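(* There is an $\left(O\!\left(\frac{T\sqrt d}{\varepsilon}\cdot\mathrm{polylog}(dT/(\delta\beta))\right),\beta\right)$-accurate $(\varepsilon,\delta)$-DP algorithm for generalized bucketized vector summation in the shuffle model. The encoder and the decoder run in time $\mathrm{poly}(ndT/\beta,\log(|Y|/(\varepsilon\delta)))$.
   Context: Generalized bucketized vector summation: $n$ users, user $i$ holds a set $Y_i\subseteq Y$ of $T$ buckets and a vector $v_i\in\mathbb{B}^d$ (closed unit ball of $\mathbb{R}^d$); the vector sum of bucket $y$ is $v_y=\sum_{i:y\in Y_i}v_i$; an estimate $\tilde v_y$ is $\eta$-accurate if $\|v_y-\tilde v_y\|<\eta$. $(\eta,\beta)$-accurate $(\varepsilon,\delta)$-DP algorithm: the encoder is $(\varepsilon,\delta)$-DP in the model, the decoder returns an estimate for any queried bucket $y$, which for each $y\in Y$ is $\eta$-accurate with probability at least $1-\beta$. One-round shuffle model: each user applies an encoder producing messages; a shuffler outputs a uniformly random permutation of all messages; $(\varepsilon,\delta)$-DP means the distribution of shuffled messages is $(\varepsilon,\delta)$-DP as a function of the input sequence (neighboring inputs differ in one user). Users and analyzer have shared public randomness. $0<\varepsilon\le O(1)$. *)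

(* Defs.v *)
From HB Require Import structures.
From mathcomp Require Import all_boot all_order all_algebra all_fingroup.
From mathcomp Require Import reals sequences exp.

Set Implicit Arguments.
Unset Strict Implicit.
Unset Printing Implicit Defensive.

Import Order.TTheory GRing.Theory Num.Theory.
Local Open Scope ring_scope.

(** * Machine model

    A real RAM.  A program uses finitely many unbounded arrays of natural
    numbers and of reals; array names are literals, cell indices are computed.
    Real arithmetic is exact and costs one step, as usual for real inputs.
    Naturals only have addition and truncated subtraction, so after t steps
    they have O(t) bits; there is no rounding from reals to naturals, so a real
    can only influence a natural through comparisons. *)

Inductive nexp : Type :=
  | NCst of nat
  | NLd of nat & nexp
  | NAdd of nexp & nexp
  | NSub of nexp & nexp.

Inductive rexp : Type :=
  | RNat of nexp
  | RLd of nat & nexp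
  | RAdd of rexp & rexp
  | RSub of rexp & rexp
  | RMul of rexp & rexp
  | RDiv of rexp & rexp.

Inductive bexp : Type :=
  | NLt of nexp & nexp
  | NEq of nexp & nexp
  | RLt of rexp & rexp
  | BNot of bexp.

Inductive cmd : Type :=
  | Skip
  | NAsg of nat & nexp & nexp    (* NAsg a i e : narr a [i] := e *)
  | RAsg of nat & nexp & rexp
  | Send of nexp                 (* emit one message *)
  | Comp of cmd & cmd
  | If of bexp & cmd & cmd
  | While of bexp & cmd.

Record state (R : Type) : Type := State {
  narr : nat -> nat -> nat;
  rarr : nat -> nat -> R;
  sent : seq nat }.

Definition upd (A : Type) (m : nat -> nat -> A) (a i : nat) (x : A) :
    nat -> nat -> A :=
  fun b j => if (b == a) && (j == i) then x else m b j.

Fixpoint neval (R : Type) (s : state R) (e : nexp) : nat :=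
  match e with
  | NCst k => k
  | NLd a i => narr s a (neval s i)
  | NAdd e1 e2 => (neval s e1 + neval s e2)%N
  | NSub e1 e2 => (neval s e1 - neval s e2)%N
  end.

Fixpoint reval (R : realType) (s : state R) (e : rexp) : R :=
  match e with
  | RNat k => (neval s k)%:R
  | RLd a i => rarr s a (neval s i)
  | RAdd e1 e2 => reval s e1 + reval s e2
  | RSub e1 e2 => reval s e1 - reval s e2
  | RMul e1 e2 => reval s e1 * reval s e2
  | RDiv e1 e2 => reval s e1 / reval s e2
  end.

Fixpoint beval (R : realType) (s : state R) (b : bexp) : bool :=
  match b with
  | NLt e1 e2 => (neval s e1 < neval s e2)%N
  | NEq e1 e2 => neval s e1 == neval s e2
  | RLt e1 e2 => reval s e1 < reval s e2
  | BNot b1 => ~~ beval s b1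
  end.

(* A configuration is the stack of commands still to be executed, together with
   the state; the machine has halted when the stack is empty.  One step costs
   one unit of time. *)
Definition step (R : realType) (c : seq cmd * state R) : seq cmd * state R :=
  let: (k, s) := c in
  match k with
  | [::] => ([::], s)
  | Skip :: k' => (k', s)
  | NAsg a i e :: k' =>
      (k', State (upd (narr s) a (neval s i) (neval s e)) (rarr s) (sent s))
  | RAsg a i e :: k' =>
      (k', State (narr s) (upd (rarr s) a (neval s i) (reval s e)) (sent s))
  | Send e :: k' =>
      (k', State (narr s) (rarr s) (rcons (sent s) (neval s e)))
  | Comp c1 c2 :: k' => (c1 :: c2 :: k', s)
  | If b c1 c2 :: k' => ((if beval s b then c1 else c2) :: k', s)
  | While b c1 :: k' =>
      (if beval s b then c1 :: While b c1 :: k' else k', s)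
  end.

Definition run (R : realType) (t : nat) (c : cmd) (s : state R) :
    seq cmd * state R :=
  iter t (@step R) ([:: c], s).

Definition halts_within (R : realType) (t : nat) (c : cmd) (s : state R) : Prop :=
  (run t c s).1 = [::].

(** * Generalized bucketized vector summation *)

(* The bucket universe Y is {0, ..., |Y|-1}. *)
Record params (R : Type) : Type := Params {
  nusers : nat;
  dim : nat;
  nbuckets : nat;   (* T, the number of buckets held by each user *)
  universe : nat;   (* |Y| *)
  eps : R;
  delta : R;
  beta : R }.

Definition admissible (R : realType) (eps0 : R) (P : params R) : Prop :=
  [/\ [/\ (0 < nusers P)%N, (0 < dim P)%N, (0 < nbuckets P)%N
        & (0 < universe P)%N],
      0 < eps P <= eps0,
      0 < delta P < 1
    & 0 < beta P < 1].

(* The library norm on row vectors is the sup norm. *)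
Definition l2norm (R : realType) (d : nat) (v : 'rV[R]_d) : R :=
  Num.sqrt (\sum_(j < d) v 0 j ^+ 2).

Record user (R : realType) (P : params R) : Type := User {
  buckets : {set 'I_(universe P)};
  vec : 'rV[R]_(dim P) }.

Definition valid_user (R : realType) (P : params R) (u : user P) : Prop :=
  #|buckets u| = nbuckets P /\ l2norm (vec u) <= 1.

Definition dataset (R : realType) (P : params R) : Type :=
  'I_(nusers P) -> user P.

Definition valid_dataset (R : realType) (P : params R) (x : dataset P) : Prop :=
  forall i, valid_user (x i).

Definition neighbors (R : realType) (P : params R) (x x' : dataset P) : Prop :=
  exists i, forall j, j != i -> x j = x' j.

Definition bucket_sum (R : realType) (P : params R) (x : dataset P)
    (y : 'I_(universe P)) : 'rV[R]_(dim P) :=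
  \sum_(i | y \in buckets (x i)) vec (x i).

(** * One-round shuffle protocols

    Natural array 0 holds n, d, T, |Y| (and, for the decoder, the number of
    messages), array 1 the user's buckets in increasing order (for the decoder,
    the queried bucket), array 2 the public random bits, array 3 the machine's
    private random bits, array 4 (decoder only) the messages.  Real array 0
    holds epsilon, delta, beta and array 1 the user's vector.  All other cells
    are 0.  The decoder leaves its estimate in real array 1. *)

Definition load (A : Type) (x0 : A) (l : seq (seq A)) : nat -> nat -> A :=
  fun a i => nth x0 (nth [::] l a) i.

Definition bits (L : nat) (t : L.-tuple bool) : seq nat := map nat_of_bool t.

Definition enc_init (R : realType) (P : params R) (L : nat)
    (pub priv : L.-tuple bool) (u : user P) : state R :=
  State
    (load 0%N [:: [:: nusers P; dim P; nbuckets P; universe P];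
                  [seq val y | y <- enum (buckets u)];
                  bits pub; bits priv])
    (load 0 [:: [:: eps P; delta P; beta P];
                [seq vec u 0 j | j <- enum 'I_(dim P)]])
    [::].

Definition dec_init (R : realType) (P : params R) (L : nat)
    (pub priv : L.-tuple bool) (msgs : seq nat) (y : 'I_(universe P)) :
    state R :=
  State
    (load 0%N [:: [:: nusers P; dim P; nbuckets P; universe P; size msgs];
                  [:: val y]; bits pub; bits priv; msgs])
    (load 0 [:: [:: eps P; delta P; beta P]])
    [::].

(* L is both the time allotted to a machine and the length of its random tapes:
   a machine halting within L steps cannot consume more than L random bits. *)

Definition messages (R : realType) (P : params R) (L : nat) (enc : cmd)
    (pub priv : L.-tuple bool) (u : user P) : seq nat :=
  sent (run L enc (enc_init pub priv u)).2.

Definition all_messages (R : realType) (P : params R) (L : nat) (enc : cmd)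
    (x : dataset P) (pub : L.-tuple bool)
    (priv : {ffun 'I_(nusers P) -> L.-tuple bool}) : seq nat :=
  flatten [seq messages enc pub (priv i) (x i) | i <- enum 'I_(nusers P)].

Definition shuffle (m : seq nat) (s : 'S_(size m)) : seq nat :=
  [seq nth 0%N m (s i) | i <- enum 'I_(size m)].

Definition estimate (R : realType) (P : params R) (L : nat) (dec : cmd)
    (pub priv : L.-tuple bool) (msgs : seq nat) (y : 'I_(universe P)) :
    'rV[R]_(dim P) :=
  \row_j rarr (run L dec (dec_init pub priv msgs y)).2 1%N j.

(* Expectation over a uniformly random element of A. *)
Definition unif (R : realType) (A : finType) (f : A -> R) : R :=
  (\sum_(a : A) f a) / #|A|%:R.

(* Expectation of F over the analyzer's view: the public randomness and the
   shuffled messages. *)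
Definition view_expectation (R : realType) (P : params R) (L : nat) (enc : cmd)
    (x : dataset P) (F : L.-tuple bool -> seq nat -> R) : R :=
  unif (fun pub : L.-tuple bool =>
  unif (fun priv : {ffun 'I_(nusers P) -> L.-tuple bool} =>
  unif (fun s : 'S_(size (all_messages enc x pub priv)) =>
    F pub (shuffle s)))).

Definition shuffle_dp (R : realType) (P : params R) (L : nat) (enc : cmd) : Prop :=
  forall x x' : dataset P, valid_dataset x -> valid_dataset x' ->
  neighbors x x' ->
  forall E : L.-tuple bool -> pred (seq nat),
    view_expectation enc x (fun pub m => (E pub m)%:R) <=
    expR (eps P) * view_expectation enc x' (fun pub m => (E pub m)%:R) + delta P.

Definition accurate (R : realType) (P : params R) (L : nat) (enc dec : cmd)
    (eta : R) : Prop :=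
  forall (x : dataset P) (y : 'I_(universe P)), valid_dataset x ->
    1 - beta P <=
    view_expectation enc x (fun (pub : L.-tuple bool) m =>
      unif (fun priv : L.-tuple bool =>
        (l2norm (bucket_sum x y - estimate dec pub priv m y) < eta)%R%:R)).

Definition enc_in_time (R : realType) (P : params R) (L : nat) (enc : cmd) : Prop :=
  forall (u : user P) (pub priv : L.-tuple bool), valid_user u ->
    halts_within L enc (enc_init pub priv u).

Definition dec_in_time (R : realType) (P : params R) (L : nat) (enc dec : cmd) :
    Prop :=
  forall (x : dataset P) (y : 'I_(universe P)) (pub dpriv : L.-tuple bool)
    (priv : {ffun 'I_(nusers P) -> L.-tuple bool})
    (s : 'S_(size (all_messages enc x pub priv))), valid_dataset x ->
    halts_within L dec (dec_init pub dpriv (shuffle s) y).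

(* poly(ndT/beta, log(|Y|/(eps delta))); the logarithm may be negative when
   eps > 1. *)
Definition time_bound (R : realType) (c : nat) (P : params R) : nat :=
  Num.truncn (c%:R *
    (1 + (nusers P * dim P * nbuckets P)%:R / beta P
       + Num.max 0 (ln ((universe P)%:R / (eps P * delta P)))) ^+ c).

(* O(T sqrt d / eps * polylog(dT/(delta beta))) *)
Definition error_bound (R : realType) (a k : nat) (P : params R) : R :=
  a%:R * ((nbuckets P)%:R * Num.sqrt (dim P)%:R / eps P)
  * (1 + ln ((dim P * nbuckets P)%:R / (delta P * beta P))) ^+ k.

(* Main.v *)
From mathcomp Require Import all_boot all_order all_algebra all_fingroup.
From mathcomp Require Import reals sequences exp.
From mathcomp Require Import zify ring lra.
Require Import Defs.

Set Implicit Arguments.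
Unset Strict Implicit.
Unset Printing Implicit Defensive.

Import Order.TTheory GRing.Theory Num.Theory.
Local Open Scope ring_scope.

(** Public randomness hashes buckets to at least 2nT/beta cells by a linear map
    over GF(2), so the queried bucket shares its cell with another one present in
    the data with probability at most beta/2.  For each of its buckets and each
    coordinate a user sends, in unary, the positive or negative part of the
    coordinate rounded at a fine scale K, under a code (cell, coordinate, sign).
    Every user also flips N private coins per code and sends the code for each
    head.  The shuffled messages then carry exactly the counts per code: data
    counts plus independent Binomial(nN, 1/2) noise.

    Privacy holds for each fixed hash: as all T buckets of a user may share a
    cell, the count vector has l2-sensitivity O(TK), whence the factor T in the
    error.  Shifting one binomial count by one changes its weight by a factor
    (1+x)/(1-x) <= exp(2x + 2x^2), where x is the normalised deviation of the
    count.  So the privacy loss is a linear form in the deviations, controlled by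
    a Chernoff bound, plus an error that is negligible once K is large.  Accuracy
    is a Chernoff bound for each coordinate.  If n * eps < 1 the permitted error
    exceeds n, and nothing is sent. *)

(** * Timed big-step semantics *)

(** The error may contain no logarithm of n, yet the number D of codes grows with n. The linear form
    in the deviations is one Chernoff event, whatever D is. Only the requirement that every count
    stay in the window where the ratio bound applies needs a union over D codes. Refining the scale
    K multiplies signal, sensitivity and noise alike, so the error is unaffected. But the admissible
    normalised deviation shrinks like the square root of 1/K while the typical one shrinks like 1/K,
    so the window fails with probability decaying like exp(-K/d). Taking K at least 2Dd thus pays
    for the union without touching the error, and K at least n keeps the total rounding error per
    coordinate below one unit. Binomial noise suits a machine whose only randomness is fair bits: it
    is sampled exactly and splits into equal shares among the users. The time may depend on 1/eps
    only through a logarithm, whereas the number of coins grows like the square of 1/eps. Once n *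
    eps is at least 1, 1/eps is at most n; this is what the silent case buys. *)

Section BigStep.
Variable R : realType.
Implicit Types (s : state R) (c : cmd) (b : bexp).
Local Open Scope nat_scope.

Inductive big : cmd -> state R -> nat -> state R -> Prop :=
  | big_skip s : big Skip s 1 s
  | big_nasg a i e s : big (NAsg a i e) s 1
      (State (upd (narr s) a (neval s i) (neval s e)) (rarr s) (sent s))
  | big_rasg a i e s : big (RAsg a i e) s 1
      (State (narr s) (upd (rarr s) a (neval s i) (reval s e)) (sent s))
  | big_send e s : big (Send e) s 1
      (State (narr s) (rarr s) (rcons (sent s) (neval s e)))
  | big_comp c1 c2 s1 t1 s2 t2 s3 :
      big c1 s1 t1 s2 -> big c2 s2 t2 s3 -> big (Comp c1 c2) s1 (t1 + t2).+1 s3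
  | big_if b c1 c2 s t s' :
      big (if beval s b then c1 else c2) s t s' -> big (If b c1 c2) s t.+1 s'
  | big_while_false b c s : ~~ beval s b -> big (While b c) s 1 s
  | big_while_true b c s t1 s1 t2 s2 : beval s b ->
      big c s t1 s1 -> big (While b c) s1 t2 s2 ->
      big (While b c) s (t1 + t2).+1 s2.

(** The stack [k] below the command is arbitrary, so the induction passes through sequencing and
    loops. The successor in the composite rules pays for unfolding the command onto the stack. *)
Lemma big_iter c s t s' : big c s t s' ->
  forall k, iter t (@step R) (c :: k, s) = (k, s').
Proof.
elim=> {c s t s'} //=.
- move=> c1 c2 s1 t1 s2 t2 s3 _ IH1 _ IH2 k.
  by rewrite -iterS iterSr /= addnC iterD IH1 IH2.
- by move=> b c1 c2 s t s' _ IH k; rewrite -iterS iterSr /= IH.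
- by move=> b c s /negbTE-> k.
- move=> b c s t1 s1 t2 s2 bs _ IH1 _ IH2 k.
  by rewrite -iterS iterSr /= bs addnC iterD IH1 IH2.
Qed.

Lemma iter_step_halted t s : iter t (@step R) ([::], s) = ([::], s).
Proof. by elim: t => //= t ->. Qed.

Lemma big_run c s t s' L : big c s t s' -> t <= L -> run L c s = ([::], s').
Proof.
move=> h tL; rewrite /run -(subnK tL) iterD (big_iter h).
exact: iter_step_halted.
Qed.

Fixpoint nwritten c : seq nat :=
  match c with
  | NAsg a _ _ => [:: a]
  | Comp c1 c2 | If _ c1 c2 => nwritten c1 ++ nwritten c2
  | While _ c1 => nwritten c1
  | _ => [::]
  end.

Fixpoint rwritten c : seq nat :=
  match c with
  | RAsg a _ _ => [:: a]
  | Comp c1 c2 | If _ c1 c2 => rwritten c1 ++ rwritten c2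
  | While _ c1 => rwritten c1
  | _ => [::]
  end.

Fixpoint silent c : bool :=
  match c with
  | Send _ => false
  | Comp c1 c2 | If _ c1 c2 => silent c1 && silent c2
  | While _ c1 => silent c1
  | _ => true
  end.

(** Whole arrays rather than cells are tracked, so that being unwritten is decided by computation on
    the program text; hence the many [isT] below. *)
Definition frame c s s' : Prop :=
  [/\ forall a, a \notin nwritten c -> narr s' a = narr s a,
      forall a, a \notin rwritten c -> rarr s' a = rarr s a
    & silent c -> sent s' = sent s].

Lemma frame_trans c s1 s2 s3 : frame c s1 s2 -> frame c s2 s3 -> frame c s1 s3.
Proof.
move=> [a1 b1 c1] [a2 b2 c2]; split=> [a h|a h|h]; first by rewrite a2 ?a1.
  by rewrite b2 ?b1.
by rewrite c2 ?c1.
Qed.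

Lemma frame_sub c c' s s' : {subset nwritten c <= nwritten c'} ->
  {subset rwritten c <= rwritten c'} -> (silent c' -> silent c) ->
  frame c s s' -> frame c' s s'.
Proof.
move=> h1 h2 h3 [f1 f2 f3]; split=> [a h|a h|h]; last exact/f3/h3.
  by apply: f1; apply: contra h => /h1.
by apply: f2; apply: contra h => /h2.
Qed.

Lemma upd_other (A : Type) (m : nat -> nat -> A) (a i : nat) (x : A) (b : nat) :
  b \notin [:: a] -> upd m a i x b = m b.
Proof. by rewrite inE /upd => /negbTE ->. Qed.

Lemma big_frame c s t s' : big c s t s' -> frame c s s'.
Proof.
elim=> {c s t s'}; try by move=> *; split=> //= a h; rewrite upd_other.
- move=> c1 c2 s1 t1 s2 t2 s3 _ f1 _ f2.
  apply: (@frame_trans _ _ s2); [apply: frame_sub f1|apply: frame_sub f2] => //=.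
  + by move=> a h; rewrite mem_cat h.
  + by move=> a h; rewrite mem_cat h.
  + by case/andP.
  + by move=> a h; rewrite mem_cat h orbT.
  + by move=> a h; rewrite mem_cat h orbT.
  + by case/andP.
- move=> b c1 c2 s t s' _; case: (beval s b) => f; apply: frame_sub f => //=.
  + by move=> a h; rewrite mem_cat h.
  + by move=> a h; rewrite mem_cat h.
  + by case/andP.
  + by move=> a h; rewrite mem_cat h orbT.
  + by move=> a h; rewrite mem_cat h orbT.
  + by case/andP.
- by move=> b c s t1 s1 t2 s2 _ _ f1 _ f2; apply: frame_trans f2.
Qed.

(** A step emits at most one message, so the encoder's time also bounds the length of the decoder's
    input. *)
Lemma big_size_sent c s t s' : big c s t s' -> size (sent s') <= size (sent s) + t.
Proof. by elim=> {c s t s'} //= *; rewrite ?size_rcons; lia. Qed.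

(** Total correctness with a budget: [big] counts steps exactly, but only an upper bound is carried
    through the program proofs. *)
Definition wp c (B : nat) (Q : state R -> Prop) s : Prop :=
  exists t s', [/\ big c s t s', t <= B & Q s'].

Lemma wp_weaken c B B' (Q Q' : state R -> Prop) s : B <= B' ->
  (forall s', frame c s s' -> Q s' -> Q' s') -> wp c B Q s -> wp c B' Q' s.
Proof.
move=> hB hQ [t [s' [h1 h2 h3]]]; exists t, s'; split=> //; first by lia.
by apply: hQ => //; apply: big_frame h1.
Qed.

Lemma wp_skip B (Q : state R -> Prop) s : 0 < B -> Q s -> wp Skip B Q s.
Proof. by exists 1, s; split=> //; constructor. Qed.

Lemma wp_nasg a i e B (Q : state R -> Prop) s : 0 < B ->
  Q (State (upd (narr s) a (neval s i) (neval s e)) (rarr s) (sent s)) ->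
  wp (NAsg a i e) B Q s.
Proof. by move=> ? h; do 2!eexists; split; [constructor| |exact: h]. Qed.

Lemma wp_rasg a i e B (Q : state R -> Prop) s : 0 < B ->
  Q (State (narr s) (upd (rarr s) a (neval s i) (reval s e)) (sent s)) ->
  wp (RAsg a i e) B Q s.
Proof. by move=> ? h; do 2!eexists; split; [constructor| |exact: h]. Qed.

Lemma wp_send e B (Q : state R -> Prop) s : 0 < B ->
  Q (State (narr s) (rarr s) (rcons (sent s) (neval s e))) ->
  wp (Send e) B Q s.
Proof. by move=> ? h; do 2!eexists; split; [constructor| |exact: h]. Qed.

(** The second command receives the frame of the first, so specifications need not list what they
    preserve. *)
Lemma wp_comp B1 c1 c2 B (Q : state R -> Prop) s : B1 < B ->
  wp c1 B1 (fun s' => frame c1 s s' -> wp c2 (B - B1.+1) Q s') s ->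
  wp (Comp c1 c2) B Q s.
Proof.
move=> hB [t [s' [h1 h2 h3]]]; have [t' [s'' [h4 h5 h6]]] := h3 (big_frame h1).
by exists (t + t').+1, s''; split; [exact: big_comp h1 h4|lia|].
Qed.

Lemma wp_if b c1 c2 B (Q : state R -> Prop) s : 0 < B ->
  wp (if beval s b then c1 else c2) B.-1 Q s -> wp (If b c1 c2) B Q s.
Proof.
move=> hB [t [s' [h1 h2 h3]]]; exists t.+1, s'; split=> //; last by lia.
exact: big_if.
Qed.

(** The frame is relative to the state before the loop, so an invariant mentions only what the body
    writes. Each round pays one step for its guard, and the outer successor pays for the final
    failing test. *)
Lemma wp_for N Bb (Inv : nat -> state R -> Prop) b c s0 :
  Inv 0 s0 ->
  (forall i s, i < N -> frame c s0 s -> Inv i s ->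
     beval s b /\ wp c Bb (Inv i.+1) s) ->
  (forall s, frame c s0 s -> Inv N s -> ~~ beval s b) ->
  wp (While b c) (N * Bb.+1).+1 (Inv N) s0.
Proof.
move=> I0 IS IN.
suff main k s : k <= N -> frame c s0 s -> Inv (N - k) s ->
    wp (While b c) (k * Bb.+1).+1 (Inv N) s.
  by apply: main => //; rewrite subnn.
elim: k s => [|k IH] s kN fr; first rewrite subn0 => Is.
  exists 1, s; split=> //; apply: big_while_false; exact: IN.
have lN : N - k.+1 < N by lia.
move=> Is; have [bs [t [s1 [h1 h2 h3]]]] := IS _ s lN fr Is.
have e : (N - k.+1).+1 = N - k by lia.
rewrite e in h3.
have [t' [s2 [h4 h5 h6]]] :=
  IH s1 (ltnW kN) (frame_trans fr (big_frame h1)) h3.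
exists (t + t').+1, s2; split=> //; last by rewrite mulSn; lia.
exact: big_while_true h4.
Qed.

End BigStep.

(** * Iteration counts: ceilings and binary logarithms obtained by comparisons *)

Section NatCeil.
Variable R : realType.

(* The number of iterations of a loop [while r < x do r := r + 1]. *)
Definition natceil (x : R) : nat := if 0 < x then `|Num.ceil x|%N else 0%N.

(** The machine cannot round a real; it can only test a counter against it. This equivalence
    therefore decides every guard whose bound is real. *)
Lemma ltn_natceil (x : R) r : (r < natceil x)%N = (r%:R < x).
Proof.
rewrite /natceil; case: ltP => x0; last first.
  by apply/esym/negbTE; rewrite -leNgt (le_trans x0).
have c0 : (0 < Num.ceil x)%R by rewrite ceil_gt0.
rewrite pmulrn -ceil_gt_int.
by move: c0; case: (Num.ceil x) => // k _; rewrite absz_nat.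
Qed.

Lemma natceil_ge (x : R) : x <= (natceil x)%:R.
Proof. by rewrite leNgt -ltn_natceil ltnn. Qed.

Lemma natceil_le (x : R) r : (natceil x <= r)%N = (x <= r%:R).
Proof. by rewrite leqNgt ltn_natceil -leNgt. Qed.

Lemma natceil_eq0 (x : R) : x <= 0 -> natceil x = 0%N.
Proof. by move=> x0; apply/eqP; rewrite -leqn0 natceil_le. Qed.

Lemma natceil_lt (x : R) : 0 <= x -> (natceil x)%:R < x + 1.
Proof.
move=> x0; case E: (natceil x) => [|k]; first by lra.
have : (k < natceil x)%N by rewrite E.
by rewrite ltn_natceil -natr1; lra.
Qed.

Lemma ltn_up_log (e c : nat) : (e < up_log 2 c)%N = (2 ^ e < c)%N.
Proof.
apply/idP/idP; rewrite !ltnNge; apply: contra => h; first exact: up_log_min.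
exact: leq_trans (@up_logP 2 c isT) (leq_pexp2l _ h).
Qed.

(** How often 1 must be doubled to reach [x], which is the iteration count of [doubling]. *)
Definition log2up (x : R) : nat := up_log 2 (natceil x).

Lemma ltn_log2up (x : R) e : (e < log2up x)%N = ((2 ^ e)%N%:R < x).
Proof. by rewrite ltn_up_log ltn_natceil. Qed.

Lemma log2up_ge (x : R) : x <= (2 ^ log2up x)%N%:R.
Proof. by rewrite leNgt -ltn_log2up ltnn. Qed.
End NatCeil.

(** * The protocol *)

(* Natural arrays 5 and up are scratch space. Array 5 holds powers of two, and
   cell 0 of the others a scalar: 6 the number of hash bits, 7 the logarithm of
   2/delta, 8 the bit length of a bucket, 11 the code to send, 12 the number of
   codes. *)

Definition nvar (a : nat) : nexp := NLd a (NCst 0).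
Definition nset (a : nat) (e : nexp) : cmd := NAsg a (NCst 0) e.
Definition incr (a k : nat) : cmd := nset a (NAdd (nvar a) (NCst k)).
Definition rcst (k : nat) : rexp := RNat (NCst k).

Definition n_exp : rexp := RNat (NLd 0 (NCst 0)).
Definition d_exp : rexp := RNat (NLd 0 (NCst 1)).
Definition T_exp : rexp := RNat (NLd 0 (NCst 2)).
Definition eps_exp : rexp := RLd 0 (NCst 0).
Definition delta_exp : rexp := RLd 0 (NCst 1).
Definition beta_exp : rexp := RLd 0 (NCst 2).

Definition cells_exp : rexp := RDiv (RMul (rcst 2) (RMul n_exp T_exp)) beta_exp.
(** There are at most 8dnT/beta codes, so the factor 32 d^2 makes the scale at least 2d times their
    number, with a factor 2 to spare. It also dominates n and d. *)
Definition scale_exp : rexp :=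
  RDiv (RMul (RMul (rcst 32) (RMul d_exp d_exp)) (RMul n_exp T_exp)) beta_exp.
(** Up to a constant, the l2-sensitivity TK divided by eps/(1+eps), a privacy level below both eps
    and 1 that needs no case distinction. *)
Definition sens_exp : rexp :=
  RMul (RMul T_exp scale_exp) (RAdd (rcst 1) (RDiv (rcst 1) eps_exp)).
(** Each user's share of the flips for one code. The constant 32 * 64 = 16 * 8 * 16 comes from the
    Chernoff exponent of the linear form: threshold em/4, factor 8, sensitivity 4TK. *)
Definition coins_exp : rexp :=
  RDiv (RMul (RMul (rcst 32) (rcst 64)) (RMul (RMul sens_exp sens_exp) (RNat (nvar 7))))
       n_exp.

Definition doubling (a : nat) (bound : rexp) : cmd :=
  Comp (NAsg 5 (NCst 0) (NCst 1)) (Comp (nset a (NCst 0))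
    (While (RLt (RNat (NLd 5 (nvar a))) bound)
      (Comp (NAsg 5 (NAdd (nvar a) (NCst 1)) (NAdd (NLd 5 (nvar a)) (NLd 5 (nvar a))))
            (incr a 1)))).

(* Parity of the public mask restricted to the binary digits of the bucket. *)
Definition hash_bit : cmd :=
  While (NLt (NCst 0) (nvar 16))
    (Comp (nset 16 (NSub (nvar 16) (NCst 1)))
    (Comp (If (NLt (nvar 15) (NLd 5 (nvar 16))) Skip
             (Comp (nset 15 (NSub (nvar 15) (NLd 5 (nvar 16))))
                   (If (NEq (nvar 14) (NLd 2 (nvar 10)))
                       (nset 14 (NCst 0)) (nset 14 (NCst 1)))))
          (incr 10 1))).

(** Naturals cannot be multiplied, so the weight in array 12 starts at 2d instead of 1 and is
    doubled once per hash bit. Array 11 then ends at 2d times the cell, and array 12 at the number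
    of codes. The mask position in array 10 runs on from one hash bit to the next, giving each its
    own block of public bits. *)
Definition hash : cmd :=
  Comp (nset 10 (NCst 0)) (Comp (nset 11 (NCst 0))
  (Comp (nset 12 (NAdd (NLd 0 (NCst 1)) (NLd 0 (NCst 1)))) (Comp (nset 13 (NCst 0))
  (While (NLt (nvar 13) (nvar 6))
    (Comp (nset 14 (NCst 0)) (Comp (nset 15 (NLd 1 (nvar 9)))
    (Comp (nset 16 (nvar 8)) (Comp hash_bit
    (Comp (If (NEq (nvar 14) (NCst 0)) Skip (nset 11 (NAdd (nvar 11) (nvar 12))))
    (Comp (nset 12 (NAdd (nvar 12) (nvar 12))) (incr 13 1))))))))))).

Definition send_copies (code : nexp) (bound : rexp) : cmd :=
  Comp (nset 18 (NCst 0))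
    (While (RLt (RNat (nvar 18)) bound) (Comp (Send code) (incr 18 1))).

Definition coordinate_exp : rexp := RLd 1 (nvar 17).

(** The sign needs no test: a loop with a nonpositive bound stops at once, so at most one of the two
    codes of a coordinate is sent. *)
Definition send_vector : cmd :=
  Comp (nset 17 (NCst 0))
  (While (NLt (nvar 17) (NLd 0 (NCst 1)))
    (Comp (send_copies (nvar 11) (RMul coordinate_exp scale_exp))
    (Comp (send_copies (NAdd (nvar 11) (NCst 1))
             (RMul (RSub (rcst 0) coordinate_exp) scale_exp))
    (Comp (incr 11 2) (incr 17 1))))).

Definition send_data : cmd :=
  Comp (nset 9 (NCst 0))
  (While (NLt (nvar 9) (NLd 0 (NCst 2))) (Comp hash (Comp send_vector (incr 9 1)))).

(** Array 12 still holds the number of codes, left by the last [hash]; this relies on T being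
    positive. Position 19 advances through the private tape without being reset, so no bit is used
    twice. *)
Definition send_noise : cmd :=
  Comp (nset 19 (NCst 0)) (Comp (nset 20 (NCst 0))
  (While (NLt (nvar 20) (nvar 12))
    (Comp (nset 18 (NCst 0))
    (Comp (While (RLt (RNat (nvar 18)) coins_exp)
             (Comp (If (NEq (NLd 3 (nvar 19)) (NCst 0)) Skip (Send (nvar 20)))
             (Comp (incr 19 1) (incr 18 1))))
          (incr 20 1))))).

Definition encoder : cmd :=
  If (RLt (RMul n_exp eps_exp) (rcst 1)) Skip
    (Comp (doubling 6 cells_exp)
    (Comp (doubling 7 (RDiv (rcst 2) delta_exp))
    (Comp (doubling 8 (RNat (NLd 0 (NCst 3))))
    (Comp send_data send_noise)))).

(** The two codes of a coordinate carry noise with the same mean, so their difference cancels it and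
    no expectation has to be subtracted. *)
Definition tally : cmd :=
  While (NLt (nvar 18) (NLd 0 (NCst 4)))
    (Comp (If (NEq (NLd 4 (nvar 18)) (nvar 11))
              (RAsg 1 (nvar 17) (RAdd (RLd 1 (nvar 17)) (rcst 1)))
              (If (NEq (NLd 4 (nvar 18)) (NAdd (nvar 11) (NCst 1)))
                  (RAsg 1 (nvar 17) (RSub (RLd 1 (nvar 17)) (rcst 1))) Skip))
          (incr 18 1)).

Definition decoder : cmd :=
  If (RLt (RMul n_exp eps_exp) (rcst 1)) Skip
    (Comp (doubling 6 cells_exp)
    (Comp (doubling 8 (RNat (NLd 0 (NCst 3))))
    (Comp (nset 9 (NCst 0)) (Comp hash
    (Comp (nset 17 (NCst 0))
    (While (NLt (nvar 17) (NLd 0 (NCst 1)))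
      (Comp (nset 18 (NCst 0)) (Comp tally
      (Comp (RAsg 1 (nvar 17) (RDiv (RLd 1 (nvar 17)) scale_exp))
      (Comp (incr 11 2) (incr 17 1))))))))))).

(** Binary digit [e], phrased as the comparison that the program makes once the higher digits have
    been subtracted. *)
Definition ybit (y e : nat) : bool := (2 ^ e <= y %% 2 ^ e.+1)%N.

(** Row [i] of a random matrix over GF(2) applied to the digits of [y], taken from the most
    significant down, the order in which subtraction exposes them. *)
Definition hbit (pub : nat -> bool) (ell y i : nat) : bool :=
  \big[addb/false]_(k < ell) (ybit y (ell - k.+1) && pub (i * ell + k)%N).

Definition hcell (pub : nat -> bool) (ell kh y : nat) : nat :=
  (\sum_(i < kh) hbit pub ell y i * 2 ^ i)%N.

(** * Total correctness and step counts of the program fragments *)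

Section ProgramSpecs.
Variable R : realType.
Implicit Types s : state R.
Local Open Scope nat_scope.

Ltac assign := apply: (@wp_comp _ 1); [lia | apply: wp_nasg => // _].

Lemma doubling_spec a bound (b : R) s : a \notin [:: 5] ->
  (forall s', frame (doubling a bound) s s' -> reval s' bound = b) ->
  wp (doubling a bound) ((log2up b * 4).+1 + 4)
    (fun s' => narr s' a 0 = log2up b /\
       (forall e, e <= log2up b -> narr s' 5 e = 2 ^ e)) s.
Proof.
rewrite inE => /negbTE a5 hb; have a5' : (5 == a) = false by rewrite eq_sym.
assign; assign.
set s1 := State _ _ _.
have f1 : frame (doubling a bound) s s1.
  by split=> // b'; rewrite !inE /= => /norP [h1 /norP [h2 _]];
    rewrite !upd_other // inE.
apply: wp_weaken; last first.
  apply: (@wp_for _ (log2up b) 3 (fun k s' => narr s' a 0 = k /\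
    (forall e, e <= k -> narr s' 5 e = 2 ^ e))).
  - split; first by rewrite /s1 /= /upd eqxx.
    by case=> // _; rewrite /s1 /= /upd a5'.
  - move=> k s' kN fr [ha hp]; split.
      have fr' : frame (doubling a bound) s s'.
        apply: frame_trans f1 _; apply: frame_sub fr => //=.
        by move=> x hx; rewrite !inE; move: hx; rewrite !inE => /orP[] ->;
          rewrite ?orbT.
      by rewrite /= (hb s' fr') ha hp // -ltn_log2up.
    assign; apply: wp_nasg => //=.
    rewrite /upd /= eqxx /= a5 a5' /= ha addn1; split=> // e he.
    case: eqP => [->|ne] /=; last by apply: hp; lia.
    by rewrite hp // expnS mul2n addnn.
  - move=> s' fr [ha hp].
    have fr' : frame (doubling a bound) s s'.
      apply: frame_trans f1 _; apply: frame_sub fr => //=.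
      by move=> x hx; rewrite !inE; move: hx; rewrite !inE => /orP[] ->;
        rewrite ?orbT.
    by rewrite /= (hb s' fr') ha hp // -ltn_log2up ltnn.
- by [].
- lia.
Qed.

Lemma modn_pow2S y e : y %% 2 ^ e.+1 = y %% 2 ^ e + ybit y e * 2 ^ e.
Proof.
have h : y %% 2 ^ e = (y %% 2 ^ e.+1) %% 2 ^ e.
  by rewrite modn_dvdm // expnS dvdn_mull.
have lt : y %% 2 ^ e.+1 < 2 ^ e.+1 by rewrite ltn_mod expn_gt0.
rewrite /ybit h; case: leqP => [le|lt2] /=; last by rewrite (modn_small lt2); lia.
have -> : (y %% 2 ^ e.+1) %% 2 ^ e = y %% 2 ^ e.+1 - 2 ^ e.
  rewrite -[in LHS](subnK le) modnDr modn_small //.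
  by move: lt; rewrite expnS; lia.
by lia.
Qed.

Lemma hash_bit_spec (pub : nat -> bool) ell y i s :
  narr s 16 0 = ell -> narr s 15 0 = y -> narr s 14 0 = 0 ->
  narr s 10 0 = i * ell ->
  (forall e, e < ell -> narr s 5 e = 2 ^ e) -> y < 2 ^ ell ->
  (forall p, narr s 2 p = pub p) ->
  wp hash_bit (ell * 16).+1
    (fun s' => narr s' 14 0 = hbit pub ell y i /\ narr s' 10 0 = i.+1 * ell) s.
Proof.
move=> h16 h15 h14 h10 h5 hy h2.
apply: wp_weaken; last first.
  apply: (@wp_for _ ell 15 (fun k s' => [/\ narr s' 16 0 = ell - k,
    narr s' 15 0 = y %% 2 ^ (ell - k),
    narr s' 14 0 = \big[addb/false]_(k' < k)
        (ybit y (ell - k'.+1) && pub (i * ell + k'))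
    & narr s' 10 0 = i * ell + k])).
  - by rewrite subn0 modn_small // big_ord0 addn0.
  - move=> k s' kN [f _ _] [i16 i15 i14 i10].
    have e5 := f 5 isT; have e2 := f 2 isT.
    split; first by rewrite /= i16; lia.
    assign; apply: (@wp_comp _ 6); first by [].
    have hk : ell - k = (ell - k.+1).+1 by lia.
    have hk' : ell - k - 1 = ell - k.+1 by lia.
    have lk : ell - k.+1 < ell by lia.
    apply: wp_if => //=; rewrite /upd /= i16 i15 e5 hk' h5 //.
    rewrite hk; have E := modn_pow2S y (ell - k.+1).
    case: ltnP => hl.
      have yb : ybit y (ell - k.+1) = false by rewrite /ybit leqNgt hl.
      apply: wp_skip => // _; apply: wp_nasg => //=; split=> //=.
      + by rewrite /upd /= i15 hk E yb addn0.
      + by rewrite /upd /= i14 big_ord_recr /= yb /= addbF.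
      + by rewrite /upd /= i10; lia.
    have yb : ybit y (ell - k.+1) = true by rewrite /ybit hl.
    apply: (@wp_comp _ 1) => //; apply: wp_nasg => // _.
    apply: wp_if => //=; rewrite /upd /= ?i14 ?i10 ?e2 ?h2.
    have E2 : y %% 2 ^ (ell - k) - 2 ^ (ell - k.+1) = y %% 2 ^ (ell - k.+1).
      by rewrite hk E yb mul1n addnK.
    (* The machine has no exclusive or; the updated parity is a disequality test. *)
    have P2 : nat_of_bool (\big[addb/false]_(k' < k.+1)
        (ybit y (ell - k'.+1) && pub (i * ell + k'))) =
      (\big[addb/false]_(k' < k) (ybit y (ell - k'.+1) && pub (i * ell + k'))
        != pub (i * ell + k)).
      by rewrite big_ord_recr /= yb; case: (\big[_/_]_(_ < _) _); case: (pub _).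
    case: eqP => hpar; apply: wp_nasg => // _; apply: wp_nasg => //=;
      rewrite /upd /= ?i16 ?i15 ?i10 ?hk' ?e5 ?h5 ?E2 ?P2 ?addn1 ?addnS //; split=> //.
      by move: hpar; case: (\big[_/_]_(_ < _) _); case: (pub _).
    by move: hpar; case: (\big[_/_]_(_ < _) _); case: (pub _).
  - by move=> s' _ [i16 _ _ _]; rewrite /= i16 subnn.
- by move=> s' _ [_ _ -> ->]; rewrite mulSnr.
- by [].
Qed.


Lemma hash_spec (pub : nat -> bool) d ell kh y s :
  narr s 1 (narr s 9 0) = y -> narr s 8 0 = ell -> narr s 6 0 = kh ->
  narr s 0 1 = d ->
  (forall e, e <= ell -> narr s 5 e = 2 ^ e) -> y < 2 ^ ell ->
  (forall p, narr s 2 p = pub p) ->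
  wp hash (kh * (ell * 16 + 21) + 10)
    (fun s' => narr s' 11 0 = hcell pub ell kh y * d.*2 /\
               narr s' 12 0 = 2 ^ kh * d.*2) s.
Proof.
move=> h1 h8 h6 h0 h5 hy h2.
assign; assign; assign; assign.
set s1 := State _ _ _.
have e1 : forall a, a \notin [:: 10; 11; 12; 13] -> narr s1 a = narr s a.
  by move=> a; rewrite !inE => /norP[h /norP[h' /norP[h'' h''']]];
    rewrite /s1 /= !upd_other // inE.
apply: wp_weaken; last first.
  apply: (@wp_for _ kh (ell * 16 + 18) (fun i s' => [/\ narr s' 13 0 = i,
    narr s' 11 0 = hcell pub ell i y * d.*2,
    narr s' 12 0 = 2 ^ i * d.*2
    & narr s' 10 0 = i * ell])).
  - by split; rewrite ?/s1 //= /upd /= ?h0 /hcell ?big_ord0 // mul1n addnn.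
  - move=> i s' ik [f _ _] [i13 i11 i12 i10].
    split.
      by rewrite /= (f 6 isT) e1 // h6 i13.
    assign; assign; assign.
    apply: (@wp_comp _ (ell * 16).+1); first by lia.
    apply: wp_weaken; last first.
      apply: (@hash_bit_spec pub ell y i); rewrite //= /upd /=.
      + by rewrite (f 8 isT) e1.
      + by rewrite (f 1 isT) (f 9 isT) !e1.
      + by move=> e he; rewrite (f 5 isT) e1 // h5 // ltnW.
      + by move=> p; rewrite (f 2 isT) e1.
    + move=> s2 [f2 _ _] [h14 h10] _.
      have g11 : narr s2 11 0 = hcell pub ell i y * d.*2 by rewrite (f2 11 isT).
      have g12 : narr s2 12 0 = 2 ^ i * d.*2 by rewrite (f2 12 isT).
      have g13 : narr s2 13 0 = i by rewrite (f2 13 isT).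
      apply: (@wp_comp _ 2); first by lia.
      apply: wp_if => //=; rewrite h14.
      have hS : hcell pub ell i.+1 y * d.*2 =
          hcell pub ell i y * d.*2 + hbit pub ell y i * (2 ^ i * d.*2).
        by rewrite /hcell big_ord_recr /= mulnDl mulnA.
      have hE : 2 ^ i * d.*2 + 2 ^ i * d.*2 = 2 ^ i.+1 * d.*2.
        by rewrite addnn -mul2n mulnA expnS.
      case hb : (hbit pub ell y i) hS => /= hS.
        apply: wp_nasg => // _; assign; apply: wp_nasg; first by lia.
        by split; rewrite /= /upd //= ?g11 ?g12 ?g13 ?hS ?mul1n ?addn1 ?hE.
      rewrite mul0n addn0 in hS.
      apply: wp_skip => // _; assign; apply: wp_nasg; first by lia.
      by split; rewrite /= /upd //= ?g11 ?g12 ?g13 ?hS ?mul1n ?addn1 ?hE.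
    + by [].
  - by move=> s' [f _ _] [i13 _ _ _]; rewrite /= (f 6 isT) e1 // h6 i13 ltnn.
- by move=> s' _ [].
- by lia.
Qed.

Lemma send_copies_spec code bound c (b : R) s :
  (forall s', frame (send_copies code bound) s s' -> neval s' code = c) ->
  (forall s', frame (send_copies code bound) s s' -> reval s' bound = b) ->
  wp (send_copies code bound) (natceil b * 4 + 3)
    (fun s' => forall x, count_mem x (sent s') =
       count_mem x (sent s) + (x == c) * natceil b) s.
Proof.
move=> hc hb; assign; set s1 := State _ _ _.
have f1 : frame (send_copies code bound) s s1.
  by split=> // a; rewrite !inE => /norP[h _]; rewrite /s1 /= upd_other // inE.
have f2 s' : frame (Comp (Send code) (incr 18 1)) s1 s' ->
  frame (send_copies code bound) s s'.
  by move=> fr; apply: frame_trans f1 _; apply: frame_sub fr => //= x;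
     rewrite !inE => ->.
apply: wp_weaken; last first.
  apply: (@wp_for _ (natceil b) 3 (fun k s' => narr s' 18 0 = k /\
     forall x, count_mem x (sent s') = count_mem x (sent s) + (x == c) * k)).
  - by split=> // x; rewrite muln0 addn0.
  - move=> k s' kb fr [i18 cnt].
    have fr' := f2 _ fr.
    split; first by rewrite /= i18 (hb _ fr') -ltn_natceil.
    apply: (@wp_comp _ 1) => //; apply: wp_send => //= _.
    apply: wp_nasg => //=; rewrite /upd /= i18 addn1; split=> // x.
    by rewrite -cats1 count_cat /= cnt (hc _ fr') eq_sym; case: eqP => _ /=; lia.
  - by move=> s' fr [i18 _]; rewrite /= i18 (hb _ (f2 _ fr)) -ltn_natceil ltnn.
- by move=> s' _ [].
- by lia.
Qed.

(* Entry [2j] of the discretised vector is the positive part of coordinate [j],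
   entry [2j+1] its negative part. *)
Definition entry (v : nat -> R) (K : R) (e : nat) : nat :=
  natceil ((if odd e then - v e./2 else v e./2) * K)%R.

Lemma reval_scale s s' : narr s' 0 = narr s 0 -> rarr s' 0 = rarr s 0 ->
  reval s' scale_exp = reval s scale_exp.
Proof. by move=> /= -> ->. Qed.

Lemma send_vector_spec (v : nat -> R) K d base kmax s :
  narr s 11 0 = base -> narr s 0 1 = d -> (forall j, rarr s 1 j = v j) ->
  reval s scale_exp = K -> (forall e, e < d.*2 -> entry v K e <= kmax) ->
  wp send_vector (d * (kmax * 8 + 20) + 3)
    (fun s' => forall x, count_mem x (sent s') = count_mem x (sent s) +
       \sum_(e < d.*2) (x == base + e) * entry v K e) s.
Proof.
move=> h11 h0 hv hK hmax; assign; set s1 := State _ _ _.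
apply: wp_weaken; last first.
  apply: (@wp_for _ d (kmax * 8 + 18) (fun j s' => [/\ narr s' 17 0 = j,
     narr s' 11 0 = base + j.*2 &
     forall x, count_mem x (sent s') = count_mem x (sent s) +
       \sum_(e < j.*2) (x == base + e) * entry v K e])).
  - by split=> //= [|x]; rewrite ?addn0 // big_ord0 addn0.
  - move=> j s' jd [f fR _] [i17 i11 cnt].
    have f0 : narr s' 0 = narr s 0 := f 0 isT.
    have fR0 : rarr s' 0 = rarr s 0 := fR 0 isT.
    have fR1 j' : rarr s' 1 j' = v j' by rewrite (fR 1 isT) /= hv.
    split; first by rewrite /= i17 f0 h0.
    have lt1 : j.*2 < d.*2 by rewrite ltn_double.
    have lt2 : j.*2.+1 < d.*2 by rewrite -doubleS in lt1 *; lia.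
    have Ks' : reval s' scale_exp = K.
      by rewrite (@reval_scale s).
    have hm1 := hmax _ lt1; have hm2 := hmax _ lt2.
    apply: (@wp_comp _ (kmax * 4 + 3)); first by lia.
    apply: wp_weaken; last first.
      apply: (@send_copies_spec _ _ (base + j.*2) (v j * K)%R) => s2 [g gR _] /=.
        by rewrite (g 11 isT).
      by rewrite -[X in (_ * X)%R]/(reval s2 scale_exp) (@reval_scale s') ?(g 0 isT)
        ?(gR 0 isT) // Ks' (gR 1 isT) (g 17 isT) i17 fR1.
    + move=> s2 [g gR _] cnt2 _.
      apply: (@wp_comp _ (kmax * 4 + 3)); first by lia.
      apply: wp_weaken; last first.
        apply: (@send_copies_spec _ _ (base + j.*2.+1) ((- v j) * K)%R) =>
           s3 [g' gR' _] /=.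
          by rewrite (g' 11 isT) (g 11 isT) i11; lia.
        by rewrite -[X in (_ * X)%R]/(reval s3 scale_exp) (@reval_scale s') ?(g' 0 isT)
          ?(gR' 0 isT) ?(g 0 isT) ?(gR 0 isT) // Ks' (gR' 1 isT) (g' 17 isT) (gR 1 isT)
          (g 17 isT) i17 fR1 sub0r.
      * move=> s3 [g' gR' _] cnt3 _.
        have k17 : narr s3 17 0 = j by rewrite (g' 17 isT) (g 17 isT).
        have k11 : narr s3 11 0 = base + j.*2 by rewrite (g' 11 isT) (g 11 isT).
        assign; apply: wp_nasg; first by lia.
        split; rewrite /= /upd /= ?k17 ?k11; [lia|lia|move=> x].
        by rewrite cnt3 cnt2 cnt !big_ord_recr /= /entry /= odd_double /= doubleK
          uphalf_double !addnA.
      * by rewrite leq_add2r leq_mul2r; move: hm2;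
          rewrite /entry /= odd_double uphalf_double.
    + by rewrite leq_add2r leq_mul2r; move: hm1; rewrite /entry odd_double doubleK.
  - move=> s' [f _ _] [i17 _ _]; have f0 : narr s' 0 = narr s 0 := f 0 isT.
    by rewrite /= i17 f0 h0 ltnn.
- by move=> s' _ [].
- by lia.
Qed.


Definition hash_time (kh ell : nat) : nat := kh * (ell * 16 + 21) + 10.
Definition vector_time (d kmax : nat) : nat := d * (kmax * 8 + 20) + 3.

Lemma send_data_spec (pub : nat -> bool) (v : nat -> R) (ys : nat -> nat)
    K d T ell kh kmax s :
  (forall t, narr s 1 t = ys t) -> narr s 8 0 = ell -> narr s 6 0 = kh ->
  narr s 0 1 = d -> narr s 0 2 = T ->
  (forall e, e <= ell -> narr s 5 e = 2 ^ e) ->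
  (forall t, t < T -> ys t < 2 ^ ell) -> (forall p, narr s 2 p = pub p) ->
  (forall j, rarr s 1 j = v j) -> reval s scale_exp = K ->
  (forall e, e < d.*2 -> entry v K e <= kmax) ->
  wp send_data (T * (hash_time kh ell + vector_time d kmax + 6) + 3)
    (fun s' => (0 < T -> narr s' 12 0 = 2 ^ kh * d.*2) /\
       forall x, count_mem x (sent s') = count_mem x (sent s) +
       \sum_(t < T) \sum_(e < d.*2)
          (x == hcell pub ell kh (ys t) * d.*2 + e) * entry v K e) s.
Proof.
move=> h1 h8 h6 h0d h0T h5 hy h2 hv hK hmax; assign; set s1 := State _ _ _.
apply: wp_weaken; last first.
  apply: (@wp_for _ T (hash_time kh ell + vector_time d kmax + 5)
    (fun t s' => [/\ narr s' 9 0 = t,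
       0 < t -> narr s' 12 0 = 2 ^ kh * d.*2 &
       forall x, count_mem x (sent s') = count_mem x (sent s) +
       \sum_(t' < t) \sum_(e < d.*2)
         (x == hcell pub ell kh (ys t') * d.*2 + e) * entry v K e])).
  - by split=> // x; rewrite big_ord0 addn0.
  - move=> t s' tT [f fR _] [i9 i12 cnt].
    have f0 : narr s' 0 = narr s 0 := f 0 isT.
    have f1 : narr s' 1 = narr s 1 := f 1 isT.
    have f2 : narr s' 2 = narr s 2 := f 2 isT.
    have f5 : narr s' 5 = narr s 5 := f 5 isT.
    have f6 : narr s' 6 = narr s 6 := f 6 isT.
    have f8 : narr s' 8 = narr s 8 := f 8 isT.
    have fR0 : rarr s' 0 = rarr s 0 := fR 0 isT.
    have fR1 : rarr s' 1 = rarr s 1 := fR 1 isT.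
    split; first by rewrite /= i9 f0 h0T.
    apply: (@wp_comp _ (hash_time kh ell)); first by lia.
    apply: wp_weaken; last first.
      apply: (@hash_spec pub d ell kh (ys t)).
      + by rewrite f1 i9 h1.
      + by rewrite f8.
      + by rewrite f6.
      + by rewrite f0.
      + by rewrite f5.
      + exact: hy.
      + by move=> p; rewrite f2.
    + move=> s2 [g gR gs] [g11 g12] _.
      apply: (@wp_comp _ (vector_time d kmax)); first by lia.
      apply: wp_weaken; last first.
        apply: (@send_vector_spec v K d _ kmax _ g11).
        * by rewrite (g 0 isT) f0.
        * by move=> j; rewrite (gR 1 isT) fR1 hv.
        * by rewrite (@reval_scale s) // ?(g 0 isT) ?(gR 0 isT).
        * exact: hmax.
      * move=> s3 [k kR _] cnt3 _.
        apply: wp_nasg; first by lia.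
        split=> [| |x]; rewrite /= /upd /=.
        -- by rewrite (k 9 isT) (g 9 isT) i9 addn1.
        -- by rewrite (k 12 isT) g12.
        -- by rewrite cnt3 gs // cnt big_ord_recr /= addnA.
      * by [].
    + by [].
  - move=> s' [f _ _] [i9 _ _]; have f0 : narr s' 0 = narr s 0 := f 0 isT.
    by rewrite /= i9 f0 h0T ltnn.
- by move=> s' _ [].
- by lia.
Qed.

Lemma send_noise_spec (priv : nat -> bool) D N (b : R) s :
  (forall p, narr s 3 p = priv p) -> narr s 12 0 = D ->
  reval s coins_exp = b -> natceil b = N ->
  wp send_noise (D * (N * 9 + 9) + 6)
    (fun s' => forall x, count_mem x (sent s') = count_mem x (sent s) +
       \sum_(p < D * N) ((p %/ N == x) && priv p)) s.
Proof.
move=> h3 h12 hb hN; assign; assign; set s1 := State _ _ _.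
have coinsE s' : narr s' 0 = narr s 0 -> narr s' 7 = narr s 7 ->
    rarr s' 0 = rarr s 0 -> reval s' coins_exp = b.
  by rewrite -hb /= => -> -> ->.
apply: wp_weaken; last first.
  apply: (@wp_for _ D (N * 9 + 8) (fun q s' => [/\ narr s' 20 0 = q,
    narr s' 19 0 = q * N & forall x, count_mem x (sent s') = count_mem x (sent s) +
       \sum_(p < q * N) ((p %/ N == x) && priv p)])).
  - by split=> // x; rewrite big_ord0 addn0.
  - move=> q s' qD [f fR _] [i20 i19 cnt].
    have f0 : narr s' 0 = narr s 0 := f 0 isT.
    have f3 : narr s' 3 = narr s 3 := f 3 isT.
    have f7 : narr s' 7 = narr s 7 := f 7 isT.
    have f12 : narr s' 12 = narr s 12 := f 12 isT.
    have fR0 : rarr s' 0 = rarr s 0 := fR 0 isT.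
    split; first by rewrite /= i20 f12 h12.
    assign; set s2 := State _ _ _.
    apply: (@wp_comp _ (N * 9).+1); first by lia.
    apply: wp_weaken; last first.
      apply: (@wp_for _ N 8 (fun r s3 => [/\ narr s3 18 0 = r,
        narr s3 19 0 = q * N + r &
        forall x, count_mem x (sent s3) = count_mem x (sent s) +
          \sum_(p < q * N + r) ((p %/ N == x) && priv p)])).
      + by split=> // [|x]; rewrite ?addn0 //= cnt.
      + move=> r s3 rN [g gR _] [j18 j19 cnt3].
        have g0 : narr s3 0 = narr s' 0 := g 0 isT.
        have g3 : narr s3 3 = narr s' 3 := g 3 isT.
        have g7 : narr s3 7 = narr s' 7 := g 7 isT.
        have g20 : narr s3 20 = narr s' 20 := g 20 isT.
        have gR0 : rarr s3 0 = rarr s' 0 := gR 0 isT.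
        split.
          rewrite -[beval _ _]/((narr s3 18 0)%:R < reval s3 coins_exp)%R.
          by rewrite coinsE ?g0 ?g7 ?gR0 // j18 -ltn_natceil hN.
        have E x : \sum_(p < q * N + r.+1) ((p %/ N == x) && priv p) =
            \sum_(p < q * N + r) ((p %/ N == x) && priv p) +
            ((q == x) && priv (q * N + r)).
          have N0 : 0 < N by lia.
          by rewrite addnS big_ord_recr /= divnMDl // divn_small // addn0.
        apply: (@wp_comp _ 2) => //; apply: wp_if => //=.
        rewrite g3 f3 j19 h3.
        case hp : (priv (q * N + r)) => /=.
          apply: wp_send => //= _; assign; apply: wp_nasg => //.
          split=> [| |x]; rewrite /= /upd /= ?j18 ?j19 ?addn1 ?addnS //.
          rewrite -cats1 count_cat /= cnt3 g20 i20 -addnS E hp andbT addn0.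
          by rewrite addnA.
        apply: wp_skip => //= _; assign; apply: wp_nasg => //.
        split=> [| |x]; rewrite /= /upd /= ?j18 ?j19 ?addn1 ?addnS //.
        by rewrite cnt3 -addnS E hp andbF addn0.
      + move=> s3 [g gR _] [j18 _ _].
        have g0 : narr s3 0 = narr s' 0 := g 0 isT.
        have g7 : narr s3 7 = narr s' 7 := g 7 isT.
        have gR0 : rarr s3 0 = rarr s' 0 := gR 0 isT.
        rewrite -[beval _ _]/((narr s3 18 0)%:R < reval s3 coins_exp)%R.
        by rewrite coinsE ?g0 ?g7 ?gR0 // j18 -ltn_natceil hN ltnn.
    + move=> s3 [g gR _] [j18 j19 cnt3] _.
      have g20 : narr s3 20 = narr s' 20 := g 20 isT.
      apply: wp_nasg; first by lia.
      split=> [| |x]; rewrite /= /upd /= ?g20 ?i20 ?j19 ?addn1 ?mulSnr //.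
    + by [].
  - move=> s' [f _ _] [i20 _ _]; have f12 : narr s' 12 = narr s 12 := f 12 isT.
    by rewrite /= i20 f12 h12 ltnn.
- by move=> s' _ [].
- by lia.
Qed.

End ProgramSpecs.

(** * Message counts of the encoder and output of the decoder *)

Section Protocol.
Variables (R : realType) (P : params R).
Local Notation n := (nusers P).
Local Notation d := (dim P).
Local Notation T := (nbuckets P).

Definition cells : R := 2%:R * (n%:R * T%:R) / beta P.
Definition scale : R := 32%:R * (d%:R * d%:R) * (n%:R * T%:R) / beta P.
Definition sens : R := T%:R * scale * (1%:R + 1%:R / eps P).
Definition cell_bits : nat := log2up cells.
Definition key_bits : nat := log2up ((universe P)%:R : R).
Definition delta_bits : nat := log2up (2%:R / delta P).
Definition coins : nat :=
  natceil (32%:R * 64%:R * (sens * sens * delta_bits%:R) / n%:R).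
Definition ncodes : nat := (2 ^ cell_bits * d.*2)%N.

(** Total on [nat], with the value 0 that the machine's memory returns past the vector. *)
Definition coord (u : user P) (j : nat) : R :=
  nth 0 [seq vec u 0 j | j <- enum 'I_d] j.

Definition base (pub : nat -> bool) (y : nat) : nat :=
  (hcell pub key_bits cell_bits y * d.*2)%N.

Definition data_count (pub : nat -> bool) (u : user P) (x : nat) : nat :=
  (\sum_(y in buckets u) \sum_(e < d.*2)
     (x == base pub y + e) * entry (coord u) scale e)%N.

Definition noise_count (priv : nat -> bool) (x : nat) : nat :=
  (\sum_(p < ncodes * coins) ((p %/ coins == x) && priv p))%N.

Definition enc_time : nat :=
  (cell_bits * 4 + delta_bits * 4 + key_bits * 4
   + T * (hash_time cell_bits key_bits + vector_time d (natceil scale) + 6)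
   + ncodes * (coins * 9 + 9) + 40)%N.

Definition dec_time (M : nat) : nat :=
  (cell_bits * 4 + key_bits * 4 + hash_time cell_bits key_bits
   + d * (M * 9 + 20) + 40)%N.

Definition tape (L : nat) (t : L.-tuple bool) (p : nat) : bool := nth false t p.

Lemma nth_bits L (t : L.-tuple bool) p : nth 0%N (bits t) p = tape t p.
Proof.
rewrite /bits /tape; case: (ltnP p L) => h.
  by rewrite (nth_map false) // size_tuple.
by rewrite !nth_default ?size_map ?size_tuple.
Qed.

Lemma coordE (u : user P) (j : 'I_d) : coord u j = vec u 0 j.
Proof. by rewrite /coord (nth_map j) ?size_enum_ord // nth_ord_enum. Qed.

Lemma l2norm_le1 (v : 'rV[R]_d) : l2norm v <= 1 -> \sum_(j < d) v 0 j ^+ 2 <= 1.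
Proof. by rewrite /l2norm -[X in _ <= X -> _]sqrtr1 ler_sqrt. Qed.

Lemma coord_le1 (u : user P) j : valid_user u -> `|coord u j| <= 1.
Proof.
case=> _ /l2norm_le1 h; case: (ltnP j d) => jd; last first.
  have -> : coord u j = 0.
    by rewrite /coord nth_default // size_map size_enum_ord.
  by rewrite normr0 ler01.
rewrite (coordE u (Ordinal jd)) -(@expr_le1 _ 2) // real_normK ?num_real //.
apply: le_trans h; rewrite (bigD1 (Ordinal jd)) //= lerDl.
by apply: sumr_ge0 => i _; apply: sqr_ge0.
Qed.

Hypothesis beta_gt0 : 0 < beta P.
Hypothesis T_gt0 : (0 < T)%N.

Lemma scale_ge0 : 0 <= scale.
Proof. by rewrite !mulr_ge0 // invr_ge0 ltW. Qed.

Lemma entry_le (u : user P) e : valid_user u ->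
  (entry (coord u) scale e <= natceil scale)%N.
Proof.
move=> hu; rewrite natceil_le; apply: le_trans (natceil_ge _).
have := coord_le1 e./2 hu; rewrite ler_norml => /andP[h1 h2].
by case: odd; apply: ler_piMl; rewrite ?scale_ge0 //; lra.
Qed.

Lemma bucket_lt (y : 'I_(universe P)) : (y < 2 ^ key_bits)%N.
Proof.
apply: leq_trans (ltn_ord y) _; rewrite -(ler_nat R); exact: log2up_ge.
Qed.

Lemma sum_nth_enum m (A : {set 'I_m}) (f : nat -> nat) t : #|A| = t ->
  (\sum_(i < t) f (nth 0 [seq val y | y <- enum A] i) = \sum_(y in A) f y)%N.
Proof.
move=> <-; have -> : #|A| = size [seq val y | y <- enum A].
  by rewrite size_map -cardE.
rewrite -(big_mkord xpredT (fun i => f (nth 0%N [seq val y | y <- enum A] i))).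
by rewrite -(big_nth 0%N xpredT f) big_map big_enum.
Qed.

Lemma encoder_spec L (pub priv : L.-tuple bool) (u : user P) :
  valid_user u -> 1 <= n%:R * eps P ->
  wp encoder enc_time (fun s' => forall x, count_mem x (sent s') =
    (data_count (tape pub) u x + noise_count (tape priv) x)%N)
    (enc_init pub priv u).
Proof.
move=> hu hn; set s := enc_init _ _ _.
apply: wp_if; first by rewrite /enc_time; lia.
have -> : beval s (RLt (RMul n_exp eps_exp) (rcst 1)) = false.
  by rewrite /= /load /=; apply/negbTE; rewrite -leNgt.
rewrite /enc_time.
apply: (@wp_comp _ ((cell_bits * 4).+1 + 4)); first by lia.
apply: wp_weaken; last first.
  apply: (@doubling_spec _ 6 cells_exp cells) => // s' [f fR _].
  have f0 : narr s' 0 = narr s 0 := f 0%N isT.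
  have fR0 : rarr s' 0 = rarr s 0 := fR 0%N isT.
  by rewrite /= f0 fR0.
2: exact: leqnn.
move=> s1 [f1 fR1 fs1] [h6 _] _.
apply: (@wp_comp _ ((delta_bits * 4).+1 + 4)); first by lia.
apply: wp_weaken; last first.
  apply: (@doubling_spec _ 7 (RDiv (rcst 2) delta_exp) (2%:R / delta P))
     => // s' [f fR _].
  have fR0 : rarr s' 0 = rarr s1 0 := fR 0%N isT.
  by rewrite /= fR0 fR1.
2: exact: leqnn.
move=> s2 [f2 fR2 fs2] [h7 _] _.
apply: (@wp_comp _ ((key_bits * 4).+1 + 4)); first by lia.
apply: wp_weaken; last first.
  apply: (@doubling_spec _ 8 (RNat (NLd 0 (NCst 3))) (universe P)%:R)
     => // s' [f fR _].
  have f0 : narr s' 0 = narr s2 0 := f 0%N isT.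
  by rewrite /= f0 f2 // f1.
2: exact: leqnn.
move=> s3 [f3 fR3 fs3] [h8 h5] _.
have e0 : narr s3 0 = narr s 0 by rewrite f3 // f2 // f1.
have eR0 : rarr s3 0 = rarr s 0 by rewrite fR3 // fR2 // fR1.
apply: (@wp_comp _ (T * (hash_time cell_bits key_bits +
  vector_time d (natceil scale) + 6) + 3)%N); first by lia.
apply: wp_weaken; last first.
  apply: (@send_data_spec _ (tape pub) (coord u)
    (fun t => nth 0%N [seq val y | y <- enum (buckets u)] t) scale d T
    key_bits cell_bits (natceil scale)).
  - by move=> t; rewrite f3 // f2 // f1.
  - by [].
  - by rewrite f3 // f2.
  - by rewrite e0.
  - by rewrite e0.
  - exact: h5.
  - move=> t tT; have [hc _] := hu.
    have ts : (t < size (enum (buckets u)))%N by rewrite -cardE hc.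
    case: (enum _) ts => // y0 l ts; rewrite (nth_map y0) //; exact: bucket_lt.
  - by move=> p; rewrite f3 // f2 // f1 // -nth_bits.
  - by move=> j; rewrite fR3 // fR2 // fR1.
  - by rewrite /= e0 eR0.
  - by move=> e _; apply: entry_le.
2: exact: leqnn.
move=> s4 [f4 fR4 _] [h12 cnt] _.
apply: wp_weaken; last first.
  apply: (@send_noise_spec _ (tape priv) ncodes coins
    (32%:R * 64%:R * (sens * sens * delta_bits%:R) / n%:R)).
  - by move=> p; rewrite f4 // f3 // f2 // f1 // -nth_bits.
  - exact: h12.
  - by rewrite /= f4 // fR4 // e0 eR0 f4 // f3 // h7.
  - by [].
- move=> s5 _ cnt5 x; rewrite cnt5 cnt fs3 // fs2 // fs1 //=; congr addn.
  rewrite /data_count add0n; have [hc _] := hu.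
  exact: (@sum_nth_enum _ _ (fun y : nat => \sum_(e < d.*2) (x == hcell (tape pub)
     key_bits cell_bits y * d.*2 + e) * entry (coord u) scale e)%N _ hc).
- by lia.
Qed.

Lemma encoder_trivial L (pub priv : L.-tuple bool) (u : user P) :
  n%:R * eps P < 1 -> wp encoder 2 (fun s' => sent s' = [::]) (enc_init pub priv u).
Proof. by move=> h; apply: wp_if => //=; rewrite /load /= h; apply: wp_skip. Qed.

Lemma decoder_trivial L (pub priv : L.-tuple bool) msgs (y : 'I_(universe P)) :
  n%:R * eps P < 1 ->
  wp decoder 2 (fun s' => forall j, rarr s' 1 j = 0) (dec_init pub priv msgs y).
Proof.
move=> h; apply: wp_if => //=; rewrite /load /= h; apply: wp_skip => // j.
by rewrite /= /load /= nth_nil.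
Qed.

Lemma tally_spec msgs b j (s : state R) :
  narr s 18 0 = 0%N -> narr s 17 0 = j -> narr s 11 0 = b ->
  narr s 0 4 = size msgs -> (forall i, narr s 4 i = nth 0%N msgs i) ->
  rarr s 1 j = 0 ->
  wp tally (size msgs * 8).+1 (fun s' =>
    rarr s' 1 j = (count_mem b msgs)%:R - (count_mem b.+1 msgs)%:R /\
    forall j', j' != j -> rarr s' 1 j' = rarr s 1 j') s.
Proof.
move=> h18 h17 h11 h0 h4 hr.
apply: wp_weaken; last first.
  apply: (@wp_for _ (size msgs) 7 (fun i s' => [/\ narr s' 18 0 = i,
    rarr s' 1 j = (count_mem b (take i msgs))%:R - (count_mem b.+1 (take i msgs))%:R
    & forall j', j' != j -> rarr s' 1 j' = rarr s 1 j'])).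
  - by split=> //; rewrite take0 /= subrr.
  - move=> i s' iM [f _ _] [i18 ir io].
    have f0 : narr s' 0 = narr s 0 := f 0%N isT.
    have f4 : narr s' 4 = narr s 4 := f 4 isT.
    have f11 : narr s' 11 = narr s 11 := f 11 isT.
    have f17 : narr s' 17 = narr s 17 := f 17 isT.
    split; first by rewrite /= i18 f0 h0.
    apply: (@wp_comp _ 4) => //; apply: wp_if => //=.
    rewrite f4 i18 h4 f11 h11.
    have E x : (count_mem x (take i.+1 msgs)) =
        (count_mem x (take i msgs) + (nth 0 msgs i == x))%N.
      by rewrite (take_nth 0%N) // -cats1 count_cat /= addn0.
    case: eqP => h1.
      apply: wp_rasg => //= _; apply: wp_nasg => //=.
      rewrite /upd /= i18 f17 h17 addn1 eqxx ir !E h1 eqxx ltn_eqF //; split=> //.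
        by rewrite !natrD /=; ring.
      by move=> j' hj; rewrite (negbTE hj) io.
    apply: wp_if => //=; rewrite f4 i18 h4 f11 h11 addn1.
    case: eqP => h2.
      apply: wp_rasg => //= _; apply: wp_nasg => //=.
      rewrite /upd /= i18 f17 h17 addn1 eqxx ir !E h2 eqxx gtn_eqF //; split=> //.
        by rewrite !natrD /=; ring.
      by move=> j' hj; rewrite (negbTE hj) io.
    apply: wp_skip => //= _; apply: wp_nasg => //=.
    rewrite /upd /= i18 addn1 !E; split=> //.
    by rewrite ir; move/eqP/negbTE: h1 => ->; move/eqP/negbTE: h2 => ->;
      rewrite !addn0.
  - move=> s' [f _ _] [i18 _ _]; have f0 : narr s' 0 = narr s 0 := f 0%N isT.
    by rewrite /= i18 f0 h0 ltnn.
- by move=> s' _ [_]; rewrite take_size.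
- by lia.
Qed.

Lemma decoder_spec L (pub priv : L.-tuple bool) msgs (y : 'I_(universe P)) :
  1 <= n%:R * eps P ->
  wp decoder (dec_time (size msgs)) (fun s' => forall j, (j < d)%N ->
    rarr s' 1 j = ((count_mem (base (tape pub) y + j.*2)%N msgs)%:R
      - (count_mem (base (tape pub) y + j.*2).+1 msgs)%:R) / scale)
    (dec_init pub priv msgs y).
Proof.
move=> hn; set s := dec_init _ _ _ _.
apply: wp_if; first by rewrite /dec_time; lia.
have -> : beval s (RLt (RMul n_exp eps_exp) (rcst 1)) = false.
  by rewrite /= /load /=; apply/negbTE; rewrite -leNgt.
rewrite /dec_time.
apply: (@wp_comp _ ((cell_bits * 4).+1 + 4)); first by lia.
apply: wp_weaken; last first.
  apply: (@doubling_spec _ 6 cells_exp cells) => // s' [f fR _].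
  have f0 : narr s' 0 = narr s 0 := f 0%N isT.
  have fR0 : rarr s' 0 = rarr s 0 := fR 0%N isT.
  by rewrite /= f0 fR0.
2: exact: leqnn.
move=> s1 [f1 fR1 fs1] [h6 _] _.
apply: (@wp_comp _ ((key_bits * 4).+1 + 4)); first by lia.
apply: wp_weaken; last first.
  apply: (@doubling_spec _ 8 (RNat (NLd 0 (NCst 3))) (universe P)%:R)
     => // s' [f fR _].
  have f0 : narr s' 0 = narr s1 0 := f 0%N isT.
  by rewrite /= f0 f1.
2: exact: leqnn.
move=> s2 [f2 fR2 fs2] [h8 h5] _.
apply: (@wp_comp _ 1); first by lia.
apply: wp_nasg => // _; set s3 := State _ _ _.
have e3 a : a \notin [:: 5; 6; 8; 9]%N -> narr s3 a = narr s a.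
  rewrite !inE => /norP[a5 /norP[a6 /norP[a8 a9]]].
  by rewrite /s3 /= upd_other ?inE // f2 ?f1 //=
    !inE ?negb_or ?a5 ?a6 ?a8.
apply: (@wp_comp _ (hash_time cell_bits key_bits)); first by lia.
apply: wp_weaken; last first.
  apply: (@hash_spec _ (tape pub) d key_bits cell_bits y).
  - by rewrite e3.
  - by rewrite /s3 /= /upd /= h8.
  - by rewrite /s3 /= /upd /= f2.
  - by rewrite e3.
  - by move=> e he; rewrite /s3 /= /upd /= h5.
  - exact: bucket_lt.
  - by move=> p; rewrite e3 // -nth_bits.
2: exact: leqnn.
move=> s4 [f4 fR4 _] [h11 _] _.
have e4 a : a \notin [:: 5; 6; 8; 9]%N -> a \notin nwritten hash ->
    narr s4 a = narr s a.
  by move=> h1 h2; rewrite f4 // e3.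
have eR4 a : rarr s4 a = rarr s a by rewrite fR4 // /s3 /= fR2 // fR1.
apply: (@wp_comp _ 1); first by lia.
apply: wp_nasg => // _; set s5 := State _ _ _.
apply: wp_weaken; last first.
  apply: (@wp_for _ d (size msgs * 8 + 15) (fun j s' => [/\ narr s' 17 0 = j,
    narr s' 11 0 = (base (tape pub) y + j.*2)%N,
    forall j', (j' < j)%N ->
      rarr s' 1 j' = ((count_mem (base (tape pub) y + j'.*2)%N msgs)%:R
      - (count_mem (base (tape pub) y + j'.*2).+1%N msgs)%:R) / scale
    (* The tally accumulates in the output cell itself, so pending coordinates must still be 0. *)
    & forall j', (j <= j')%N -> rarr s' 1 j' = 0])).
  - split=> //.
    + by rewrite /s5 /= /upd /= h11 addn0.
    + by move=> j' _; rewrite /s5 /= eR4 /= /load /= nth_nil.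
  - move=> j s' jd [f fR _] [i17 i11 idone itodo].
    have f0 : narr s' 0 = narr s 0 := etrans (f 0%N isT) (e4 0%N isT isT).
    have g4 : narr s' 4 = narr s 4 := etrans (f 4 isT) (e4 4 isT isT).
    have fR0 : rarr s' 0 = rarr s 0 := etrans (fR 0%N isT) (eR4 0%N).
    split; first by rewrite /= i17 f0.
    apply: (@wp_comp _ 1); first by lia.
    apply: wp_nasg => // _.
    apply: (@wp_comp _ (size msgs * 8).+1); first by lia.
    apply: wp_weaken; last first.
      apply: (@tally_spec msgs (base (tape pub) y + j.*2)%N j); rewrite //= /upd //=.
      * by rewrite f0.
      * by move=> i; rewrite g4.
      * exact: itodo.
    + move=> s6 [g gR _] [hr ho] _ /=.
      have g0 : narr s6 0 = narr s' 0 := g 0%N isT.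
      have g11 : narr s6 11 = narr s' 11 := g 11 isT.
      have g17 : narr s6 17 = narr s' 17 := g 17 isT.
      have gR0 : rarr s6 0 = rarr s' 0 := gR 0%N isT.
      apply: (@wp_comp _ 1); first by lia.
      apply: wp_rasg => // _.
      apply: (@wp_comp _ 1); first by lia.
      apply: wp_nasg => // _; apply: wp_nasg; first by lia.
      split.
      * by rewrite /= /upd /= g17 i17 addn1.
      * by rewrite /= /upd /= g11 i11; lia.
      * move=> j' hj'; rewrite -[LHS]/(upd (rarr s6) 1 (narr s6 17 0)
          (rarr s6 1 (narr s6 17 0) / reval s6 scale_exp) 1 j').
        rewrite g17 i17 /upd /=; case: eqP => [->|/eqP ne].
          by rewrite hr; congr (_ / _); rewrite /= g0 f0 gR0 fR0.
        by rewrite ho // idone //; lia.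
      * move=> j' hj'; rewrite -[LHS]/(upd (rarr s6) 1 (narr s6 17 0)
          (rarr s6 1 (narr s6 17 0) / reval s6 scale_exp) 1 j').
        rewrite g17 i17 /upd /=; case: eqP => [e|/eqP ne]; first by lia.
        by rewrite ho // itodo //; lia.
    + by [].
  - move=> s' [f fR _] [i17 _ _ _].
    have f0 : narr s' 0 = narr s 0 := etrans (f 0%N isT) (e4 0%N isT isT).
    by rewrite /= i17 f0 /= /load /= ltnn.
- by move=> s' _ [].
- by lia.
Qed.

End Protocol.

(** * Binomial noise *)

Section ExpBounds.
Variable R : realType.
Implicit Types x : R.

(** From exp(-x) >= 1 - x one gets exp(x) <= 1/(1 - x), and (1 - x)(1 + x + 2x^2) = 1 + x^2 (1 - 2x)
    is at least 1 in this range. *)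
Lemma expR_le_quadratic x : x <= 1 / 2 -> expR x <= 1 + x + 2 * x ^+ 2.
Proof.
move=> hx; have h := expR_ge1Dx (- x); rewrite expRN in h.
have e0 := expR_gt0 x.
have h1 : expR x * (1 - x) <= 1.
  have := ler_wpM2l (ltW e0) h; by rewrite mulfV // gt_eqF.
have x0 : 0 < 1 - x by lra.
rewrite -(ler_pM2r x0); apply: le_trans h1 _.
have : 0 <= x ^+ 2 * (1 - 2 * x) by rewrite mulr_ge0 ?sqr_ge0 //; lra.
by rewrite !expr2; nra.
Qed.

(** A crude form of cosh x <= exp(x^2/2). For |x| <= 1/2 the linear terms of the two quadratic
    bounds cancel; beyond that |x| <= 2x^2. *)
Lemma expR_cosh_le x : expR x + expR (- x) <= 2 * expR (2 * x ^+ 2).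
Proof.
have [h1|h1] := leP `|x| (1 / 2).
  move: h1; rewrite ler_norml => /andP[h1 h2].
  have := expR_le_quadratic h2.
  have : - x <= 1 / 2 by lra.
  move/expR_le_quadratic; have := expR_ge1Dx (2 * x ^+ 2); rewrite sqrrN; lra.
have h2 : `|x| <= 2 * x ^+ 2.
  by rewrite -real_normK ?num_real // expr2; nra.
have h3 : expR x <= expR (2 * x ^+ 2).
  by rewrite ler_expR; apply: le_trans h2; apply: ler_norm.
have h4 : expR (- x) <= expR (2 * x ^+ 2).
  by rewrite ler_expR; apply: le_trans h2; rewrite -normrN; apply: ler_norm.
by lra.
Qed.

(** One factor 1 + x is at most exp(x). The other, 1/(1 - x) = 1 + x/(1 - x), is at most exp(x/(1 -
    x)), and x/(1 - x) <= x + 2x^2. *)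
Lemma expR_mobius_le x : `|x| <= 1 / 2 ->
  1 + x <= expR (2 * x + 2 * x ^+ 2) * (1 - x).
Proof.
rewrite ler_norml => /andP[h1 h2].
have x0 : 0 < 1 - x by lra.
have i0 : 0 < (1 - x)^-1 by rewrite invr_gt0.
have i1 : (1 - x) * (1 - x)^-1 = 1 by rewrite mulfV // gt_eqF.
have h3 : (1 - x)^-1 <= expR (x + 2 * x ^+ 2).
  have := expR_ge1Dx (x * (1 - x)^-1).
  have -> : 1 + x * (1 - x)^-1 = (1 - x)^-1 by field; rewrite gt_eqF.
  move=> h; apply: le_trans h _; rewrite ler_expR.
  rewrite -(ler_pM2r x0) -mulrA [_^-1 * _]mulrC i1 mulr1.
  have : 0 <= x ^+ 2 * (1 - 2 * x) by rewrite mulr_ge0 ?sqr_ge0 //; lra.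
  by rewrite !expr2; nra.
have -> : 2 * x + 2 * x ^+ 2 = x + (x + 2 * x ^+ 2) by ring.
rewrite expRD -mulrA; apply: le_trans (expR_ge1Dx x) _.
rewrite ler_peMr ?expR_ge0 //.
by have := ler_wpM2r (ltW x0) h3; rewrite [_^-1 * _]mulrC i1.
Qed.

End ExpBounds.

(** * Tail bound for weighted sums of independent fair signs *)

Section Chernoff.
Variables (R : realType) (J : finType).

Definition signed_sum (th : J -> R) (A : {set J}) : R :=
  \sum_p (if p \in A then th p else - th p).

(** A uniform subset is a family of independent fair signs, so the sum over subsets factors into one
    hyperbolic cosine per element. *)
Lemma mgf_le (th : J -> R) :
  \sum_(A : {set J}) expR (signed_sum th A) <=
  2 ^+ #|J| * expR (2 * \sum_p th p ^+ 2).
Proof.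
have -> : \sum_(A : {set J}) expR (signed_sum th A) =
    \prod_p (expR (th p) + expR (- th p)).
  rewrite bigA_distr; apply: eq_bigr => A _; rewrite /signed_sum expR_sum.
  by apply: eq_bigr => p _; case: ifP.
rewrite mulr_sumr expR_sum -prodr_const -big_split /=.
apply: ler_prod => p _; rewrite expR_cosh_le andbT.
by rewrite addr_ge0 ?expR_ge0.
Qed.

Lemma chernoff (th : J -> R) (t V : R) : 0 <= t -> 0 < V ->
  \sum_p th p ^+ 2 <= V ->
  \sum_(A : {set J}) (t <= signed_sum th A)%R%:R <=
  2 ^+ #|J| * expR (- (t ^+ 2 / (8 * V))).
Proof.
(* This [l] minimises - l t + 2 l^2 V. *)
move=> t0 V0 hV; pose l := t / (4 * V).
have l0 : 0 <= l by rewrite /l divr_ge0 // mulr_ge0 // ltW.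
apply: (@le_trans _ _ (\sum_(A : {set J})
    expR (- (l * t)) * expR (signed_sum (fun p => l * th p) A))).
  apply: ler_sum => A _; rewrite -expRD.
  case: (leP t) => h /=; rewrite ?mulr0n ?mulr1n; last exact: expR_ge0.
  have -> : signed_sum (fun p => l * th p) A = l * signed_sum th A.
    by rewrite /signed_sum mulr_sumr; apply: eq_bigr => p _; case: ifP => _ //;
      rewrite mulrN.
  rewrite -expR0 ler_expR; have := ler_wpM2l l0 h; lra.
rewrite -mulr_sumr.
apply: le_trans (ler_wpM2l (expR_ge0 _) (mgf_le _)) _.
rewrite mulrCA ler_wpM2l ?exprn_ge0 // -expRD ler_expR.
have -> : \sum_p (l * th p) ^+ 2 = l ^+ 2 * \sum_p th p ^+ 2.
  by rewrite mulr_sumr; apply: eq_bigr => p _; rewrite exprMn.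
have h1 : l ^+ 2 * \sum_p th p ^+ 2 <= l ^+ 2 * V by rewrite ler_wpM2l ?sqr_ge0.
have h2 : - (l * t) + 2 * (l ^+ 2 * V) = - (t ^+ 2 / (8 * V)).
  by rewrite /l; field; rewrite gt_eqF.
by rewrite -h2; lra.
Qed.

End Chernoff.

(** * Weights of a shifted binomial count *)

Section BinomialRatio.
Variables (R : realType) (m : nat) (X : R).
Hypothesis X_le : X <= 1 / 2.

(** Only the recurrence of binomial coefficients is assumed of [a], so the lemma applies directly to
    numbers of outcomes. The normalised deviations met on the way are (w + 2i + 1)/(m + 1) for i <
    k, with w = 2u - m, and their numerators add up to kw + k^2. *)
Lemma ratio_up (a : nat -> R) (u k : nat) :
  (forall v, 0 <= a v) ->
  (forall v, (v < m)%N -> a v * (m%:R - v%:R) = a v.+1 * v.+1%:R) ->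
  `|2 * u%:R - m%:R| + 2 * k%:R <= X * (m%:R + 1) ->
  a u <= expR (2 * (k%:R * (2 * u%:R - m%:R) + k%:R ^+ 2) / (m%:R + 1)
               + 2 * k%:R * X ^+ 2) * a (u + k)%N.
Proof.
move=> a0 ha; elim: k => [|k IH] hk.
  by rewrite addn0 !(mul0r, mulr0, expr0n, addr0) /= expR0 mul1r.
have m0 : 0 < m%:R + 1 :> R by rewrite ltr_wpDl.
have hk' : `|2 * u%:R - m%:R| + 2 * k%:R <= X * (m%:R + 1).
  by apply: le_trans hk; rewrite -natr1; lra.
apply: le_trans (IH hk') _.
set w := 2 * u%:R - m%:R in hk hk' *.
(* Chosen so that the two factors of the recurrence become (1 + x) and (1 - x) times the same (m +
   1)/2. *)
pose x := (w + 2 * k%:R + 1) / (m%:R + 1).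
have hx : `|x| <= X.
  rewrite /x normrM normfV (gtr0_norm m0) ler_pdivrMr //.
  apply: le_trans hk; have := ler_normD w (2 * k%:R + 1); rewrite addrA => h.
  apply: le_trans h _; rewrite -natr1 (ger0_norm (_ : 0 <= 2 * k%:R + 1)).
    by lra.
  by rewrite addr_ge0 ?mulr_ge0.
have hx2 : x ^+ 2 <= X ^+ 2.
  rewrite -real_normK ?num_real // ler_sqr ?nnegrE //.
  exact: le_trans (normr_ge0 _) hx.
have xm : x * (m%:R + 1) = w + 2 * k%:R + 1 by rewrite /x mulfVK // gt_eqF.
have p1 : (u + k).+1%:R = (m%:R + 1) / 2 * (1 + x) :> R.
  by rewrite -natr1 natrD mulrDr mulr1 mulrAC [_ * x]mulrC xm /w; field.
have p2 : m%:R - (u + k)%:R = (m%:R + 1) / 2 * (1 - x) :> R.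
  by rewrite natrD mulrBr mulr1 mulrAC [_ * x]mulrC xm /w; field.
have x12 : `|x| <= 1 / 2 := le_trans hx X_le.
have x1 : 0 < 1 - x by move: x12; rewrite ler_norml; lra.
have um : (u + k < m)%N.
  rewrite -(ltr_nat R) -subr_gt0 p2 mulr_gt0 //; lra.
have := ha _ um; rewrite p1 p2 addnS.
set y := a (u + k)%N; set z := a (u + k).+1 => hyz.
have hyz' : y * (1 - x) = z * (1 + x).
  have c0 : (m%:R + 1) / 2 != 0 :> R by rewrite gt_eqF //; lra.
  by apply: (mulfI c0); rewrite mulrCA hyz mulrCA.
have hz : y <= expR (2 * x + 2 * x ^+ 2) * z.
  rewrite -(ler_pM2r x1) hyz' mulrAC [_ * z]mulrC ler_wpM2l //; first exact: a0.
  exact: expR_mobius_le.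
apply: le_trans (ler_wpM2l (expR_ge0 _) hz) _.
rewrite mulrA -expRD ler_wpM2r ?a0 // ler_expR.
have -> : 2 * (k.+1%:R * w + k.+1%:R ^+ 2) / (m%:R + 1) + 2 * k.+1%:R * X ^+ 2 =
  (2 * (k%:R * w + k%:R ^+ 2) / (m%:R + 1) + 2 * k%:R * X ^+ 2) +
  (2 * x + 2 * X ^+ 2).
  by rewrite /x -natr1; field; rewrite gt_eqF.
by lra.
Qed.

Lemma ratio_le (a : nat -> R) (u v : nat) : (u <= m)%N -> (v <= m)%N ->
  (forall v, 0 <= a v) ->
  (forall v, (v < m)%N -> a v * (m%:R - v%:R) = a v.+1 * v.+1%:R) ->
  let D := v%:R - u%:R : R in
  `|2 * u%:R - m%:R| + 2 * `|D| <= X * (m%:R + 1) ->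
  a u <= expR (2 * (D * (2 * u%:R - m%:R) + D ^+ 2) / (m%:R + 1)
               + 2 * `|D| * X ^+ 2) * a v.
Proof.
move=> um vm a0 ha D; have [uv|vu] := leqP u v.
  have DE : D = (v - u)%:R by rewrite /D natrB.
  rewrite DE normr_nat => h.
  by have := ratio_up a0 ha h; rewrite subnKC.
have DE : D = - (u - v)%:R by rewrite /D natrB ?opprB // ltnW.
rewrite DE normrN normr_nat => h.
(* Exchanging heads and tails preserves the recurrence and turns a downward shift into an upward
   one. *)
have ha' v' : (v' < m)%N -> a (m - v')%N * (m%:R - v'%:R) =
    a (m - v'.+1)%N * v'.+1%:R.
  move=> lt; have lt2 : (m - v'.+1 < m)%N by lia.
  have := ha _ lt2; have -> : (m - v'.+1).+1 = (m - v')%N by lia.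
  rewrite -natrB; last by lia.
  have -> : (m - (m - v'.+1))%N = v'.+1 by lia.
  by rewrite -natrB ?(ltnW lt).
have hw : 2 * (m - u)%:R - m%:R = - (2 * u%:R - m%:R) :> R.
  by rewrite natrB //; lra.
have h' : `|2 * (m - u)%:R - m%:R| + 2 * (u - v)%:R <= X * (m%:R + 1).
  by rewrite hw normrN.
have := @ratio_up (fun v' => a (m - v')%N) (m - u) (u - v) (fun v' => a0 _) ha' h'.
have -> : (m - (m - u))%N = u by lia.
have -> : (m - (m - u + (u - v)))%N = v by lia.
by rewrite hw sqrrN mulrN mulNr.
Qed.

End BinomialRatio.

(** * Counts of heads in disjoint classes of fair coins *)

Section BinomialMechanism.
Variables (R : realType) (J : finType) (cls : J -> nat) (D m : nat).
Hypothesis cls_card : forall c, (c < D)%N -> #|[set p | cls p == c]| = m.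
Hypothesis m_gt0 : (0 < m)%N.

Definition ones (A : {set J}) (c : nat) : nat := #|[set p in A | cls p == c]|.
Definition walk (A : {set J}) (c : nat) : R := 2 * (ones A c)%:R - m%:R.

Lemma ones_le A c : (c < D)%N -> (ones A c <= m)%N.
Proof.
move=> cD; rewrite -(cls_card cD); apply: subset_leq_card.
by apply/subsetP => p; rewrite !inE => /andP[].
Qed.

Lemma signed_sum_cls (eta : nat -> R) A :
  signed_sum (fun p => if (cls p < D)%N then eta (cls p) else 0) A =
  \sum_(c < D) eta c * walk A c.
Proof.
rewrite /signed_sum.
transitivity (\sum_p \sum_(c < D | cls p == c)
    (if p \in A then eta c else - eta c)).
  apply: eq_bigr => p _; case: ltnP => h; last first.
    rewrite big_pred0; first by rewrite oppr0 if_same.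
    by move=> c; apply/negbTE; rewrite neq_ltn (leq_trans (ltn_ord c) h) orbT.
  by rewrite (big_pred1 (Ordinal h)).
rewrite (exchange_big_dep xpredT) //=; apply: eq_bigr => c _.
rewrite (bigID (mem A)) /=.
rewrite (eq_bigr (fun=> eta c)); last by move=> p /andP[_ ->].
rewrite [X in _ + X](eq_bigr (fun=> - eta c)); last first.
  by move=> p /andP[_ /negbTE->].
rewrite !sumr_const.
have e1 : #|[pred p | (cls p == c) && (p \in A)]| = ones A c.
  by apply: eq_card => p; rewrite !inE andbC.
have e2 : (#|[pred p | (cls p == c) && (p \notin A)]| = m - ones A c)%N.
  rewrite -(cls_card (ltn_ord c)) -(cardsID A [set p | cls p == c]).
  have -> : #|[set p | cls p == c] :&: A| = ones A c.
    by apply: eq_card => p; rewrite !inE andbC.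
  by rewrite addKn; apply: eq_card => p; rewrite !inE andbC.
rewrite -[X in _ *+ X + _]/(#|[pred p | (cls p == c) && (p \in A)]|).
rewrite -[X in _ + _ *+ X]/(#|[pred p | (cls p == c) && (p \notin A)]|).
rewrite e1 e2 -[eta c *+ _]mulr_natr -[- eta c *+ _]mulr_natr natrB ?ones_le //.
by rewrite /walk; ring.
Qed.

Lemma sum_sqr_cls (eta : nat -> R) :
  \sum_p (if (cls p < D)%N then eta (cls p) else 0) ^+ 2 =
  m%:R * \sum_(c < D) eta c ^+ 2.
Proof.
transitivity (\sum_p \sum_(c < D | cls p == c) eta c ^+ 2).
  apply: eq_bigr => p _; case: ltnP => h; last first.
    rewrite big_pred0 ?expr0n //.
    by move=> c; apply/negbTE; rewrite neq_ltn (leq_trans (ltn_ord c) h) orbT.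
  by rewrite (big_pred1 (Ordinal h)).
rewrite (exchange_big_dep xpredT) //= mulr_sumr; apply: eq_bigr => c _.
rewrite sumr_const -[_ *+ _]mulr_natl; congr (_%:R * _).
by rewrite -(cls_card (ltn_ord c)); apply: eq_card => p; rewrite !inE.
Qed.

Lemma chernoff_walk (eta : nat -> R) (t V : R) : 0 <= t -> 0 < V ->
  \sum_(c < D) eta c ^+ 2 <= V ->
  \sum_(A : {set J}) (t <= \sum_(c < D) eta c * walk A c)%R%:R <=
  2 ^+ #|J| * expR (- (t ^+ 2 / (8 * (m%:R * V)))).
Proof.
move=> t0 V0 hV.
have mV : 0 < m%:R * V by rewrite mulr_gt0 ?ltr0n.
have := @chernoff R J (fun p => if (cls p < D)%N then eta (cls p) else 0) t
  (m%:R * V) t0 mV.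
rewrite sum_sqr_cls ler_wpM2l // => /(_ isT) h; apply: le_trans h.
by apply: ler_sum => A _; rewrite signed_sum_cls.
Qed.

(** Equal to the product of the binomial coefficients of m over b c, times the free choices of coins
    outside the classes. The ratio of neighbouring values is counted directly, so this closed form
    is never computed. *)
Definition fiber (b : nat -> nat) : nat :=
  #|[set A : {set J} | [forall c : 'I_D, ones A c == b c]]|.

Lemma eq_fiber b b' : (forall c, (c < D)%N -> b c = b' c) -> fiber b = fiber b'.
Proof.
move=> h; apply: eq_card => A; rewrite !inE; apply: eq_forallb => c.
by rewrite h.
Qed.

Lemma ones_setU1 (A : {set J}) p c : p \notin A -> ones (p |: A) c = (ones A c + (cls p == c))%N.
Proof.
move=> pA; rewrite /ones; case: eqP => h /=.
  have -> : [set q in p |: A | cls q == c] = p |: [set q in A | cls q == c].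
    apply/setP => q; rewrite !inE; case: eqP => [->|] //=; by rewrite h eqxx.
  by rewrite cardsU1 !inE (negbTE pA) /= addnC.
rewrite addn0; apply: eq_card => q; rewrite !inE.
by case: eqP => [->|] //=; rewrite (negbTE pA); apply/eqP.
Qed.

(* Both sides count the pairs of an outcome in the fiber of [b] and a tail of
   class [c] that is turned into a head. *)
Lemma fiber_ratio b c : (c < D)%N ->
  ((m - b c) * fiber b =
   (b c).+1 * fiber (fun c' => if c' == c then (b c).+1 else b c'))%N.
Proof.
move=> cD; set b' := fun c' => _.
pose S (f : nat -> nat) := [set A : {set J} | [forall c : 'I_D, ones A c == f c]].
have onesE f A : A \in S f -> ones A c = f c.
  by rewrite inE => /forallP /(_ (Ordinal cD)) /eqP.
transitivity (\sum_(A in S b) \sum_(p | (cls p == c) && (p \notin A)) 1)%N.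
  rewrite mulnC /fiber -sum_nat_const; apply: eq_bigr => A hA.
  rewrite sum1_card -(onesE b A hA) -(cls_card cD) -(cardsID A [set p | cls p == c]).
  have -> : #|[set p | cls p == c] :&: A| = ones A c.
    by apply: eq_card => p; rewrite !inE andbC.
  by rewrite addKn; apply: eq_card => p; rewrite !inE andbC.
transitivity (\sum_(A in S b') \sum_(p | (cls p == c) && (p \in A)) 1)%N; last first.
  rewrite mulnC /fiber -sum_nat_const; apply: eq_bigr => A hA.
  have -> : (b c).+1 = ones A c by rewrite (onesE b' A hA) /b' eqxx.
  by rewrite sum1_card; apply: eq_card => p; rewrite !inE andbC.
rewrite (exchange_big_dep (fun p => cls p == c)) /=; last by move=> A p _ /andP[].
rewrite [RHS](exchange_big_dep (fun p => cls p == c)) /=;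
  last by move=> A p _ /andP[].
apply: eq_bigr => p /eqP hp.
rewrite [RHS](reindex_onto (fun A => p |: A) (fun A => A :\ p)) /=; last first.
  by move=> A /andP[_ /andP[_ pA]]; apply: setD1K.
apply: eq_bigl => A; rewrite hp eqxx setU11 /= andbT.
have [pA|pA] := boolP (p \in A); rewrite ?andbF ?andbT.
  have -> : ((p |: A) :\ p == A) = false.
    by apply/eqP => /setP /(_ p); rewrite !inE eqxx pA.
  by rewrite andbF.
rewrite setU1K // eqxx andbT !inE; apply: eq_forallb => c'.
rewrite ones_setU1 // hp /b' [c == _]eq_sym; have [->|_] := eqVneq (c' : nat) c.
  by rewrite addn1 eqSS.
by rewrite addn0.
Qed.

Lemma fiber_shift (X : R) (f f' : nat -> nat) : X <= 1 / 2 ->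
  (forall c, (c < D)%N -> (f c <= m)%N /\ (f' c <= m)%N) ->
  let w c := 2 * (f c)%:R - m%:R in
  let De c := (f' c)%:R - (f c)%:R in
  (forall c, (c < D)%N -> `|w c| + 2 * `|De c| <= X * (m%:R + 1)) ->
  (fiber f)%:R <= expR (\sum_(c < D)
     (2 * (De c * w c + De c ^+ 2) / (m%:R + 1) + 2 * `|De c| * X ^+ 2))
     * (fiber f')%:R.
Proof.
move=> X2 hm w De hX.
(* Hybrid profiles move one class at a time, so each step is a shift of a single binomial. *)
pose h k c := if (c < k)%N then f' c else f c.
suff main k : (k <= D)%N -> (fiber f)%:R <= expR (\sum_(c < k)
     (2 * (De c * w c + De c ^+ 2) / (m%:R + 1) + 2 * `|De c| * X ^+ 2))
     * (fiber (h k))%:R.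
  apply: le_trans (main D (leqnn D)) _.
  by rewrite (@eq_fiber (h D) f') // => c cD; rewrite /h cD.
elim: k => [|k IH] kD.
  by rewrite big_ord0 expR0 mul1r (@eq_fiber (h 0%N) f).
apply: le_trans (IH (ltnW kD)) _.
rewrite big_ord_recr /= expRD -mulrA ler_wpM2l ?expR_ge0 //.
pose a v : R := (fiber (fun c => if c == k then v else h k c))%:R.
have -> : (fiber (h k))%:R = a (f k).
  congr (_%:R); apply: eq_fiber => c _; case: eqP => // ->.
  by rewrite /h ltnn.
have -> : (fiber (h k.+1))%:R = a (f' k).
  congr (_%:R); apply: eq_fiber => c _; rewrite /h ltnS leq_eqVlt.
  by case: eqP => //= ->.
have [fm fm'] := hm _ kD.
apply: (ratio_le X2 fm fm' _ _ (hX _ kD)) => v; first exact: ler0n.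
move=> vm; have := fiber_ratio (fun c => if c == k then v else h k c) kD.
rewrite eqxx => e; rewrite /a -natrB ?(ltnW vm) // -!natrM.
congr (_%:R); rewrite mulnC e mulnC; congr (_ * _)%N.
by apply: eq_fiber => c _; case: eqP.
Qed.

End BinomialMechanism.

(** * Approximate differential privacy of binomial noise *)

Section BinomialPrivacy.
Variables (R : realType) (J : finType) (cls : J -> nat) (D m : nat).
Hypothesis cls_card : forall c, (c < D)%N -> #|[set p | cls p == c]| = m.
Hypothesis m_gt0 : (0 < m)%N.
Local Notation ones := (ones cls).
Local Notation fiber := (fiber cls D).
Local Notation walk := (@walk R J cls m).

Definition bounded_ext (f : {ffun 'I_D -> 'I_m.+1}) (c : nat) : nat :=
  if insub c is Some i then f i else 0%N.

Lemma bounded_extE f (c : nat) (cD : (c < D)%N) : bounded_ext f c = f (Ordinal cD).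
Proof. by rewrite /bounded_ext insubT. Qed.

Definition agree (f f' : nat -> nat) : Prop := forall c, (c < D)%N -> f c = f' c.

Lemma sum_fiber (h : (nat -> nat) -> R) :
  (forall f f', agree f f' -> h f = h f') ->
  \sum_(A : {set J}) h (ones A) =
  \sum_(f : {ffun 'I_D -> 'I_m.+1}) (fiber (bounded_ext f))%:R * h (bounded_ext f).
Proof.
move=> hext; pose F (A : {set J}) := [ffun c : 'I_D => inord (ones A c) : 'I_m.+1].
have FE A f : (F A == f) = [forall c : 'I_D, ones A c == bounded_ext f c].
  apply/eqP/forallP => [<- c|hf].
    rewrite bounded_extE ffunE; have -> : Ordinal (ltn_ord c) = c by apply: val_inj.
    by rewrite inordK // ltnS (ones_le cls_card).
  apply/ffunP => c; rewrite ffunE; have /eqP := hf c; rewrite bounded_extE.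
  have -> : Ordinal (ltn_ord c) = c by apply: val_inj.
  by move=> ->; rewrite inord_val.
rewrite (partition_big F xpredT) //=; apply: eq_bigr => f _.
rewrite (eq_bigr (fun=> h (bounded_ext f))).
  rewrite sumr_const mulr_natl; congr (_ *+ _); apply: eq_card => A.
  by rewrite !inE -FE.
move=> A; rewrite FE => /forallP hA; apply: hext => c cD.
by have /eqP := hA (Ordinal cD).
Qed.

(** Noise [f] on data [s] and noise [f + s - s'] on data [s'] give the same view. On good profiles
    this shift stays in range, is injective and costs a factor exp(e); the other outcomes are paid
    for additively. *)
Lemma fiber_dp (s s' : nat -> nat) (g : (nat -> nat) -> R)
    (good : (nat -> nat) -> bool) (e : R) :
  (forall f f', agree f f' -> g f = g f') -> (forall f, 0 <= g f <= 1) ->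
  (forall f f', agree f f' -> good f = good f') ->
  (forall f, (forall c, (c < D)%N -> (f c <= m)%N) -> good f ->
     (forall c, (c < D)%N -> (s' c <= f c + s c)%N /\ (f c + s c - s' c <= m)%N) /\
     (fiber f)%:R <= expR e * (fiber (fun c => f c + s c - s' c)%N)%:R) ->
  \sum_(A : {set J}) g (fun c => s c + ones A c)%N <=
  expR e * \sum_(A : {set J}) g (fun c => s' c + ones A c)%N +
  \sum_(A : {set J}) (~~ good (ones A))%:R.
Proof.
move=> gext g01 goodext hgood.
have g0 f : 0 <= g f by case/andP: (g01 f).
apply: (@le_trans _ _ (\sum_(A : {set J})
    (good (ones A))%:R * g (fun c => s c + ones A c)%N +
    \sum_(A : {set J}) (~~ good (ones A))%:R)).
  rewrite -big_split /=; apply: ler_sum => A _; case: (good _) => /=.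
    by rewrite mul1r addr0.
  by rewrite mul0r add0r; case/andP: (g01 (fun c => s c + ones A c)%N).
rewrite lerD2r.
rewrite (@sum_fiber (fun f => (good f)%:R * g (fun c => s c + f c)%N)); last first.
  move=> f f' ff; rewrite (goodext _ _ ff); congr (_ * _); apply: gext => c cD.
  by rewrite ff.
rewrite (@sum_fiber (fun f => g (fun c => s' c + f c)%N)); last first.
  by move=> f f' ff; apply: gext => c cD; rewrite ff.
pose sh (f : {ffun 'I_D -> 'I_m.+1}) :=
  [ffun i : 'I_D => inord (bounded_ext f i + s i - s' i) : 'I_m.+1].
pose G := [set f : {ffun 'I_D -> 'I_m.+1} | good (bounded_ext f)].
have bm f c : (c < D)%N -> (bounded_ext f c <= m)%N.
  by move=> cD; rewrite bounded_extE -ltnS.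
have shE f : f \in G -> agree (bounded_ext (sh f))
    (fun c => bounded_ext f c + s c - s' c)%N.
  rewrite inE => fG c cD; rewrite bounded_extE ffunE /= inordK // ltnS.
  by have [h _] := hgood _ (bm f) fG; have [] := h _ cD.
have shinj : {in G &, injective sh}.
  move=> f1 f2 h1 h2 e12; apply/ffunP => i; apply/val_inj.
  have := shE _ h1 _ (ltn_ord i); rewrite e12 (shE _ h2 _ (ltn_ord i)).
  move: h1 h2; rewrite !inE => h1 h2.
  have [k1 _] := hgood _ (bm f1) h1; have [k2 _] := hgood _ (bm f2) h2.
  have [l1 _] := k1 _ (ltn_ord i); have [l2 _] := k2 _ (ltn_ord i).
  have ei : Ordinal (ltn_ord i) = i by apply: val_inj.
  by move: l1 l2; rewrite !bounded_extE ei /=; lia.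
pose H f := (fiber (bounded_ext f))%:R * g (fun c => s' c + bounded_ext f c)%N.
have H0 f : 0 <= H f by rewrite mulr_ge0.
apply: (@le_trans _ _ (expR e * \sum_(f in G) H (sh f))); last first.
  rewrite ler_wpM2l ?expR_ge0 // -(big_imset H shinj) /=.
  rewrite [leRHS](bigID (mem (sh @: G))) /= lerDl.
  by apply: sumr_ge0 => f _; exact: H0.
rewrite mulr_sumr [leRHS]big_mkcond /=; apply: ler_sum => f _.
rewrite inE; case fG : (good _) => /=; last by rewrite mul0r mulr0.
have fG' : f \in G by rewrite inE.
have [h1 h2] := hgood _ (bm f) fG.
rewrite mul1r /H (@eq_fiber _ _ _ (bounded_ext (sh f)) _ (shE f fG')).
rewrite (gext (fun c => s' c + bounded_ext (sh f) c)%N (fun c => s c + bounded_ext f c)%N).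
  by rewrite mulrA ler_wpM2r.
by move=> c cD; rewrite shE //; have [h3 _] := h1 _ cD; lia.
Qed.

Lemma bool_natr_le (b : bool) (x : R) : 0 <= x -> (b -> 1 <= x) -> b%:R <= x.
Proof. by case: b => // _ /(_ isT). Qed.

(** Union bound: half of [dl] covers the linear form, the other half the 2D one-sided deviations of
    single classes, each an instance of [chernoff_walk] with an indicator as weight. *)
Lemma bad_outcomes (De : nat -> R) (W t B dl : R) :
  0 <= W -> 0 <= t -> 0 < B -> \sum_(c < D) De c ^+ 2 <= B ^+ 2 ->
  expR (- (t ^+ 2 / (8 * (m%:R * B ^+ 2)))) <= dl / 2 ->
  2 * D%:R * expR (- (W ^+ 2 / (8 * m%:R))) <= dl / 2 ->
  \sum_(A : {set J}) (~~ ([forall c : 'I_D, `|walk A c| <= W] &&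
      (\sum_(c < D) De c * walk A c <= t)))%:R <= 2 ^+ #|J| * dl.
Proof.
move=> W0 t0 B0 hB h1 h2.
have V1 (c : 'I_D) : \sum_(c' < D) ((c' == c :> nat)%:R : R) ^+ 2 <= 1.
  rewrite (bigD1 c) //= eqxx expr1n big1 ?addr0 // => c' ne.
  by rewrite -val_eqE /= in ne; rewrite (negbTE ne) expr0n.
have V1' (c : 'I_D) : \sum_(c' < D) (- ((c' == c :> nat)%:R : R)) ^+ 2 <= 1.
  by under eq_bigr do rewrite sqrrN; apply: V1.
have linE (c : 'I_D) A : \sum_(c' < D) (c' == c :> nat)%:R * walk A c' = walk A c.
  rewrite (bigD1 c) //= eqxx mul1r big1 ?addr0 // => c' ne.
  by rewrite -val_eqE /= in ne; rewrite (negbTE ne) mul0r.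
have t1 (c : 'I_D) := @chernoff_walk R J cls D m cls_card m_gt0
  (fun c' => (c' == c :> nat)%:R) W 1 W0 ltr01 (V1 c).
have t2 (c : 'I_D) := @chernoff_walk R J cls D m cls_card m_gt0
  (fun c' => - (c' == c :> nat)%:R) W 1 W0 ltr01 (V1' c).
have t3 := chernoff_walk cls_card m_gt0 t0 (exprn_gt0 2 B0) hB.
apply: (@le_trans _ _ (\sum_(A : {set J}) (\sum_(c : 'I_D)
   ((W <= \sum_(c' < D) (c' == c :> nat)%:R * walk A c')%R%:R +
    (W <= \sum_(c' < D) (- (c' == c :> nat)%:R) * walk A c')%R%:R) +
    (t <= \sum_(c < D) De c * walk A c)%R%:R))).
  apply: ler_sum => A _; apply: bool_natr_le.
    by rewrite addr_ge0 // sumr_ge0 // => c _; rewrite addr_ge0.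
  rewrite negb_and => /orP[/forallPn[c]|]; rewrite -ltNge => hc; last first.
    rewrite (ltW hc) lerDr; apply: sumr_ge0 => c _; by rewrite addr_ge0.
  rewrite (bigD1 c) //= -!addrA.
  have -> : \sum_(c' < D) - (c' == c :> nat)%:R * walk A c' = - walk A c.
    by rewrite -linE -sumrN; apply: eq_bigr => c' _; rewrite mulNr.
  rewrite linE.
  set x := _ + (t <= _)%R%:R; have x0 : 0 <= x.
    by rewrite addr_ge0 // sumr_ge0 // => c' _; rewrite addr_ge0.
  case: (lerP 0 (walk A c)) => hw.
    rewrite ger0_norm // in hc; rewrite (ltW hc) lerDl addr_ge0 //.
  rewrite ltr0_norm // in hc; rewrite (ltW hc) addrCA lerDl addr_ge0 //.
rewrite big_split /= exchange_big /=.
apply: (@le_trans _ _ (\sum_(c < D) (2 ^+ #|J| * (2 * expR (- (W ^+ 2 / (8 * m%:R)))))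
   + 2 ^+ #|J| * (dl / 2))).
  apply: lerD; last by apply: le_trans t3 _; rewrite ler_wpM2l ?exprn_ge0.
  apply: ler_sum => c _; rewrite big_split /=.
  have := t1 c; have := t2 c; rewrite !mulr1; lra.
rewrite sumr_const card_ord -[_ *+ D]mulr_natr.
have := ler_wpM2l (exprn_ge0 #|J| (ler0n R 2)) h2; lra.
Qed.

(** [B] and [S1] bound the l2- and l1-sensitivity, [W] is the window for the walks and [X] bounds
    the normalised deviations. In the loss, the linear form takes e/2 because t = em/4; the
    quadratic and second-order terms take the other e/2. *)
Theorem binomial_dp (s s' : nat -> nat) (g : (nat -> nat) -> R)
    (e dl X W B S1 : R) :
  let De c : R := (s c)%:R - (s' c)%:R in
  let t := e * m%:R / 4 in
  (forall f f', agree f f' -> g f = g f') -> (forall f, 0 <= g f <= 1) ->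
  0 < e -> 0 <= W -> 0 < B -> X <= 1 / 2 ->
  \sum_(c < D) De c ^+ 2 <= B ^+ 2 -> \sum_(c < D) `|De c| <= S1 ->
  W + 2 * B <= X * (m%:R + 1) ->
  2 * B ^+ 2 / m%:R + 2 * S1 * X ^+ 2 <= e / 2 ->
  expR (- (t ^+ 2 / (8 * (m%:R * B ^+ 2)))) <= dl / 2 ->
  2 * D%:R * expR (- (W ^+ 2 / (8 * m%:R))) <= dl / 2 ->
  \sum_(A : {set J}) g (fun c => s c + ones A c)%N <=
  expR e * \sum_(A : {set J}) g (fun c => s' c + ones A c)%N + 2 ^+ #|J| * dl.
Proof.
move=> De t gext g01 e0 W0 B0 X2 hB hS hX hloss tail1 tail2.
have m0 : 0 < m%:R :> R by rewrite ltr0n.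
have t0 : 0 <= t by rewrite /t divr_ge0 // mulr_ge0 // ltW.
pose wf (f : nat -> nat) c : R := 2 * (f c)%:R - m%:R.
pose good (f : nat -> nat) := [forall c : 'I_D, `|wf f c| <= W] &&
      (\sum_(c < D) De c * wf f c <= t).
apply: le_trans (@fiber_dp s s' g good e gext g01 _ _) _.
- move=> f f' ff; rewrite /good; congr (_ && _).
    by apply: eq_forallb => c; rewrite /wf ff.
  congr (_ <= _); by apply: eq_bigr => c _; rewrite /wf ff.
- move=> f fm /andP[/forallP hW hlin].
  have DeB c : (c < D)%N -> `|De c| <= B.
    move=> cD; rewrite -ler_sqr ?nnegrE ?(ltW B0) // real_normK ?num_real //.
    apply: le_trans hB; rewrite (bigD1 (Ordinal cD)) //= lerDl.
    by apply: sumr_ge0 => i _; apply: sqr_ge0.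
  have hXc c : (c < D)%N -> `|wf f c| + 2 * `|De c| <= X * (m%:R + 1).
    move=> cD; apply: le_trans hX; apply: lerD; first exact: (hW (Ordinal cD)).
    by rewrite ler_pM2l // DeB.
  have rng c : (c < D)%N -> (s' c <= f c + s c)%N /\ (f c + s c - s' c <= m)%N.
    move=> cD; have h := hXc _ cD.
    have h12 : X * (m%:R + 1) <= 1 / 2 * (m%:R + 1) by rewrite ler_wpM2r // ltW // ltr_wpDl.
    have m1 : 1 <= m%:R :> R by rewrite ler1n.
    have [h3 h4] : - `|wf f c| <= wf f c /\ wf f c <= `|wf f c|.
      by rewrite lerNl -normrN ler_norm normrN ler_norm.
    have [h5 h6] : - `|De c| <= De c /\ De c <= `|De c|.
      by rewrite lerNl -normrN ler_norm normrN ler_norm.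
    rewrite /wf /De in h h3 h4 h5 h6.
    have a1 : (s' c <= f c + s c)%N by rewrite -(ler_nat R) natrD; lra.
    split=> //; rewrite leq_subLR -(ler_nat R) !natrD; lra.
  split=> //; pose f' c := (f c + s c - s' c)%N.
  have DeE c : (c < D)%N -> (f' c)%:R - (f c)%:R = De c.
    by move=> cD; have [h _] := rng _ cD; rewrite /f' natrB // natrD /De; lra.
  have hf c : (c < D)%N -> (f c <= m)%N /\ (f' c <= m)%N.
    by move=> cD; split; [exact: fm|case: (rng _ cD)].
  have hx c : (c < D)%N -> `|2 * (f c)%:R - m%:R| + 2 * `|(f' c)%:R - (f c)%:R|
      <= X * (m%:R + 1).
    by move=> cD; rewrite DeE //; apply: hXc.
  apply: le_trans (fiber_shift cls_card X2 hf hx) _.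
  rewrite ler_wpM2r // ler_expR.
  rewrite (eq_bigr (fun c : 'I_D => 2 * (m%:R + 1)^-1 * (De c * wf f c) +
     2 * (m%:R + 1)^-1 * De c ^+ 2 + 2 * X ^+ 2 * `|De c|)); last first.
    by move=> c _; rewrite DeE // /wf; ring.
  rewrite !big_split /= -!mulr_sumr.
  have i0 : 0 < (m%:R + 1)^-1 :> R by rewrite invr_gt0 ltr_wpDl.
  have a1 : 2 * (m%:R + 1)^-1 * \sum_(c < D) De c * wf f c <= e / 2.
    apply: (@le_trans _ _ (2 * (m%:R + 1)^-1 * t)).
      by rewrite ler_wpM2l // mulr_ge0 // ltW.
    rewrite mulrAC ler_pdivrMr ?ltr_wpDl // /t; nra.
  have a2 : 2 * (m%:R + 1)^-1 * \sum_(c < D) De c ^+ 2 <= 2 * B ^+ 2 / m%:R.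
    rewrite mulrAC; apply: ler_pM.
    - by rewrite mulr_ge0 // sumr_ge0 // => c _; apply: sqr_ge0.
    - exact: ltW.
    - by rewrite ler_wpM2l.
    - by rewrite lef_pV2 ?posrE ?ltr_wpDl // lerDl.
  have a3 : 2 * X ^+ 2 * \sum_(c < D) `|De c| <= 2 * S1 * X ^+ 2.
    by rewrite [leRHS]mulrAC ler_wpM2l // mulr_ge0 // sqr_ge0.
  lra.
- rewrite lerD2l; exact: (bad_outcomes W0 t0 B0 hB tail1 tail2).
Qed.

End BinomialPrivacy.

(** * Random tapes, shuffling and hashing *)

Section Tapes.
Variables (n L N D : nat).
Hypotheses (N_gt0 : (0 < N)%N) (DN_le : (D * N <= L)%N).
Local Notation coin := ('I_n * 'I_L)%type.

(** Tapes are identified with the set of positions holding a 1, so uniform tapes become the uniform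
    subsets of the binomial mechanism. *)
Definition tapes_of (A : {set coin}) : {ffun 'I_n -> L.-tuple bool} :=
  [ffun i => [tuple (i, p) \in A | p < L]].

Definition set_of_tapes (f : {ffun 'I_n -> L.-tuple bool}) : {set coin} :=
  [set q | tnth (f q.1) q.2].

Lemma set_of_tapesK : cancel set_of_tapes tapes_of.
Proof.
move=> f; apply/ffunP => i; apply: eq_from_tnth => p.
by rewrite ffunE tnth_mktuple inE.
Qed.

Lemma tapes_ofK : cancel tapes_of set_of_tapes.
Proof. by move=> A; apply/setP => -[i p]; rewrite inE ffunE tnth_mktuple. Qed.

Lemma tapes_of_bij : bijective tapes_of.
Proof. exact: Bijective tapes_ofK set_of_tapesK. Qed.

Lemma unif_tapes (R : realType) (h : {ffun 'I_n -> L.-tuple bool} -> R) :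
  unif h = (\sum_(A : {set coin}) h (tapes_of A)) / 2 ^+ #|{: coin}|.
Proof.
rewrite /unif (reindex tapes_of) /=; last exact/onW_bij/tapes_of_bij.
rewrite -natrX; congr (_ / _%:R).
by rewrite card_ffun card_tuple card_bool card_prod !card_ord -expnM mulnC.
Qed.

(** The code served by a tape position; positions past [D * N] fall into classes from [D] on and are
    never read as noise. *)
Definition coin_class (q : coin) : nat := q.2 %/ N.

Lemma coin_class_card c : (c < D)%N ->
  #|[set q | coin_class q == c]| = (n * N)%N.
Proof.
move=> cD.
have lt (r : 'I_N) : (c * N + r < L)%N.
  by apply: leq_trans DN_le; have := ltn_ord r; nia.
pose f (x : 'I_n * 'I_N) : coin := (x.1, Ordinal (lt x.2)).
have finj : injective f.
  move=> [i r] [i' r'] [-> /eqP]; rewrite eqn_add2l => /eqP h.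
  by congr (_, _); apply: val_inj.
have -> : [set q | coin_class q == c] = f @: setT.
  apply/setP => -[i p]; rewrite inE /coin_class /=; apply/eqP/imsetP.
    move=> h; have rN : (p %% N < N)%N by rewrite ltn_mod.
    exists (i, Ordinal rN) => //; congr (_, _); apply: val_inj => /=.
    by rewrite -h -divn_eq.
  by case=> -[i' r] _ [_ ->] /=; rewrite divnMDl // divn_small // addn0.
by rewrite card_imset // cardsT card_prod !card_ord.
Qed.

Lemma sum_tapes_ones A c : (c < D)%N ->
  (\sum_(i < n) \sum_(p < D * N) ((p %/ N == c) && tape (tapes_of A i) p) =
   ones coin_class A c)%N.
Proof.
move=> cD; rewrite /ones -sum1_card [RHS]big_mkcond /=.
pose F i p := (if (i, p) \in [set q in A | coin_class q == c] then 1 else 0)%N.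
rewrite [RHS](eq_bigr (fun q => F q.1 q.2)); last by case=> i p _; rewrite /F /= !inE.
rewrite -(pair_bigA _ F) /=.
apply: eq_bigr => i _.
rewrite (big_ord_widen _ (fun p => nat_of_bool ((p %/ N == c)%N && tape (tapes_of A i) p))
  DN_le) big_mkcond /=.
apply: eq_bigr => p _; rewrite /F !inE /coin_class /=.
have -> : tape (tapes_of A i) p = ((i, p) \in A).
  by rewrite /tape -tnth_nth ffunE tnth_mktuple.
case: ltnP => h; first by rewrite andbC; case: (_ && _).
case: eqP => [e|_]; last by rewrite andbF.
by move: h; rewrite leqNgt -ltn_divLR // e cD.
Qed.

Lemma sum_tapes_out (f : {ffun 'I_n -> L.-tuple bool}) c : (D <= c)%N ->
  (\sum_(i < n) \sum_(p < D * N) ((p %/ N == c) && tape (f i) p) = 0)%N.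
Proof.
move=> Dc; rewrite big1 // => i _; rewrite big1 // => p _.
case: eqP => // e; have := ltn_ord p; rewrite -ltn_divLR // e; lia.
Qed.

End Tapes.

(** * A shuffled view depends only on the message counts *)

Section Shuffling.
Variable R : realType.
Implicit Type F : seq nat -> R.

Definition shuffle_mean F (m : seq nat) : R :=
  unif (fun s : 'S_(size m) => F (shuffle s)).

(** The index type ['S_(size m)] depends on the list; tuples give a list and its rearrangements a
    common one. *)
Lemma shuffle_mean_tuple F k (t : k.-tuple nat) :
  shuffle_mean F t = unif (fun s : 'S_k => F [seq nth 0%N t (s i) | i <- enum 'I_k]).
Proof. by case: t => m hm /=; have /eqP E := hm; subst k. Qed.

(** The permutation relating the two lists is absorbed by translating the uniform permutation. *)
Lemma shuffle_mean_perm F m m' : perm_eq m m' ->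
  shuffle_mean F m = shuffle_mean F m'.
Proof.
move=> pm; pose t := in_tuple m'.
have sm : size m == size m' by apply/eqP/perm_size.
pose t0 := Tuple sm.
have /tuple_permP [p hp] : perm_eq t0 t by [].
rewrite -[m]/(tval t0) -[m']/(tval t) !shuffle_mean_tuple /unif; congr (_ / _).
rewrite [RHS](reindex_inj (mulIg p)) /=; apply: eq_bigr => s _; congr F.
apply: eq_map => i; transitivity (tnth t0 (s i)); first by rewrite (tnth_nth 0%N).
have -> : t0 = [tuple tnth t (p j) | j < size m'] by apply: val_inj.
by rewrite tnth_mktuple permM (tnth_nth 0%N).
Qed.

Lemma perm_shuffle (m : seq nat) (s : 'S_(size m)) : perm_eq (shuffle s) m.
Proof.
have /tuple_permP : exists p : 'S_(size m), shuffle s =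
    [tuple tnth (in_tuple m) (p i) | i < size m].
  exists s; rewrite /shuffle /=; apply: eq_map => i.
  by rewrite (tnth_nth 0%N).
by [].
Qed.

Definition canonical_seq (D : nat) (f : nat -> nat) : seq nat :=
  flatten [seq nseq (f c) c | c <- iota 0 D].

Lemma count_canonical_seq D f x :
  count_mem x (canonical_seq D f) = if (x < D)%N then f x else 0%N.
Proof.
rewrite /canonical_seq count_flatten -map_comp sumnE big_map.
rewrite (eq_bigr (fun c => (c == x) * f c)%N); last first.
  by move=> c _; rewrite /= count_nseq.
have -> : iota 0 D = index_iota 0 D by rewrite /index_iota subn0.
rewrite big_mkord.
case: ltnP => h; last first.
  by rewrite big1 // => c _; rewrite ltn_eqF // (leq_trans (ltn_ord c) h).
rewrite (bigD1 (Ordinal h)) //= eqxx mul1n big1 ?addn0 // => c.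
by rewrite -val_eqE /= => /negbTE->.
Qed.

Lemma shuffle_mean_counts F D f m :
  (forall x, count_mem x m = if (x < D)%N then f x else 0%N) ->
  shuffle_mean F m = shuffle_mean F (canonical_seq D f).
Proof.
move=> h; apply: shuffle_mean_perm; apply/allP => x _ /=.
by rewrite h count_canonical_seq.
Qed.

Lemma eq_canonical_seq D f f' : (forall c, (c < D)%N -> f c = f' c) ->
  canonical_seq D f = canonical_seq D f'.
Proof.
move=> h; congr flatten; apply/eq_in_map => c; rewrite mem_iota add0n => cD.
by rewrite h.
Qed.

Lemma unif_const (A : finType) (a0 : A) (c : R) : unif (fun _ : A => c) = c.
Proof.
rewrite /unif sumr_const -[c *+ _]mulr_natr mulfK // pnatr_eq0 -lt0n.
by apply/card_gt0P; exists a0.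
Qed.

Lemma unif_le (A : finType) (f g : A -> R) : (forall a, f a <= g a) ->
  unif f <= unif g.
Proof. by move=> h; rewrite /unif ler_wpM2r ?invr_ge0 // ler_sum. Qed.

Lemma unif_affine (A : finType) (a0 : A) (k c : R) (f : A -> R) :
  unif (fun a => k * f a + c) = k * unif f + c.
Proof.
have := unif_const a0 c; rewrite /unif => {2}<-.
by rewrite mulrA -mulrDl mulr_sumr -big_split.
Qed.

Lemma shuffle_mean01 F m : (forall x, 0 <= F x <= 1) -> 0 <= shuffle_mean F m <= 1.
Proof.
move=> h; rewrite /shuffle_mean.
have id1 : 'S_(size m) := 1%g.
apply/andP; split.
  rewrite -[leLHS](unif_const id1); apply: unif_le => s.
  by case/andP: (h (shuffle s)).
rewrite -[leRHS](unif_const id1); apply: unif_le => s.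
by case/andP: (h (shuffle s)).
Qed.

End Shuffling.

(** * Collision probability of the linear hash *)

Section HashCells.
Local Open Scope nat_scope.

Lemma hcell_lt pub ell r y : hcell pub ell r y < 2 ^ r.
Proof.
elim: r => [|r IH]; first by rewrite /hcell big_ord0.
rewrite /hcell big_ord_recr /= -/(hcell _ _ _ _) expnS; case: hbit => /=; lia.
Qed.

Lemma hcell_inj pub ell r y y' : hcell pub ell r y = hcell pub ell r y' ->
  forall i, i < r -> hbit pub ell y i = hbit pub ell y' i.
Proof.
elim: r => // r IH; rewrite /hcell !big_ord_recr /= -!/(hcell _ _ _ _) => h.
have l1 := hcell_lt pub ell r y; have l2 := hcell_lt pub ell r y'.
have hb : hbit pub ell y r = hbit pub ell y' r.
  by move: h; case: (hbit _ _ y r); case: (hbit _ _ y' r) => //=; lia.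
have {}h : hcell pub ell r y = hcell pub ell r y' by move: h; rewrite hb; lia.
move=> i; rewrite ltnS leq_eqVlt => /orP[/eqP->|] //; exact: IH.
Qed.

End HashCells.

Section Hashing.
Variables (L ell kh : nat).
Hypothesis key_le : (kh * ell <= L)%N.
Local Open Scope nat_scope.

Definition flip (p0 : nat) (t : L.-tuple bool) : L.-tuple bool :=
  [tuple if i == p0 :> nat then ~~ tnth t i else tnth t i | i < L].

Lemma flipK p0 : involutive (flip p0).
Proof.
move=> t; apply: eq_from_tnth => i; rewrite !tnth_mktuple.
by case: eqP => // _; rewrite negbK.
Qed.

Lemma tape_flip p0 t p : p0 < L ->
  tape (flip p0 t) p = if p == p0 then ~~ tape t p else tape t p.
Proof.
move=> p0L; case: (ltnP p L) => h.
  rewrite /tape -[p]/(val (Ordinal h)) -!tnth_nth tnth_mktuple.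
  by [].
by rewrite /tape !nth_default ?size_tuple // gtn_eqF // (leq_trans p0L).
Qed.

Lemma hbit_flip t y r i k0 : r < kh -> k0 < ell ->
  hbit (tape (flip (r * ell + k0) t)) ell y i =
  hbit (tape t) ell y i (+) ((i == r) && ybit y (ell - k0.+1)).
Proof.
move=> rk k0l.
have p0L : r * ell + k0 < L by apply: leq_trans key_le; nia.
have posE (k : 'I_ell) : (i * ell + k == r * ell + k0) = (i == r) && (k == k0 :> nat).
  apply/eqP/andP => [e|[/eqP-> /eqP->]] //.
  have ei : i = r.
    have := congr1 (fun x => x %/ ell) e; rewrite !divnMDl; try lia.
    by rewrite !divn_small // !addn0.
  by move: e; rewrite ei eqxx => /eqP; rewrite eqn_add2l.
transitivity (\big[addb/false]_(k < ell)
   ((ybit y (ell - k.+1) && tape t (i * ell + k)) (+)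
    ((k == k0 :> nat) && ((i == r) && ybit y (ell - k0.+1))))).
  apply: eq_bigr => k _; rewrite tape_flip // posE.
  case: eqP => [->|] /=; last by rewrite andbF addbF.
  case: eqP => [->|] /=; last by rewrite addbF.
  by case: ybit; case: tape.
rewrite big_split /= -/(hbit _ _ _ _); congr (_ (+) _).
rewrite (bigD1 (Ordinal k0l)) //= eqxx big1 ?addbF // => k.
by rewrite -val_eqE /= => /negbTE->.
Qed.

Definition collisions r y y' : {set L.-tuple bool} :=
  [set t | [forall i : 'I_r, hbit (tape t) ell y i == hbit (tape t) ell y' i]].

Lemma ybit_differ y y' : y < 2 ^ ell -> y' < 2 ^ ell -> y != y' ->
  exists2 k, k < ell & ybit y (ell - k.+1) != ybit y' (ell - k.+1).
Proof.
move=> hy hy' ne.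
case: (boolP [exists e : 'I_ell, ybit y e != ybit y' e]) => [/existsP[e he]|].
  exists (ell - e.+1); first by have := ltn_ord e; lia.
  by have -> : ell - (ell - e.+1).+1 = e by have := ltn_ord e; lia.
rewrite negb_exists => /forallP h.
suff E e : e <= ell -> y %% 2 ^ e = y' %% 2 ^ e.
  by have := E ell (leqnn _); rewrite !modn_small // => e; rewrite e eqxx in ne.
elim: e => [|e IH] he; first by rewrite expn0 !modn1.
rewrite !modn_pow2S IH ?(ltnW he) //.
by have := h (Ordinal he); rewrite negbK => /eqP /= ->.
Qed.

(** Flip the public bit in row [r] that masks a digit where [y] and [y'] differ. This breaks the
    agreement in row [r] and leaves earlier rows alone, so it injects the collisions of r + 1 rows
    into those of r rows that they do not contain. *)
Lemma collisions_half r y y' : y < 2 ^ ell -> y' < 2 ^ ell -> y != y' -> r < kh ->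
  2 * #|collisions r.+1 y y'| <= #|collisions r y y'|.
Proof.
move=> hy hy' ne rk; have [k0 k0l hk0] := ybit_differ hy hy' ne.
pose f := flip (r * ell + k0).
have sub : collisions r.+1 y y' \subset collisions r y y'.
  apply/subsetP => t; rewrite !inE => /forallP h; apply/forallP => i.
  exact: (h (widen_ord (leqnSn r) i)).
have sub2 : f @: collisions r.+1 y y' \subset
    collisions r y y' :\: collisions r.+1 y y'.
  apply/subsetP => _ /imsetP[t ht ->].
  move: ht; rewrite !inE => /forallP h; apply/andP; split.
    apply/forallPn; exists ord_max; rewrite /f !hbit_flip //= eqxx /=.
    have /eqP -> := h ord_max; move: hk0.
    by case: hbit; case: ybit; case: ybit.
  apply/forallP => i; rewrite /f !hbit_flip //= ltn_eqF //= !addbF.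
  exact: (h (widen_ord (leqnSn r) i)).
have := subset_leq_card sub2; rewrite card_imset; last exact: inv_inj (flipK _).
rewrite cardsD (setIidPr sub) leq_subRL ?subset_leq_card //.
by rewrite mul2n -addnn.
Qed.

Lemma collisions_card r y y' : y < 2 ^ ell -> y' < 2 ^ ell -> y != y' -> r <= kh ->
  2 ^ r * #|collisions r y y'| <= 2 ^ L.
Proof.
move=> hy hy' ne; elim: r => [|r IH] rk.
  by rewrite mul1n (leq_trans (max_card _)) // card_tuple card_bool.
apply: leq_trans (IH (ltnW rk)); rewrite expnSr -mulnA.
by rewrite leq_mul2l collisions_half ?orbT.
Qed.

Lemma hash_collision_prob (R : realType) y y' :
  y < 2 ^ ell -> y' < 2 ^ ell -> y != y' ->
  (unif (fun t : L.-tuple bool =>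
     (hcell (tape t) ell kh y == hcell (tape t) ell kh y')%:R : R) <=
   ((2 ^ kh)%N%:R)^-1)%R.
Proof.
move=> hy hy' ne; rewrite /unif -natr_sum.
have p0 : (0 < (2 ^ L)%N%:R :> R)%R by rewrite ltr0n expn_gt0.
have q0 : (0 < (2 ^ kh)%N%:R :> R)%R by rewrite ltr0n expn_gt0.
rewrite card_tuple card_bool ler_pdivrMr // mulrC ler_pdivlMr // -natrM ler_nat.
apply: leq_trans (collisions_card hy hy' ne (leqnn kh)); rewrite mulnC.
rewrite leq_mul2l; apply/orP; right; rewrite -sum1_card [leqRHS]big_mkcond /=.
apply: leq_sum => t _; case: eqP => // e; rewrite inE.
have -> // : [forall i : 'I_kh, hbit (tape t) ell y i == hbit (tape t) ell y' i].
by apply/forallP => i; apply/eqP; apply: hcell_inj e _ _.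
Qed.

End Hashing.

(** * Sensitivity of the data counts *)

Section SumBounds.
Variable R : realType.

Lemma sqr_sum_le (I : finType) (A : {pred I}) (a : I -> R) :
  (\sum_(i in A) a i) ^+ 2 <= #|A|%:R * \sum_(i in A) a i ^+ 2.
Proof.
rewrite expr2 mulr_suml.
under eq_bigr do rewrite mulr_sumr.
apply: (@le_trans _ _ (\sum_(i in A) \sum_(j in A) (a i ^+ 2 / 2 + a j ^+ 2 / 2))).
  apply: ler_sum => i _; apply: ler_sum => j _.
  by have := sqr_ge0 (a i - a j); rewrite sqrrB; lra.
rewrite (eq_bigr (fun i => #|A|%:R * (a i ^+ 2 / 2) +
    (\sum_(j in A) a j ^+ 2) / 2)); last first.
  by move=> i _; rewrite big_split /= sumr_const -mulr_suml mulr_natl.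
rewrite big_split /= -mulr_sumr -mulr_suml sumr_const -[_ *+ _]mulr_natl; lra.
Qed.

Lemma sum_delta_le (D k : nat) : \sum_(c < D) ((c == k :> nat)%:R : R) <= 1.
Proof.
case: (ltnP k D) => kD.
  rewrite (bigD1 (Ordinal kD)) //= eqxx big1 ?addr0 // => c.
  by rewrite -val_eqE /= => /negbTE->.
by rewrite big1 ?ler01 // => c _; rewrite ltn_eqF // (leq_trans (ltn_ord c)).
Qed.

Definition placed (b k : nat) (x : nat -> R) (c : nat) : R :=
  \sum_(e < k) (c == b + e)%N%:R * x e.

(** The positions of a block are distinct, so at most one summand is nonzero. *)
Lemma placed_sqr b k x c : placed b k x c ^+ 2 = placed b k (fun e => x e ^+ 2) c.
Proof.
rewrite /placed; case: (pickP (fun e : 'I_k => c == b + e)%N) => [e0 /eqP ->|h].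
  have E y : \sum_(e < k) (b + e0 == b + e)%N%:R * y e = y e0 :> R.
    rewrite (bigD1 e0) //= eqxx mul1r big1 ?addr0 // => e.
    by rewrite eqn_add2l eq_sym -val_eqE => /negbTE->; rewrite mul0r.
  by rewrite !E.
rewrite !big1 ?expr0n // => e _; by rewrite h mul0r.
Qed.

Lemma placed_sum_le (D b k : nat) (x : nat -> R) : (forall e, 0 <= x e) ->
  \sum_(c < D) placed b k x c <= \sum_(e < k) x e.
Proof.
move=> x0; rewrite /placed exchange_big /=; apply: ler_sum => e _.
by rewrite -mulr_suml ler_piMl // sum_delta_le.
Qed.

Lemma sum_double (f : nat -> R) k :
  \sum_(e < k.*2) f e = \sum_(j < k) (f j.*2 + f j.*2.+1).
Proof.
elim: k => [|k IH]; first by rewrite !big_ord0.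
by rewrite doubleS !big_ord_recr /= IH addrA.
Qed.

(** One of the two roundings is 0 and the other is below |x| + 1. *)
Lemma natceil_pm_sqr (x : R) :
  (natceil x)%:R ^+ 2 + (natceil (- x))%:R ^+ 2 <= 2 * x ^+ 2 + 2.
Proof.
wlog x0 : x / 0 <= x.
  move=> h; case: (leP 0 x) => [/h //|x0].
  have h' : 0 <= - x by lra.
  by have := h _ h'; rewrite opprK sqrrN; lra.
rewrite (@natceil_eq0 _ (- x)) ?oppr_le0 // expr0n addr0.
have := natceil_lt x0; have := natceil_ge x; set y := (natceil x)%:R => h1 h2.
have : y ^+ 2 <= (x + 1) ^+ 2 by rewrite ler_sqr ?nnegrE; lra.
have := sqr_ge0 (x - 1); rewrite sqrrB sqrrD; lra.
Qed.

Lemma natceil_pm_sum (x : R) :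
  (natceil x)%:R + (natceil (- x))%:R <= `|x| + 1 :> R.
Proof.
wlog x0 : x / 0 <= x.
  move=> h; case: (leP 0 x) => [/h //|x0].
  have h' : 0 <= - x by lra.
  by have := h _ h'; rewrite opprK normrN; lra.
rewrite (@natceil_eq0 _ (- x)) ?oppr_le0 // addr0 ger0_norm //.
by have := natceil_lt x0; lra.
Qed.

Lemma natceil_pm_diff (x : R) :
  `|(natceil x)%:R - (natceil (- x))%:R - x| <= 1 :> R.
Proof.
wlog x0 : x / 0 <= x.
  move=> h; case: (leP 0 x) => [/h //|x0].
  have h' : 0 <= - x by lra.
  have -> : (natceil x)%:R - (natceil (- x))%:R - x =
      - ((natceil (- x))%:R - (natceil x)%:R + x) by ring.
  by have := h _ h'; rewrite !opprK normrN.
rewrite (@natceil_eq0 _ (- x)) ?oppr_le0 // subr0.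
have := natceil_lt x0; have := natceil_ge x => h1 h2.
by rewrite ger0_norm; lra.
Qed.

End SumBounds.

Section Sensitivity.
Variables (R : realType) (P : params R).
Local Notation n := (nusers P).
Local Notation d := (dim P).
Local Notation T := (nbuckets P).
Local Notation K := (scale P).
Local Notation D := (ncodes P).
Variable pub : nat -> bool.

Lemma data_countE (u : user P) c : (data_count pub u c)%:R = \sum_(y in buckets u)
  placed (base P pub y) d.*2 (fun e => (entry (coord u) K e)%:R) c :> R.
Proof.
rewrite /data_count natr_sum; apply: eq_bigr => y _.
by rewrite natr_sum; apply: eq_bigr => e _; rewrite natrM.
Qed.

Lemma base_lt y e : (e < d.*2)%N -> (base P pub y + e < D)%N.
Proof.
move=> he; have := hcell_lt pub (key_bits P) (cell_bits P) y.
rewrite /base /ncodes; nia.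
Qed.

Lemma data_count_out (u : user P) c : (D <= c)%N -> data_count pub u c = 0%N.
Proof.
move=> Dc; rewrite /data_count big1 // => y _; rewrite big1 // => e _.
by rewrite gtn_eqF // (leq_trans (base_lt _ (ltn_ord e)) Dc).
Qed.

Lemma entry_even (u : user P) j : entry (coord u) K j.*2 = natceil (coord u j * K).
Proof. by rewrite /entry odd_double doubleK. Qed.

Lemma entry_odd (u : user P) j :
  entry (coord u) K j.*2.+1 = natceil (- (coord u j * K)).
Proof. by rewrite /entry /= odd_double /= uphalf_double mulNr. Qed.

Hypothesis K_ge : d%:R <= K.
Hypothesis d_gt0 : (0 < d)%N.

Let K1 : 1 <= K. Proof. by apply: le_trans K_ge; rewrite ler1n. Qed.

(** Rounding adds up to 2 per coordinate, 2d altogether, which 2K^2 absorbs since d <= K. *)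
Lemma entries_sqr (u : user P) : valid_user u ->
  \sum_(e < d.*2) (entry (coord u) K e)%:R ^+ 2 <= 4 * K ^+ 2 :> R.
Proof.
case=> _ /l2norm_le1 hv; rewrite (sum_double (fun e => (entry (coord u) K e)%:R ^+ 2)).
apply: (@le_trans _ _ (\sum_(j < d) (2 * K ^+ 2 * vec u 0 j ^+ 2 + 2))).
  apply: ler_sum => j _; rewrite entry_even entry_odd; apply: le_trans (natceil_pm_sqr _) _.
  by rewrite coordE exprMn; lra.
rewrite big_split /= -mulr_sumr sumr_const card_ord -[2 *+ _]mulr_natl.
have k0 : 0 <= 2 * K ^+ 2 by rewrite mulr_ge0 // sqr_ge0.
have := ler_wpM2l k0 hv; have K1' := K1; have : d%:R <= K ^+ 2.
  by apply: le_trans K_ge _; rewrite expr2; nra.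
lra.
Qed.

Lemma entries_sum (u : user P) : valid_user u ->
  \sum_(e < d.*2) (entry (coord u) K e)%:R <= 2 * d%:R * K :> R.
Proof.
move=> hu; rewrite (sum_double (fun e => (entry (coord u) K e)%:R)).
apply: (@le_trans _ _ (\sum_(j < d) (2 * K))).
  apply: ler_sum => j _; rewrite entry_even entry_odd; apply: le_trans (natceil_pm_sum _) _.
  have h := coord_le1 j hu; have K1' := K1.
  rewrite normrM (ger0_norm (_ : 0 <= K)); last by lra.
  have : `|coord u j| * K <= 1 * K by rewrite ler_wpM2r //; lra.
  by lra.
by rewrite sumr_const card_ord -[_ *+ _]mulr_natl; lra.
Qed.

(** Buckets sharing a cell may add up on the same code; Cauchy-Schwarz over the T buckets covers
    every overlap at once. *)
Lemma data_count_sqr (u : user P) : valid_user u ->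
  \sum_(c < D) (data_count pub u c)%:R ^+ 2 <= 4 * (T%:R * K) ^+ 2 :> R.
Proof.
move=> hu; have [hT _] := hu.
apply: (@le_trans _ _ (\sum_(c < D) T%:R * \sum_(y in buckets u)
  placed (base P pub y) d.*2 (fun e => (entry (coord u) K e)%:R ^+ 2) c)).
  apply: ler_sum => c _; rewrite data_countE -hT; apply: le_trans (sqr_sum_le _ _) _.
  by rewrite ler_wpM2l // ler_sum // => y _; rewrite placed_sqr.
rewrite -mulr_sumr exchange_big /=.
have -> : 4 * (T%:R * K) ^+ 2 = T%:R * (T%:R * (4 * K ^+ 2)) by rewrite exprMn; ring.
rewrite ler_wpM2l //.
apply: (@le_trans _ _ (\sum_(y in buckets u) (4 * K ^+ 2))).
  apply: ler_sum => y _; apply: le_trans (entries_sqr hu).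
  by apply: placed_sum_le => e; apply: sqr_ge0.
by rewrite sumr_const hT -[_ *+ _]mulr_natl.
Qed.

(** This l1 bound enters only the second-order part of the privacy loss, so its extra factor d can
    be absorbed by a smaller deviation radius instead of more noise. *)
Lemma data_count_sum (u : user P) : valid_user u ->
  \sum_(c < D) (data_count pub u c)%:R <= T%:R * (2 * d%:R * K) :> R.
Proof.
move=> hu; have [hT _] := hu.
under eq_bigr do rewrite data_countE.
rewrite exchange_big /= -hT mulr_natl -sumr_const; apply: ler_sum => y _.
by apply: le_trans (entries_sum hu); apply: placed_sum_le.
Qed.

Section Neighbors.
Variables x x' : dataset P.
Hypotheses (vx : valid_dataset x) (vx' : valid_dataset x').
Variable i0 : 'I_n.
Hypothesis same : forall j, j != i0 -> x j = x' j.

Definition total_count (z : dataset P) (c : nat) : nat :=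
  (\sum_(i < n) data_count pub (z i) c)%N.

Lemma total_diff c : (total_count x c)%:R - (total_count x' c)%:R =
  (data_count pub (x i0) c)%:R - (data_count pub (x' i0) c)%:R :> R.
Proof.
rewrite /total_count (bigD1 i0) //= [X in _ - X%:R](bigD1 i0) //= !natrD.
rewrite (eq_bigr (fun i => data_count pub (x' i) c)); first by lra.
by move=> i ne; rewrite same.
Qed.

Lemma total_diff_sqr :
  \sum_(c < D) ((total_count x c)%:R - (total_count x' c)%:R) ^+ 2 <=
  (4 * (T%:R * K)) ^+ 2.
Proof.
apply: (@le_trans _ _ (\sum_(c < D) (2 * (data_count pub (x i0) c)%:R ^+ 2 +
    2 * (data_count pub (x' i0) c)%:R ^+ 2))).
  apply: ler_sum => c _; rewrite total_diff.
  set a := (_%:R : R); set b := (_%:R : R); have := sqr_ge0 (a + b).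
  by rewrite sqrrD sqrrB; lra.
rewrite big_split /= -!mulr_sumr exprMn.
have := data_count_sqr (vx i0); have := data_count_sqr (vx' i0); lra.
Qed.

Lemma total_diff_sum :
  \sum_(c < D) `|(total_count x c)%:R - (total_count x' c)%:R| <=
  4 * (T%:R * d%:R * K).
Proof.
apply: (@le_trans _ _ (\sum_(c < D) ((data_count pub (x i0) c)%:R +
    (data_count pub (x' i0) c)%:R))).
  apply: ler_sum => c _; rewrite total_diff; apply: le_trans (ler_normB _ _) _.
  by rewrite !normr_nat.
rewrite big_split /=.
have := data_count_sum (vx i0); have := data_count_sum (vx' i0); lra.
Qed.

End Neighbors.
End Sensitivity.

(** * The numerical conditions of the binomial mechanism at the chosen parameters *)

Section PrivacyArithmetic.
Variable R : realType.
Variables T d K e1 g m D dl : R.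
Hypotheses (T1 : 1 <= T) (d1 : 1 <= d) (e11 : 1 <= e1) (g1 : 1 <= g) (dK : d <= K).
Hypothesis m_ge : 32 * 64 * (T * K * e1) ^+ 2 * g <= m.
Hypothesis D0 : 0 <= D.
Hypothesis D_le : 2 * D * d <= K.
Hypothesis g_ge : expR (- g) <= dl / 2.

Ltac bounds := have ? := T1; have ? := d1; have ? := e11; have ? := g1;
  have ? := dK.

Let K0 : 0 < K. Proof. bounds; lra. Qed.
Let Y := 64 * (T * d * K * e1).

Let TdKe : 1 <= T * d * K * e1.
Proof.
bounds; have a : 1 <= T * d by rewrite mulr_ege1.
by rewrite !mulr_ege1 //; lra.
Qed.

Let Y0 : 0 < Y. Proof. by have := TdKe; rewrite /Y; lra. Qed.

Let TKe2 : 1 <= (T * K * e1) ^+ 2.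
Proof. by bounds; rewrite exprn_ege1 // !mulr_ege1 //; lra. Qed.

Let m0 : 0 < m.
Proof.
bounds; have ? := TKe2; apply: lt_le_trans m_ge; rewrite mulr_gt0 //; last by lra.
by rewrite mulr_gt0 //; lra.
Qed.

(** Solves 2 S1 X^2 = 1/(8 e1) for the l1-sensitivity S1 = 4TdK, so the second-order loss is an
    eighth of the privacy level 1/e1. *)
Definition radius : R := Num.sqrt (1 / (64 * (T * d * K * e1))).

Let radius_sqr : radius ^+ 2 = 1 / Y.
Proof. by rewrite sqr_sqrtr // divr_ge0 // ltW. Qed.

Let radius0 : 0 <= radius. Proof. exact: sqrtr_ge0. Qed.

Lemma radius_le : radius <= 1 / 2.
Proof.
rewrite -ler_sqr ?nnegrE //; last by lra.
rewrite radius_sqr ler_pdivrMr ?Y0 // /Y expr2.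
by have ? := TdKe; lra.
Qed.

(** Half of the admissible deviation is left to the walks; the other half absorbs the shift between
    neighbouring data. *)
Lemma window_ge : m * radius / 2 + 2 * (4 * (T * K)) <= radius * (m + 1).
Proof.
bounds; have ? := TKe2; have ? := K0; have ? := radius0; have ? := m0; have ? := TdKe.
have h : 16 * (T * K) <= m * radius.
  have TK0 : 0 <= 16 * (T * K) by rewrite !mulr_ge0 //; lra.
  rewrite -ler_sqr ?nnegrE //; last by rewrite mulr_ge0 // ltW.
  rewrite [leRHS]exprMn radius_sqr.
  rewrite div1r ler_pdivlMr ?Y0 //.
  have h1 : 32 * 64 * (T * K * e1) ^+ 2 <= m.
    apply: le_trans m_ge; rewrite ler_peMr // mulr_ge0 //; lra.
  have h2 : (32 * 64 * (T * K * e1) ^+ 2) ^+ 2 <= m ^+ 2.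
    by rewrite ler_sqr ?nnegrE //; lra.
  apply: le_trans h2.
  have -> : (32 * 64 * (T * K * e1) ^+ 2) ^+ 2 =
    (T * K) ^+ 2 * (32 * 64 * (32 * 64) * ((T * K * e1) ^+ 2 * e1 ^+ 2)) by ring.
  have -> : (16 * (T * K)) ^+ 2 * Y = (T * K) ^+ 2 * (128 * 128 * (T * d * K * e1)).
    by rewrite /Y; ring.
  rewrite ler_wpM2l ?sqr_ge0 //.
  have a1 : T * d * K * e1 <= (T * K * e1) ^+ 2 * e1 ^+ 2.
    have -> : (T * K * e1) ^+ 2 * e1 ^+ 2 = (T * K * K * e1) * (T * e1 ^+ 3) by ring.
    apply: (@le_trans _ _ (T * K * K * e1)).
      rewrite !ler_wpM2r //; [lra|lra|rewrite ler_wpM2l //; lra].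
    rewrite ler_peMr ?mulr_ege1 ?exprn_ege1 // !mulr_ge0 //; lra.
  by lra.
by rewrite mulrDr mulr1 [radius * m]mulrC; lra.
Qed.

Lemma loss_le : 2 * (4 * (T * K)) ^+ 2 / m + 2 * (4 * (T * d * K)) * radius ^+ 2 <=
  1 / e1 / 2.
Proof.
bounds; have ? := TKe2; have ? := K0; have ? := m0; have ? := TdKe.
have e0 : 0 < e1 by lra.
have a1 : 2 * (4 * (T * K)) ^+ 2 / m <= 1 / e1 / 4.
  rewrite ler_pdivrMr //.
  have h1 : 32 * 64 * (T * K * e1) ^+ 2 <= m.
    apply: le_trans m_ge; rewrite ler_peMr // mulr_ge0 //; lra.
  apply: (@le_trans _ _ (1 / e1 / 4 * (32 * 64 * (T * K * e1) ^+ 2))); last first.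
    by rewrite ler_wpM2l // !divr_ge0 //; lra.
  have -> : 1 / e1 / 4 * (32 * 64 * (T * K * e1) ^+ 2) = 512 * (T * K) ^+ 2 * e1.
    by field; rewrite gt_eqF.
  have : 512 * (T * K) ^+ 2 * 1 <= 512 * (T * K) ^+ 2 * e1.
    by rewrite ler_wpM2l // mulr_ge0 // sqr_ge0.
  have := sqr_ge0 (T * K); rewrite [(4 * _) ^+ 2]exprMn; lra.
have a2 : 2 * (4 * (T * d * K)) * radius ^+ 2 = 1 / e1 / 8.
  rewrite radius_sqr /Y; field; rewrite !gt_eqF //; lra.
have h : 0 < 1 / e1 by rewrite divr_gt0.
by rewrite a2; lra.
Qed.

(** The exponent equals m/(32 * 64 (TKe1)^2), which the choice of [m] makes at least [g]. *)
Lemma tail1_le : expR (- ((1 / e1 * m / 4) ^+ 2 / (8 * (m * (4 * (T * K)) ^+ 2)))) <=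
  dl / 2.
Proof.
bounds; have ? := TKe2; have ? := m0; have ? := m_ge; have ? := K0.
apply: le_trans g_ge; rewrite ler_expR lerN2.
have TKe0 : 0 < (T * K * e1) ^+ 2 by lra.
have -> : (1 / e1 * m / 4) ^+ 2 / (8 * (m * (4 * (T * K)) ^+ 2)) =
   m / (32 * 64 * (T * K * e1) ^+ 2).
  by field; rewrite !gt_eqF //; lra.
by rewrite ler_pdivlMr ?mulr_gt0 //; lra.
Qed.

(** The exponent is at least gK/d, hence at least g + (K/d - 1) since both g and K/d are at least 1.
    The part exp(-g) gives dl/2, and exp(1 - K/d) <= d/K pays for the union over 2D events. *)
Lemma tail2_le : 2 * D * expR (- ((m * radius / 2) ^+ 2 / (8 * m))) <= dl / 2.
Proof.
bounds; have ? := TKe2; have ? := m0; have ? := TdKe; have ? := K0; have ? := D_le; have ? := D0.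
have d0 : 0 < d by lra.
have e0 : 0 < e1 by lra.
have -> : (m * radius / 2) ^+ 2 / (8 * m) = m / (32 * 64 * (T * d * K * e1)).
  have -> : (m * radius / 2) ^+ 2 = m ^+ 2 / 4 * radius ^+ 2 by field.
  rewrite radius_sqr /Y; field; rewrite !gt_eqF //; lra.
have h : g + (K / d - 1) <= m / (32 * 64 * (T * d * K * e1)).
  rewrite ler_pdivlMr; last by lra.
  apply: le_trans m_ge.
  have kd1 : 1 <= K / d by rewrite ler_pdivlMr // mul1r.
  have s1 : g + (K / d - 1) <= g * (K / d) by nra.
  apply: (@le_trans _ _ (g * (K / d) * (32 * 64 * (T * d * K * e1)))).
    by rewrite ler_wpM2r //; lra.
  have -> : g * (K / d) * (32 * 64 * (T * d * K * e1)) = 32 * 64 * (T * K ^+ 2 * e1) * g.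
    by field; rewrite gt_eqF.
  have -> : 32 * 64 * (T * K * e1) ^+ 2 * g = 32 * 64 * (T * K ^+ 2 * e1) * g * (T * e1).
    by ring.
  rewrite ler_peMr ?mulr_ege1 // !mulr_ge0 ?sqr_ge0 //; lra.
apply: (@le_trans _ _ (2 * D * expR (- (g + (K / d - 1))))).
  by rewrite ler_wpM2l ?mulr_ge0 // ler_expR lerN2.
rewrite opprD expRD mulrCA; apply: (@le_trans _ _ (dl / 2 * 1)); last first.
  by rewrite mulr1.
apply: ler_pM => //; first exact: expR_ge0.
  by rewrite !mulr_ge0 ?expR_ge0.
rewrite expRN ler_pdivrMr ?expR_gt0 // mul1r.
apply: le_trans (expR_ge1Dx _); have -> : 1 + (K / d - 1) = K / d by ring.
by rewrite ler_pdivlMr.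
Qed.

End PrivacyArithmetic.

(** * Privacy of the protocol *)

Section ParameterBounds.
Variable R : realType.

Lemma log2up_le (x : R) : 1 <= x -> (2 ^ log2up x)%N%:R <= 2 * x.
Proof.
move=> x1; case E: (log2up x) => [|e]; first by rewrite expn0; lra.
have : (e < log2up x)%N by rewrite E.
by rewrite ltn_log2up expnS natrM; lra.
Qed.

Lemma expR_ge_pow2 k : (2 ^ k)%N%:R <= expR (k%:R : R).
Proof.
rewrite -[k%:R]mulr1 expRM_natl natrX lerXn2r ?nnegrE ?expR_ge0 //.
by have := expR_ge1Dx (1 : R); lra.
Qed.

Variables (eps0 : R) (P : params R).
Hypothesis adm : admissible eps0 P.
Local Notation n := (nusers P).
Local Notation d := (dim P).
Local Notation T := (nbuckets P).
Local Notation K := (scale P).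
Local Notation D := (ncodes P).
Local Notation g := (delta_bits P).

Lemma n_ge1 : 1 <= n%:R :> R.
Proof. by case: adm => -[h *]; rewrite ler1n. Qed.

Lemma d_ge1 : 1 <= d%:R :> R.
Proof. by case: adm => -[_ h *]; rewrite ler1n. Qed.

Lemma T_ge1 : 1 <= T%:R :> R.
Proof. by case: adm => -[_ _ h *]; rewrite ler1n. Qed.

Lemma eps_gt0 : 0 < eps P. Proof. by case: adm => _ /andP[]. Qed.
Lemma beta_gt0 : 0 < beta P. Proof. by case: adm => _ _ _ /andP[]. Qed.
Lemma beta_lt1 : beta P < 1. Proof. by case: adm => _ _ _ /andP[]. Qed.
Lemma delta_gt0 : 0 < delta P. Proof. by case: adm => _ _ /andP[]. Qed.
Lemma delta_lt1 : delta P < 1. Proof. by case: adm => _ _ /andP[]. Qed.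

Lemma nT_le : n%:R * T%:R <= n%:R * T%:R / beta P.
Proof.
have b0 := beta_gt0; have b1 := beta_lt1.
by rewrite ler_peMr ?mulr_ge0 // invf_ge1 // ltW.
Qed.

Lemma nT_ge1 : 1 <= n%:R * T%:R :> R.
Proof. by rewrite mulr_ege1 // ?n_ge1 ?T_ge1. Qed.

Lemma cellsE : cells P = 2 * (n%:R * T%:R / beta P).
Proof. by rewrite /cells -mulrA. Qed.

Lemma scaleE : K = 32 * d%:R ^+ 2 * (n%:R * T%:R / beta P).
Proof. by rewrite /scale expr2 -mulrA. Qed.

Lemma scale_ge_d : d%:R <= K.
Proof.
rewrite scaleE; have h1 := nT_le; have h2 := nT_ge1; have h3 := d_ge1.
set q := n%:R * T%:R / beta P in h1 *.
have q1 : 1 <= q by lra.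
have h4 : d%:R * 1 <= d%:R * d%:R :> R by rewrite ler_wpM2l.
have : 32 * d%:R ^+ 2 * 1 <= 32 * d%:R ^+ 2 * q by rewrite ler_wpM2l ?mulr_ge0 ?sqr_ge0.
by rewrite expr2; lra.
Qed.

Lemma scale_ge_n : n%:R <= K.
Proof.
rewrite scaleE; have h1 := nT_le; have h3 := d_ge1; have h4 := n_ge1; have h5 := T_ge1.
have h6 : n%:R * 1 <= n%:R * T%:R :> R by rewrite ler_wpM2l.
have h7 : 1 <= d%:R ^+ 2 :> R by rewrite exprn_ege1.
have q0 : 0 <= n%:R * T%:R / beta P by lra.
have : 1 * (n%:R * T%:R / beta P) <= d%:R ^+ 2 * (n%:R * T%:R / beta P).
  by rewrite ler_wpM2r.
by rewrite -mulrA; lra.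
Qed.

Lemma scale_gt0 : 0 < K.
Proof. by have := scale_ge_n; have := n_ge1; lra. Qed.

Lemma ncodes_le : D%:R <= 8 * d%:R * (n%:R * T%:R / beta P).
Proof.
have h1 := nT_le; have h2 := nT_ge1; have h3 := d_ge1.
have c1 : 1 <= cells P by rewrite cellsE; lra.
have h4 := log2up_le c1; rewrite [X in _ <= 2 * X]cellsE in h4.
have d0 : 0 <= 2 * d%:R :> R by rewrite mulr_ge0.
have := ler_wpM2r d0 h4; rewrite /ncodes -mul2n !natrM; lra.
Qed.

Lemma ncodes_scale : 2 * D%:R * d%:R <= K.
Proof.
have h := ncodes_le; have h3 := d_ge1; have h1 := nT_le; have h2 := nT_ge1.
have d0 : 0 <= 2 * d%:R :> R by rewrite mulr_ge0.
have := ler_wpM2l d0 h; rewrite scaleE expr2.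
set q := n%:R * T%:R / beta P in h1 *.
have q0 : 0 <= q by lra.
have : 0 <= d%:R * d%:R * q by rewrite mulr_ge0 // mulr_ge0.
by lra.
Qed.

Lemma delta_bits_ge1 : 1 <= g%:R :> R.
Proof.
rewrite ler1n ltn_log2up expn0 ltr_pdivlMr ?delta_gt0 // mul1r.
by have := delta_lt1; lra.
Qed.

(** Doubling only yields logarithms to base 2; that suffices because e is at least 2. *)
Lemma expR_delta_bits : expR (- g%:R) <= delta P / 2.
Proof.
have h := log2up_ge (2%:R / delta P); have h2 := expR_ge_pow2 g.
have d0 := delta_gt0.
rewrite expRN -[leRHS]invrK lef_pV2 ?posrE ?expR_gt0 ?invr_gt0 ?divr_gt0 //.
by rewrite invf_div; apply: le_trans h2.
Qed.

(** Its inverse eps/(1+eps) is the privacy level at which the mechanism is analysed. *)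
Definition inflation : R := 1 + 1 / eps P.

Lemma inflation_ge1 : 1 <= inflation.
Proof. by rewrite /inflation lerDl divr_ge0 // ltW // eps_gt0. Qed.

Lemma sensE : sens P = T%:R * K * inflation.
Proof. by []. Qed.

Definition flips : R := 32 * 64 * (T%:R * K * inflation) ^+ 2 * g%:R.

Lemma coinsE : coins P = natceil (flips / n%:R).
Proof. by rewrite /coins /flips sensE expr2 mulrA. Qed.

Lemma flips_ge1 : 1 <= flips.
Proof.
have h1 := T_ge1; have h2 := inflation_ge1; have h3 := delta_bits_ge1.
have h4 : 1 <= K by have := scale_ge_n; have := n_ge1; lra.
rewrite /flips mulr_ege1 // mulr_ege1 //; first by lra.
by rewrite exprn_ege1 // mulr_ege1 // mulr_ege1.
Qed.

Lemma coins_gt0 : (0 < coins P)%N.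
Proof.
rewrite coinsE ltn_natceil divr_gt0 //.
  by have := flips_ge1; lra.
by have := n_ge1; lra.
Qed.

Lemma flips_le : flips <= (n * coins P)%N%:R.
Proof.
have n0 : 0 < n%:R :> R by have := n_ge1; lra.
rewrite natrM mulrC -ler_pdivrMr // coinsE; exact: natceil_ge.
Qed.

(** Rounding up each user's share adds at most one flip per user and code. *)
Lemma flips_ge : (n * coins P)%N%:R <= flips + n%:R.
Proof.
have n0 : 0 < n%:R :> R by have := n_ge1; lra.
have h : 0 <= flips / n%:R by rewrite divr_ge0 //; have := flips_ge1; lra.
have := natceil_lt h; rewrite -coinsE => /ltW /(ler_wpM2l (ltW n0)).
by rewrite -natrM mulrDr mulr1 mulrC mulfVK // gt_eqF.
Qed.

End ParameterBounds.

(** * From machine runs to counts of messages *)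

Section Messages.
Variables (R : realType) (eps0 : R) (P : params R) (L : nat).
Hypothesis adm : admissible eps0 P.
Hypothesis large : 1 <= (nusers P)%:R * eps P.
Hypothesis L_ge : (enc_time P <= L)%N.
Local Notation n := (nusers P).
Local Notation D := (ncodes P).
Local Notation N := (coins P).

Lemma messages_spec (pub priv : L.-tuple bool) (u : user P) : valid_user u ->
  [/\ halts_within L encoder (enc_init pub priv u),
      forall x, count_mem x (messages encoder pub priv u) =
        (data_count (tape pub) u x + noise_count P (tape priv) x)%N
    & (size (messages encoder pub priv u) <= enc_time P)%N].
Proof.
move=> hu; have [t [s' [h1 h2 h3]]] := encoder_spec (beta_gt0 adm)
  (ltac:(case: adm => -[_ _ h *]; exact h)) pub priv hu large.
rewrite /halts_within /messages (big_run h1 (leq_trans h2 L_ge)); split=> //.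
by have := big_size_sent h1; rewrite /= add0n => h; apply: leq_trans h2.
Qed.

(** [L] is also the tape length; since every flip takes time, the time bound ensures that each flip
    reads a genuine random bit. *)
Lemma noise_fits : (D * N <= L)%N.
Proof. by apply: leq_trans L_ge; rewrite /enc_time; clear; nia. Qed.

Lemma key_fits : (cell_bits P * key_bits P <= L)%N.
Proof.
apply: leq_trans L_ge; rewrite /enc_time /hash_time.
have T0 : (0 < nbuckets P)%N by case: adm => -[_ _ h *].
by move: T0; clear; nia.
Qed.

Variables (x : dataset P).
Hypothesis vx : valid_dataset x.

Lemma count_all_messages (pub : L.-tuple bool) A c :
  count_mem c (all_messages encoder x pub (tapes_of A)) =
  if (c < D)%N then (total_count (tape pub) x c + ones (coin_class N) A c)%N else 0%N.
Proof.
rewrite /all_messages count_flatten -map_comp sumnE big_map big_enum /=.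
rewrite (eq_bigr (fun i => data_count (tape pub) (x i) c +
  noise_count P (tape (tapes_of A i)) c)%N); last first.
  by move=> i _; have [_ -> _] := messages_spec pub (tapes_of A i) (vx i).
rewrite big_split /=; case: ltnP => h.
  by rewrite (sum_tapes_ones (coins_gt0 adm) noise_fits A h).
rewrite (sum_tapes_out (coins_gt0 adm) noise_fits (tapes_of A) h) addn0.
by apply: big1 => i _; apply: data_count_out.
Qed.

Lemma size_all_messages (pub : L.-tuple bool) priv :
  (size (all_messages encoder x pub priv) <= n * enc_time P)%N.
Proof.
rewrite /all_messages size_flatten /shape -map_comp sumnE big_map big_enum /=.
rewrite -[X in (_ <= X * _)%N]card_ord -sum_nat_const; apply: leq_sum => i _.
by have [_ _] := messages_spec pub (priv i) (vx i).
Qed.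

Lemma view_expectationE (F : L.-tuple bool -> seq nat -> R) :
  view_expectation encoder x F = unif (fun pub => (\sum_(A : {set 'I_n * 'I_L})
    shuffle_mean (F pub) (all_messages encoder x pub (tapes_of A))) /
    2 ^+ #|{: 'I_n * 'I_L}|).
Proof.
rewrite /view_expectation /unif; congr (_ / _); apply: eq_bigr => pub _.
exact: (unif_tapes (fun priv => shuffle_mean (F pub) (all_messages encoder x pub priv))).
Qed.

End Messages.

Section Privacy.
Variables (R : realType) (eps0 : R) (P : params R) (L : nat).
Hypothesis adm : admissible eps0 P.
Hypothesis large : 1 <= (nusers P)%:R * eps P.
Hypothesis L_ge : (enc_time P <= L)%N.
Local Notation n := (nusers P).
Local Notation D := (ncodes P).
Local Notation N := (coins P).

Lemma encoder_dp : shuffle_dp P L encoder.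
Proof.
move=> x x' vx vx' [i0 same] E.
rewrite !(view_expectationE) //.
apply: (@le_trans _ _ (unif (fun pub : L.-tuple bool => expR (eps P) *
  ((\sum_(A : {set 'I_n * 'I_L}) shuffle_mean (fun m => (E pub m)%:R)
      (all_messages encoder x' pub (tapes_of A))) / 2 ^+ #|{: 'I_n * 'I_L}|)
    + delta P))); last first.
  by rewrite (unif_affine [tuple of nseq L false]).
apply: unif_le => pub; set C := 2 ^+ _.
have C0 : 0 < C by rewrite exprn_gt0.
pose gm f : R := shuffle_mean (fun m => (E pub m)%:R) (canonical_seq D f).
have g01 f : 0 <= gm f <= 1.
  by apply: shuffle_mean01 => m; case: (E pub m); rewrite ?ler01 ?lexx.
have gE (z : dataset P) A : valid_dataset z -> shuffle_mean (fun m => (E pub m)%:R : R)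
    (all_messages encoder z pub (tapes_of A)) =
    gm (fun c => total_count (tape pub) z c + ones (coin_class N) A c)%N.
  move=> vz; apply: (@shuffle_mean_counts R _ D) => c.
  by rewrite (count_all_messages adm large L_ge vz).
under eq_bigr do rewrite gE //.
under [X in _ <= _ * (X / _) + _]eq_bigr do rewrite gE //.
rewrite ler_pdivrMr // mulrDl mulrA mulfVK ?gt_eqF // [delta P * _]mulrC.
have d0 : (0 < dim P)%N by case: adm => -[_ h *].
have Kd := scale_ge_d adm.
have T1 := T_ge1 adm; have d1 := d_ge1 adm; have e1 := inflation_ge1 adm.
have g1 := delta_bits_ge1 adm; have fl := flips_le adm.
have m0 : (0 < n * N)%N.
  by rewrite muln_gt0 (coins_gt0 adm) andbT; case: adm => -[].
have K0 := scale_gt0 adm.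
have TK0 : 0 < 4 * ((nbuckets P)%:R * scale P).
  have T0 : 0 < (nbuckets P)%:R :> R by lra.
  by rewrite mulr_gt0 // mulr_gt0.
set T := (nbuckets P)%:R : R in T1 fl TK0 *.
pose X := radius T (dim P)%:R (scale P) (inflation P).
pose W := (n * N)%:R * X / 2.
(* Privacy is shown at the stricter level eps/(1+eps) and relaxed to eps at the end. *)
apply: (@le_trans _ _ (expR (1 / inflation P) * \sum_(A : {set 'I_n * 'I_L})
   gm (fun c => total_count (tape pub) x' c + ones (coin_class N) A c)%N + C * delta P)).
  have := (@binomial_dp R _ (coin_class N) D (n * N)
    (fun c => @coin_class_card n L N D (coins_gt0 adm) (noise_fits L_ge) c)
    m0 (total_count (tape pub) x) (total_count (tape pub) x') gm (1 / inflation P) (delta P) X W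
    (4 * (T * scale P)) (4 * (T * (dim P)%:R * scale P))).
  cbv zeta; apply.
  - by move=> f f' h; rewrite /gm (eq_canonical_seq h).
  - exact: g01.
  - by rewrite divr_gt0 //; lra.
  - by rewrite /W divr_ge0 // mulr_ge0 // sqrtr_ge0.
  - exact: TK0.
  - exact: (radius_le T1 d1 e1 g1 Kd).
  - exact: (total_diff_sqr (tape pub) Kd d0 vx vx' same).
  - exact: (total_diff_sum (tape pub) Kd d0 vx vx' same).
  - exact: (window_ge T1 d1 e1 g1 Kd fl).
  - exact: (loss_le T1 d1 e1 g1 Kd fl).
  - exact: (tail1_le T1 d1 e1 g1 Kd fl (expR_delta_bits adm)).
  - exact: (tail2_le T1 d1 e1 g1 Kd fl (ler0n R D) (ncodes_scale adm)
       (expR_delta_bits adm)).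
rewrite lerD2r ler_wpM2r //.
  by apply: sumr_ge0 => A _; case/andP: (g01 (fun c =>
    total_count (tape pub) x' c + ones (coin_class N) A c)%N).
have eps0' := eps_gt0 adm.
rewrite ler_expR /inflation ler_pdivrMr; last by have := divr_gt0 ltr01 eps0'; lra.
by rewrite mulrDr mulr1 mulrCA mulfV ?gt_eqF //; lra.
Qed.

End Privacy.

(** * Accuracy of the protocol *)

Section Logarithms.
Variable R : realType.

Lemma ln2_le1 : ln 2 <= 1 :> R.
Proof. by have := @le_ln1Dx R 1; rewrite -[1 + 1]/(2 : R); apply; lra. Qed.

Lemma ln2_ge : 1 / 2 <= ln 2 :> R.
Proof.
rewrite -ler_expR lnK ?posrE //.
by apply: le_trans (expR_le_quadratic (lexx _)) _; rewrite expr2; lra.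
Qed.

Lemma log2up_le_ln (x : R) : 1 <= x -> (log2up x)%:R <= 2 + 2 * ln x.
Proof.
move=> x1; have x0 : 0 < x by lra.
have := log2up_le x1.
have p0 : 0 < (2 ^ log2up x)%N%:R :> R by rewrite ltr0n expn_gt0.
have q0 : 0 < 2 * x by lra.
rewrite -ler_ln ?posrE // lnM ?posrE // natrX lnXn // -[_ *+ _]mulr_natl => h.
have h1 := ln2_le1; have h2 := ln2_ge.
by have := ler_wpM2l (ler0n R (log2up x)) h2; lra.
Qed.

End Logarithms.

Section Accuracy.
Variables (R : realType) (eps0 : R) (P : params R) (L : nat).
Hypothesis adm : admissible eps0 P.
Hypothesis large : 1 <= (nusers P)%:R * eps P.
Hypothesis L_ge : (enc_time P <= L)%N.
Hypothesis L_ge_dec : (dec_time P (nusers P * enc_time P) <= L)%N.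
Local Notation n := (nusers P).
Local Notation d := (dim P).
Local Notation T := (nbuckets P).
Local Notation K := (scale P).
Local Notation D := (ncodes P).
Local Notation N := (coins P).
Local Notation ell := (key_bits P).
Local Notation kh := (cell_bits P).

Let T_gt0 : (0 < T)%N. Proof. by case: adm => -[]. Qed.

Lemma decoder_run (pub dpriv : L.-tuple bool) msgs (y : 'I_(universe P)) :
  (size msgs <= n * enc_time P)%N ->
  halts_within L decoder (dec_init pub dpriv msgs y) /\
  forall j : 'I_d, estimate decoder pub dpriv msgs y 0 j =
    ((count_mem (base P (tape pub) y + j.*2)%N msgs)%:R
      - (count_mem (base P (tape pub) y + j.*2).+1 msgs)%:R) / K.
Proof.
move=> hs.
have [t [s' [h1 h2 h3]]] := decoder_spec (beta_gt0 adm) T_gt0 pub dpriv msgs y large.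
have tL : (t <= L)%N.
  apply: leq_trans h2 (leq_trans _ L_ge_dec); rewrite /dec_time.
  by rewrite !(leq_add2r, leq_add2l) leq_mul2l leq_add2r leq_mul2r hs !orbT.
rewrite /halts_within /estimate (big_run h1 tL); split=> // j.
by rewrite mxE h3.
Qed.

(** Different cells own disjoint blocks of 2d codes, so without a collision only the queried bucket
    contributes to its block. *)
Lemma data_count_hit (pub : nat -> bool) (u : user P) (y : 'I_(universe P)) e :
  (forall y', y' \in buckets u -> y' != y ->
     hcell pub ell kh y != hcell pub ell kh y') -> (e < d.*2)%N ->
  data_count pub u (base P pub y + e) =
  ((y \in buckets u) * entry (coord u) K e)%N.
Proof.
move=> nocoll he; rewrite /data_count.
have hit : (\sum_(e' < d.*2) (base P pub y + e == base P pub y + e') *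
    entry (coord u) K e' = entry (coord u) K e)%N.
  rewrite (bigD1 (Ordinal he)) //= eqxx mul1n big1 ?addn0 // => e'.
  by rewrite eqn_add2l eq_sym -val_eqE /= => /negbTE->.
have miss y' : y' \in buckets u -> y' != y ->
    (\sum_(e' < d.*2) (base P pub y + e == base P pub y' + e') *
    entry (coord u) K e' = 0)%N.
  move=> yu ne; rewrite big1 // => e' _; case: eqP => // h.
  case/eqP: (nocoll _ yu ne).
  have d0 : (0 < d.*2)%N by apply: leq_ltn_trans he.
  have := congr1 (fun a => a %/ d.*2)%N h.
  by rewrite /base !divnMDl // !divn_small ?ltn_ord // !addn0.
case: (boolP (y \in buckets u)) => yu /=.
  rewrite (bigD1 y) //= hit mul1n big1 ?addn0 // => y' /andP[h1 h2].
  exact: miss.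
rewrite big1 // => y' hy'; apply: miss => //.
by apply: contraNneq yu => <-.
Qed.

(** At threshold [2 * tau] and squared weight 2, the Chernoff exponent is exactly ln(4d/beta). Two
    signs and d coordinates then total beta/2. *)
Definition tau : R :=
  2 * Num.sqrt ((n * N)%N%:R * ln (4 * d%:R / beta P)).

Lemma ln4d_ge0 : 0 <= ln (4 * d%:R / beta P).
Proof.
apply: ln_ge0; rewrite ler_pdivlMr ?(beta_gt0 adm) // mul1r.
by have := d_ge1 adm; have := beta_lt1 adm; lra.
Qed.

(** A difference of walks is twice the difference of head counts, hence the threshold [2 * tau] for
    a noise of [tau]. *)
Definition noisy (A : {set 'I_n * 'I_L}) (c : nat) : bool :=
  (2 * tau <= `|walk R (coin_class N) (n * N) A c
                - walk R (coin_class N) (n * N) A c.+1|)%R.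

Lemma noisy_sum (c : nat) : (c.+1 < D)%N ->
  \sum_(A : {set 'I_n * 'I_L}) (noisy A c)%:R <=
  2 ^+ #|{: 'I_n * 'I_L}| * (beta P / (2 * d%:R)).
Proof.
move=> cD; have cD' : (c < D)%N by apply: ltnW.
have m0 : (0 < n * N)%N.
  by rewrite muln_gt0 (coins_gt0 adm) andbT; case: adm => -[].
have cards c' := @coin_class_card n L N D (coins_gt0 adm) (noise_fits L_ge) c'.
(* The difference of two unit vectors, of squared norm 2; the signs 1 and -1 give the two tails. *)
pose eta (sg : R) (c' : nat) : R := sg * ((c' == c)%:R - (c' == c.+1)%:R).
have etaS (h : nat -> R) sg : \sum_(c' < D) eta sg c' * h c' = sg * (h c - h c.+1).
  rewrite (bigD1 (Ordinal cD')) //= (bigD1 (Ordinal cD)) //=; last first.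
    by rewrite -val_eqE /= gtn_eqF.
  have n1 : (c == c.+1) = false by rewrite ltn_eqF.
  have n2 : (c.+1 == c) = false by rewrite gtn_eqF.
  rewrite /eta !eqxx n1 n2 big1 ?addr0; first by rewrite /= mulr1n mulr0n; ring.
  move=> c' /andP[]; rewrite -!val_eqE /= => /negbTE-> /negbTE->.
  by rewrite subrr mulr0 mul0r.
have V2 sg : sg ^+ 2 = 1 -> \sum_(c' < D) eta sg c' ^+ 2 <= 2.
  move=> sg1; under eq_bigr do rewrite expr2.
  have n1 : (c == c.+1) = false by rewrite ltn_eqF.
  have n2 : (c.+1 == c) = false by rewrite gtn_eqF.
  rewrite etaS /eta !eqxx n1 n2 /= mulr1n mulr0n.
  have -> : sg * (sg * (1 - 0) - sg * (0 - 1)) = 2 * sg ^+ 2 by ring.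
  by rewrite sg1; lra.
have t0 : 0 <= 2 * tau by rewrite !mulr_ge0 // sqrtr_ge0.
have V0 : 0 < 2 :> R by lra.
have m11 : (-1) ^+ 2 = 1 :> R by rewrite sqrrN expr1n.
have h1 := @chernoff_walk R _ _ D (n * N) cards m0 (eta 1) (2 * tau) 2 t0 V0
  (V2 1 (expr1n _ _)).
have h2 := @chernoff_walk R _ _ D (n * N) cards m0 (eta (-1)) (2 * tau) 2 t0 V0
  (V2 (-1) m11).
apply: (@le_trans _ _ (2 ^+ #|{: 'I_n * 'I_L}| *
   expR (- ((2 * tau) ^+ 2 / (8 * ((n * N)%N%:R * 2)))) +
   2 ^+ #|{: 'I_n * 'I_L}| *
   expR (- ((2 * tau) ^+ 2 / (8 * ((n * N)%N%:R * 2)))))).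
  apply: le_trans (lerD h1 h2); rewrite -big_split /=; apply: ler_sum => A _.
  rewrite !etaS mul1r mulN1r; apply: bool_natr_le; first by rewrite addr_ge0.
  rewrite /noisy; set z := (_ - _)%R; case: (leP 0 z) => hz.
    by rewrite ger0_norm // => h; rewrite h lerDl.
  by rewrite ltr0_norm // => h; rewrite h lerDr.
have mr : 0 < (n * N)%N%:R :> R by rewrite ltr0n.
have -> : (2 * tau) ^+ 2 / (8 * ((n * N)%N%:R * 2)) = ln (4 * d%:R / beta P).
  rewrite /tau !exprMn sqr_sqrtr ?mulr_ge0 ?ln4d_ge0 //.
  move: ((n * N)%N%:R) mr => M mr; move: (ln _) => l.
  by field; rewrite gt_eqF.
have d1 := d_ge1 adm; have b0 := beta_gt0 adm.
have q0 : 0 < 4 * d%:R / beta P by rewrite divr_gt0 // mulr_gt0 //; lra.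
rewrite expRN lnK ?posrE // -mulrDr ler_wpM2l ?exprn_ge0 //.
rewrite invf_div le_eqVlt; apply/orP; left; apply/eqP.
by field; rewrite gt_eqF //; lra.
Qed.

Variables (x : dataset P) (y : 'I_(universe P)).
Hypothesis vx : valid_dataset x.

Definition collides (pub : L.-tuple bool) : bool :=
  [exists i : 'I_n, exists y' : 'I_(universe P),
    [&& y' \in buckets (x i), y' != y &
     hcell (tape pub) ell kh y == hcell (tape pub) ell kh y']].

Lemma collides_prob : unif (fun pub => (collides pub)%:R) <= beta P / 2.
Proof.
apply: (@le_trans _ _ (unif (fun pub : L.-tuple bool => \sum_(i < n)
  \sum_(y' in buckets (x i)) ((y' != y) &&
     (hcell (tape pub) ell kh y == hcell (tape pub) ell kh y'))%:R))).
  apply: unif_le => pub; apply: bool_natr_le.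
    by apply: sumr_ge0 => i _; apply: sumr_ge0.
  case/existsP => i /existsP[y' /and3P[h1 h2 h3]].
  rewrite (bigD1 i) //= (bigD1 y') //= h2 h3 /= -!addrA lerDl addr_ge0 //.
    by apply: sumr_ge0.
  by apply: sumr_ge0 => i' _; apply: sumr_ge0.
have -> : unif (fun pub : L.-tuple bool => \sum_(i < n)
  \sum_(y' in buckets (x i)) ((y' != y) &&
     (hcell (tape pub) ell kh y == hcell (tape pub) ell kh y'))%:R) =
  \sum_(i < n) \sum_(y' in buckets (x i)) unif (fun pub : L.-tuple bool =>
     ((y' != y) && (hcell (tape pub) ell kh y == hcell (tape pub) ell kh y'))%:R) :> R.
  rewrite /unif exchange_big /= mulr_suml; apply: eq_bigr => i _.
  by rewrite exchange_big /= mulr_suml.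
have q0 : 0 < (2 ^ kh)%N%:R :> R by rewrite ltr0n expn_gt0.
apply: (@le_trans _ _ (\sum_(i < n) \sum_(y' in buckets (x i)) ((2 ^ kh)%N%:R)^-1)).
  apply: ler_sum => i _; apply: ler_sum => y' _.
  have [->|ne] := eqVneq y' y.
    rewrite (_ : unif _ = 0) ?invr_ge0 //.
    by rewrite /unif big1 ?mul0r.
  apply: hash_collision_prob; [exact: (key_fits adm L_ge)|exact: bucket_lt
    |exact: bucket_lt|by rewrite eq_sym].
rewrite (eq_bigr (fun=> T%:R / (2 ^ kh)%N%:R)); last first.
  by move=> i _; rewrite sumr_const; have [-> _] := vx i; rewrite -[_ *+ _]mulr_natl.
rewrite sumr_const card_ord -[_ *+ _]mulr_natl mulrA ler_pdivrMr //.
have := log2up_ge (cells P); rewrite -/kh [X in X <= _]cellsE => h.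
have b0 := beta_gt0 adm.
have := ler_wpM2l (ltW b0) h.
have -> : beta P * (2 * (n%:R * T%:R / beta P)) = 2 * (n%:R * T%:R).
  by field; rewrite gt_eqF.
by lra.
Qed.

Lemma l2norm_le_sup k (v : 'rV[R]_k) M : 0 <= M -> (forall j, `|v 0 j| <= M) ->
  l2norm v <= Num.sqrt k%:R * M.
Proof.
move=> M0 h; rewrite /l2norm -[M in X in _ <= X]ger0_norm // -sqrtr_sqr -sqrtrM //.
rewrite ler_sqrt ?mulr_ge0 ?sqr_ge0 //.
rewrite mulr_natl -[k in X in _ <= X]card_ord -sumr_const; apply: ler_sum => j _.
by rewrite -[leLHS]real_normK ?num_real // ler_sqr ?nnegrE.
Qed.

(** In units of 1/K, each contributing user adds at most 1 of rounding error per coordinate and the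
    noise at most [tau]. *)
Lemma estimate_error (pub dpriv : L.-tuple bool) A
    (s : 'S_(size (all_messages encoder x pub (tapes_of A)))) :
  ~~ collides pub ->
  (forall j : 'I_d, ~~ noisy A (base P (tape pub) y + j.*2)) ->
  l2norm (bucket_sum x y - estimate decoder pub dpriv (shuffle s) y) <=
  Num.sqrt d%:R * ((n%:R + tau) / K).
Proof.
move=> nc quiet; have K0 := scale_gt0 adm.
have tau0 : 0 <= tau by rewrite mulr_ge0 // sqrtr_ge0.
apply: l2norm_le_sup; first by rewrite divr_ge0 ?addr_ge0 // ltW.
move=> j; have pe := perm_shuffle s.
have hsz : (size (shuffle s) <= n * enc_time P)%N.
  by rewrite (perm_size pe) (size_all_messages adm large L_ge vx).
have [_ est] := decoder_run pub dpriv y hsz.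
set c := (base P (tape pub) y + j.*2)%N in est *.
have l1 : (j.*2 < d.*2)%N by rewrite ltn_double.
have l2 : (j.*2.+1 < d.*2)%N.
  by have := ltn_ord j; rewrite -doubleS -leq_double => h; apply: leq_trans h.
have cD : (c < D)%N by apply: base_lt.
have cD' : (c.+1 < D)%N by rewrite /c -addnS; apply: base_lt.
have cntE c0 : (c0 < D)%N -> (count_mem c0 (shuffle s) =
    total_count (tape pub) x c0 + ones (coin_class N) A c0)%N.
  move=> h; rewrite (seq.permP pe) (count_all_messages adm large L_ge vx).
  by rewrite h.
have ncE i y' : y' \in buckets (x i) -> y' != y ->
    hcell (tape pub) ell kh y != hcell (tape pub) ell kh y'.
  move=> h1 h2; apply: contra nc => h3; apply/existsP; exists i.
  by apply/existsP; exists y'; rewrite h1 h2 h3.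
have totE e : (e < d.*2)%N -> (total_count (tape pub) x
    (base P (tape pub) y + e))%:R =
    \sum_(i | y \in buckets (x i)) (entry (coord (x i)) K e)%:R :> R.
  move=> he; rewrite /total_count natr_sum [RHS]big_mkcond /=; apply: eq_bigr => i _.
  by rewrite data_count_hit //; [case: (y \in _); rewrite ?mul1n ?mul0n|exact: ncE].
have -> : (bucket_sum x y - estimate decoder pub dpriv (shuffle s) y) 0 j =
    bucket_sum x y 0 j - estimate decoder pub dpriv (shuffle s) y 0 j by rewrite !mxE.
rewrite /bucket_sum summxE est -/c !cntE // !natrD totE // /c -addnS totE //.
rewrite addnS -/c.
set S := \sum_(i | _) vec _ _ _; set S1 := \sum_(i | _) _; set S2 := \sum_(i | _) _.
have e1 : `|S1 - S2 - S * K| <= n%:R.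
  rewrite -sumrB mulr_suml -sumrB; apply: le_trans (ler_norm_sum _ _ _) _.
  apply: (@le_trans _ _ (\sum_(i < n) 1)); last by rewrite sumr_const card_ord.
  rewrite big_mkcond /=; apply: ler_sum => i _; case: ifP => // _.
  by rewrite entry_even entry_odd -coordE; apply: natceil_pm_diff.
have e2 : `|(ones (coin_class N) A c)%:R - (ones (coin_class N) A c.+1)%:R| <= tau :> R.
  have := quiet j; rewrite -ltNge /walk.
  have -> : 2 * (ones (coin_class N) A c)%:R - (n * N)%:R -
    (2 * (ones (coin_class N) A c.+1)%:R - (n * N)%:R) =
    2 * ((ones (coin_class N) A c)%:R - (ones (coin_class N) A c.+1)%:R) :> R by ring.
  rewrite normrM (ger0_norm (_ : 0 <= 2)) // => h; lra.
set o1 := (ones _ A c)%:R in e2 *; set o2 := (ones _ A c.+1)%:R in e2 *.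
have -> : S - (S1 + o1 - (S2 + o2)) / K = - ((S1 - S2 - S * K) + (o1 - o2)) / K.
  by field; rewrite gt_eqF.
rewrite normrM normrN normfV (gtr0_norm K0) ler_pM2r ?invr_gt0 //.
by apply: le_trans (ler_normD _ _) _; apply: lerD.
Qed.

Lemma accuracy_of_bound (eta : R) : Num.sqrt d%:R * ((n%:R + tau) / K) < eta ->
  1 - beta P <= view_expectation encoder x (fun (pub : L.-tuple bool) m =>
      unif (fun priv : L.-tuple bool =>
        (l2norm (bucket_sum x y - estimate decoder pub priv m y) < eta)%R%:R)).
Proof.
move=> heta; rewrite (view_expectationE).
have d1 := d_ge1 adm; have b0 := beta_gt0 adm.
have t0 : L.-tuple bool := [tuple of nseq L false].
(* Half of beta is spent on collisions here; the other half is left for the noise, uniformly in the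
   public bits. *)
apply: (@le_trans _ _ (unif (fun pub : L.-tuple bool =>
   (-1) * (collides pub)%:R + (1 - beta P / 2)))).
  by rewrite (unif_affine t0); have := collides_prob; lra.
apply: unif_le => pub; set C := 2 ^+ _.
have C0 : 0 < C by rewrite exprn_gt0.
rewrite ler_pdivlMr //.
set F := fun m : seq nat => _.
have F01 m : 0 <= F m <= 1.
  rewrite /F; apply/andP; split.
    rewrite -[leLHS](unif_const t0); apply: unif_le => p; exact: ler0n.
  rewrite -[leRHS](unif_const t0); apply: unif_le => p.
  by case: (_ < _)%R; rewrite ?ler01 ?lexx.
(* Outcome by outcome, the success probability over the shuffle and the decoder's coins is at least
   1 minus the number of bad events. *)
apply: (@le_trans _ _ (\sum_(A : {set 'I_n * 'I_L})
   (1 - (collides pub)%:R - \sum_(j < d)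
      (noisy A (base P (tape pub) y + j.*2))%:R))).
  rewrite big_split /= sumrN sumr_const exchange_big /=.
  have h : \sum_(j < d) \sum_(A : {set 'I_n * 'I_L})
      (noisy A (base P (tape pub) y + j.*2))%:R <= C * (beta P / 2).
    apply: (@le_trans _ _ (\sum_(j < d) C * (beta P / (2 * d%:R)))).
      apply: ler_sum => j _; apply: noisy_sum; rewrite -addnS; apply: base_lt.
      by have := ltn_ord j; rewrite -doubleS -leq_double => h; apply: leq_trans h.
    rewrite sumr_const card_ord -[_ *+ _]mulr_natl.
    rewrite le_eqVlt; apply/orP; left; apply/eqP; field; rewrite gt_eqF //; lra.
  have -> : #|{set 'I_n * 'I_L}| = (2 ^ #|{: 'I_n * 'I_L}|)%N.
    by rewrite -cardsT -powersetT card_powerset cardsT.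
  by rewrite -[X in _ <= X - _]mulr_natl natrX -/C; lra.
apply: ler_sum => A _; set m := all_messages _ _ _ _.
have SM0 : 0 <= shuffle_mean F m by case/andP: (shuffle_mean01 m F01).
case: (boolP (collides pub)) => nc /=; rewrite ?mulr1n ?mulr0n.
  have : 0 <= \sum_(j < d) (noisy A (base P (tape pub) y + j.*2))%:R :> R.
    by apply: sumr_ge0.
  by lra.
case: (boolP [exists j : 'I_d, noisy A (base P (tape pub) y + j.*2)]).
  case/existsP => j hj; rewrite (bigD1 j) //= hj /= mulr1n.
  have : 0 <= \sum_(i < d | i != j) (noisy A (base P (tape pub) y + i.*2))%:R :> R.
    by apply: sumr_ge0.
  by lra.
rewrite negb_exists => /forallP quiet.
rewrite big1; last by move=> j _; rewrite (negbTE (quiet j)).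
have -> : shuffle_mean F m = 1; last by lra.
rewrite /shuffle_mean -[RHS](unif_const (1%g : 'S_(size m))) /unif; congr (_ / _); apply: eq_bigr => s _.
rewrite /F -[RHS](unif_const t0) /unif; congr (_ / _); apply: eq_bigr => dp _.
by rewrite (le_lt_trans (estimate_error dp s nc quiet) heta).
Qed.

End Accuracy.

(** * Size of the error in terms of the parameters *)

Section ErrorBound.
Variables (R : realType) (eps0 : R) (P : params R).
Hypothesis adm : admissible eps0 P.
Local Notation n := (nusers P).
Local Notation d := (dim P).
Local Notation T := (nbuckets P).
Local Notation K := (scale P).

Definition log_term : R := ln ((d * T)%N%:R / (delta P * beta P)).

Lemma ln_le_log_term (z : R) : 0 < z -> z * (delta P * beta P) <= (d * T)%N%:R ->
  ln z <= log_term.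
Proof.
move=> z0 h; have db : 0 < delta P * beta P.
  by rewrite mulr_gt0 ?(delta_gt0 adm) ?(beta_gt0 adm).
rewrite ler_ln ?posrE //; last first.
  rewrite divr_gt0 // ltr0n muln_gt0.
  by case: adm => -[_ -> ->].
by rewrite ler_pdivlMr.
Qed.

Let db_le : delta P * beta P <= delta P /\ delta P * beta P <= beta P.
Proof.
have := delta_gt0 adm; have := delta_lt1 adm; have := beta_gt0 adm.
by have := beta_lt1 adm => *; split; nra.
Qed.

Let dT_ge : 1 <= (d * T)%N%:R :> R /\ d%:R <= (d * T)%N%:R :> R.
Proof.
have [h1 h2] : (0 < d)%N /\ (0 < T)%N by case: adm => -[].
by rewrite ler1n muln_gt0 h1 h2 ler_nat leq_pmulr.
Qed.

Lemma log_term_ge0 : 0 <= log_term.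
Proof.
rewrite -(ln1 R); apply: ln_le_log_term => //; rewrite mul1r.
by have [h _] := db_le; have [h' _] := dT_ge; have := delta_lt1 adm; lra.
Qed.

Lemma ln_delta_le : ln (1 / delta P) <= log_term.
Proof.
have d0 := delta_gt0 adm; apply: ln_le_log_term; first by rewrite divr_gt0.
rewrite mulrA divfK ?gt_eqF // mul1r.
by have [h _] := dT_ge; have := beta_lt1 adm; lra.
Qed.

Lemma ln_dim_le : ln (4 * d%:R / beta P) <= 2 * (1 + log_term).
Proof.
have b0 := beta_gt0 adm; have d1 := d_ge1 adm.
have q0 : 0 < d%:R / beta P by rewrite divr_gt0 //; lra.
have -> : 4 * d%:R / beta P = 2 * (2 * (d%:R / beta P)) by ring.
have q2 : 0 < 2 * (d%:R / beta P) by rewrite mulr_gt0.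
rewrite lnM ?posrE // lnM ?posrE //.
have h : ln (d%:R / beta P) <= log_term.
  apply: ln_le_log_term => //; have [_ h2] := dT_ge.
  have -> : d%:R / beta P * (delta P * beta P) = delta P * d%:R.
    by field; rewrite gt_eqF.
  apply: le_trans h2; rewrite ler_piMl // ltW //; exact: delta_lt1 adm.
by have := ln2_le1 R; have := log_term_ge0; lra.
Qed.

Lemma delta_bits_le : (delta_bits P)%:R <= 4 * (1 + log_term).
Proof.
have d0 := delta_gt0 adm; have d1 := delta_lt1 adm.
have h1 : 1 <= 2%:R / delta P by rewrite ler_pdivlMr // mul1r; lra.
have := log2up_le_ln h1; rewrite -/(delta_bits P).
have -> : 2%:R / delta P = 2 * (1 / delta P) by ring.
rewrite lnM ?posrE ?divr_gt0 //.
by have := ln2_le1 R; have := ln_delta_le; have := log_term_ge0; lra.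
Qed.

(** Under the square root stand two logarithms, one from delta in the number of flips and one from
    beta and d in the tail. Both are O(1 + [log_term]), so a single power of the logarithm comes
    out. The flips added by rounding up number at most n <= [flips P]. *)
Lemma tau_le : tau P <= 512 * (T%:R * K * inflation P * (1 + log_term)).
Proof.
have T1 := T_ge1 adm; have e1 := inflation_ge1 adm; have l0 := log_term_ge0.
have K1 : 1 <= K by have := scale_ge_n adm; have := n_ge1 adm; lra.
set U := T%:R * K * inflation P.
have KU : K <= U.
  rewrite /U -mulrA mulrCA ler_peMr ?mulr_ege1 //; lra.
have U1 : 1 <= U by lra.
have fl : flips P = 32 * 64 * U ^+ 2 * (delta_bits P)%:R by [].
have g1 := delta_bits_ge1 adm; have g2 := delta_bits_le.
have UU : U <= U ^+ 2 by rewrite expr2; nra.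
have U2 : 0 <= U ^+ 2 by lra.
have nfl : n%:R <= flips P.
  apply: le_trans (scale_ge_n adm) (le_trans KU _); rewrite fl.
  have : U ^+ 2 * 1 <= U ^+ 2 * (delta_bits P)%:R by rewrite ler_wpM2l.
  by lra.
have m2 := flips_ge adm.
set v := U * (1 + log_term); have v0 : 0 <= v by rewrite mulr_ge0 //; lra.
have w0 : 0 <= 256 * v by rewrite mulr_ge0.
have -> : 512 * v = 2 * (256 * v) by ring.
rewrite /tau ler_pM2l // -(ger0_norm w0) -sqrtr_sqr ler_sqrt ?sqr_ge0 //.
have a1 := ln_dim_le; have a0 := ln4d_ge0 adm.
apply: (@le_trans _ _ ((2 * flips P) * (2 * (1 + log_term)))).
  by apply: ler_pM => //; lra.
have a3 : U ^+ 2 * (delta_bits P)%:R <= U ^+ 2 * (4 * (1 + log_term)).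
  by rewrite ler_wpM2l.
have a4 : (1 + log_term) * (U ^+ 2 * (delta_bits P)%:R) <=
    (1 + log_term) * (U ^+ 2 * (4 * (1 + log_term))) by rewrite ler_wpM2l //; lra.
have -> : (256 * v) ^+ 2 = 256 * 256 * ((1 + log_term) * (U ^+ 2 * (1 + log_term))).
  by rewrite /v; ring.
have a5 : 0 <= (1 + log_term) * (U ^+ 2 * (1 + log_term)).
  by rewrite mulr_ge0 ?(mulr_ge0 U2) //; lra.
rewrite fl; have -> : 2 * (32 * 64 * U ^+ 2 * (delta_bits P)%:R) *
    (2 * (1 + log_term)) =
  32 * 64 * 4 * ((1 + log_term) * (U ^+ 2 * (delta_bits P)%:R)) by ring.
move: a4 a5; have -> : (1 + log_term) * (U ^+ 2 * (4 * (1 + log_term))) =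
  4 * ((1 + log_term) * (U ^+ 2 * (1 + log_term))) by ring.
move: ((1 + log_term) * (U ^+ 2 * (1 + log_term))) => B.
move: ((1 + log_term) * (U ^+ 2 * (delta_bits P)%:R)) => A; lra.
Qed.

Lemma error_boundE a : error_bound a 1 P =
  a%:R * (T%:R * Num.sqrt d%:R / eps P) * (1 + log_term).
Proof. by rewrite /error_bound expr1. Qed.

Lemma sqrt_d_ge1 : 1 <= Num.sqrt d%:R :> R.
Proof. by rewrite -[leLHS]sqrtr1 ler_sqrt // (d_ge1 adm). Qed.

(** Noise contributes 512, rounding 1 because n <= K, and one more makes the inequality strict. The
    factor 1 + eps0 comes from eps * [inflation P] = 1 + eps. *)
Lemma error_small a : 514 * (1 + eps0) <= a%:R ->
  Num.sqrt d%:R * ((n%:R + tau P) / K) < error_bound a 1 P.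
Proof.
move=> ha; have K0 := scale_gt0 adm; have T1 := T_ge1 adm; have s1 := sqrt_d_ge1.
have e1 := inflation_ge1 adm; have l0 := log_term_ge0; have eps1 := eps_gt0 adm.
have eps2 : eps P <= eps0 by case: adm => _ /andP[].
set V := T%:R * inflation P * (1 + log_term).
have V1 : 1 <= V.
  by rewrite mulr_ege1 //; [rewrite mulr_ege1|lra].
have h1 : (n%:R + tau P) / K <= 513 * V.
  rewrite ler_pdivrMr //; have := tau_le; have := scale_ge_n adm.
  have : 1 * K <= V * K by rewrite ler_pM2r.
  have -> : T%:R * K * inflation P * (1 + log_term) = V * K by rewrite /V; ring.
  by lra.
apply: (@le_lt_trans _ _ (Num.sqrt d%:R * (513 * V))).
  by rewrite ler_wpM2l // sqrtr_ge0.
apply: (@lt_le_trans _ _ (Num.sqrt d%:R * (514 * V))).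
  by rewrite ltr_pM2l; lra.
rewrite error_boundE.
have h2 : 514 * inflation P <= a%:R / eps P.
  rewrite ler_pdivlMr // /inflation.
  have -> : 514 * (1 + 1 / eps P) * eps P = 514 * (1 + eps P).
    by field; rewrite gt_eqF.
  by lra.
have w0 : 0 <= Num.sqrt d%:R * (T%:R * (1 + log_term)).
  by rewrite mulr_ge0 ?sqrtr_ge0 // mulr_ge0 //; lra.
have := ler_wpM2l w0 h2; rewrite /V.
have -> : a%:R * (T%:R * Num.sqrt d%:R / eps P) * (1 + log_term) =
  Num.sqrt d%:R * (T%:R * (1 + log_term)) * (a%:R / eps P) by ring.
have -> // : Num.sqrt d%:R * (514 * (T%:R * inflation P * (1 + log_term))) =
  Num.sqrt d%:R * (T%:R * (1 + log_term)) * (514 * inflation P) by ring.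
Qed.

Lemma error_large a : (0 < a)%N -> n%:R * eps P < 1 -> n%:R < error_bound a 1 P.
Proof.
move=> a0 hn; have T1 := T_ge1 adm; have s1 := sqrt_d_ge1.
have l0 := log_term_ge0; have eps1 := eps_gt0 adm.
have h1 : n%:R < 1 / eps P by rewrite ltr_pdivlMr.
apply: (lt_le_trans h1); rewrite error_boundE.
have -> : a%:R * (T%:R * Num.sqrt d%:R / eps P) * (1 + log_term) =
  (a%:R * (T%:R * Num.sqrt d%:R) * (1 + log_term)) / eps P by ring.
rewrite ler_pM2r ?invr_gt0 // mulr_ege1 //; last by lra.
by rewrite mulr_ege1 ?ler1n // mulr_ege1.
Qed.

End ErrorBound.

(* When [n * eps < 1] the permitted error exceeds [n], so silence is accurate. *)
Section Silence.
Variables (R : realType) (P : params R) (L : nat).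
Hypothesis small : (nusers P)%:R * eps P < 1.
Hypothesis L_ge : (2 <= L)%N.
Local Notation n := (nusers P).

Lemma silent_run (pub priv : L.-tuple bool) (u : user P) :
  halts_within L encoder (enc_init pub priv u) /\ messages encoder pub priv u = [::].
Proof.
have [t [s' [h1 h2 h3]]] := encoder_trivial pub priv u small.
by rewrite /halts_within /messages (big_run h1 (leq_trans h2 L_ge)).
Qed.

Lemma silent_messages (x : dataset P) (pub : L.-tuple bool) priv :
  all_messages encoder x pub priv = [::].
Proof.
rewrite /all_messages; elim: (enum _) => //= i l ->.
by have [_ ->] := silent_run pub (priv i) (x i).
Qed.

Lemma silent_view (x : dataset P) (F : L.-tuple bool -> seq nat -> R) :
  view_expectation encoder x F = unif (fun pub => shuffle_mean (F pub) [::]).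
Proof.
rewrite /view_expectation /unif; congr (_ / _); apply: eq_bigr => pub _.
pose p0 : {ffun 'I_n -> L.-tuple bool} := [ffun=> [tuple of nseq L false]].
rewrite -[RHS](unif_const p0) /unif; congr (_ / _); apply: eq_bigr => priv _.
rewrite -[LHS]/(shuffle_mean (F pub) (all_messages encoder x pub priv)).
by rewrite silent_messages.
Qed.

Lemma silent_decoder (pub priv : L.-tuple bool) msgs (y : 'I_(universe P)) :
  halts_within L decoder (dec_init pub priv msgs y) /\
  estimate decoder pub priv msgs y = 0.
Proof.
have [t [s' [h1 h2 h3]]] := decoder_trivial pub priv msgs y small.
rewrite /halts_within /estimate (big_run h1 (leq_trans h2 L_ge)); split=> //.
by apply/rowP => j; rewrite !mxE h3.
Qed.

Lemma silent_dp : 0 < eps P -> 0 < delta P -> shuffle_dp P L encoder.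
Proof.
move=> e0 d0 x x' _ _ _ E; rewrite !silent_view; set v := unif _.
have v0 : 0 <= v.
  rewrite /v -[leLHS](unif_const [tuple of nseq L false]); apply: unif_le => pub.
  have E01 m : 0 <= ((E pub m)%:R : R) <= 1.
    by case: (E pub m); rewrite ?ler01 ?lexx.
  by case/andP: (shuffle_mean01 [::] E01).
have : 1 * v <= expR (eps P) * v.
  by rewrite ler_wpM2r // -[leLHS]expR0 ler_expR ltW.
by lra.
Qed.

(** Cauchy-Schwarz in each coordinate bounds the squared norm by n times the sum of the squared
    norms, which stands in for a triangle inequality. *)
Lemma l2norm_bucket_sum (x : dataset P) y : valid_dataset x ->
  l2norm (bucket_sum x y) <= n%:R.
Proof.
move=> vx; rewrite /l2norm -[leRHS]ger0_norm // -sqrtr_sqr ler_sqrt ?sqr_ge0 //.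
apply: (@le_trans _ _ (\sum_(j < dim P) n%:R * \sum_(i < n) vec (x i) 0 j ^+ 2)).
  apply: ler_sum => j _; rewrite /bucket_sum summxE.
  apply: le_trans (sqr_sum_le (fun i => y \in buckets (x i)) _) _.
  apply: ler_pM => //; first by apply: sumr_ge0 => i _; apply: sqr_ge0.
    by rewrite ler_nat -[X in (_ <= X)%N]card_ord max_card.
  rewrite [leRHS](bigID (fun i => y \in buckets (x i))) /= lerDl.
  by apply: sumr_ge0 => i _; apply: sqr_ge0.
rewrite -mulr_sumr exchange_big /= expr2 ler_wpM2l //.
apply: (@le_trans _ _ (\sum_(i < n) 1)); last by rewrite sumr_const card_ord.
by apply: ler_sum => i _; case: (vx i) => _ /l2norm_le1.
Qed.

Lemma silent_accurate eta : n%:R < eta -> 0 < beta P ->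
  accurate P L encoder decoder eta.
Proof.
move=> he b0 x y vx; rewrite silent_view.
apply: (@le_trans _ _ 1); first by lra.
rewrite -[leLHS](unif_const [tuple of nseq L false]); apply: unif_le => pub.
rewrite /shuffle_mean -[leLHS](unif_const (1%g : 'S_(size (Nil nat)))).
apply: unif_le => s.
rewrite -[leLHS](unif_const [tuple of nseq L false]); apply: unif_le => dp.
have [_ ->] := silent_decoder pub dp (shuffle s) y.
by rewrite subr0 (le_lt_trans (l2norm_bucket_sum y vx) he).
Qed.

End Silence.

(** * Running time *)

Section RunningTime.
Variables (R : realType) (eps0 : R).
Hypothesis eps0_gt0 : 0 < eps0.

(** The coefficient met in [coins_le]: with T <= Z, K <= 32 Z^2 and inflation <= 2Z, the squared
    product is (64 Z^4)^2, and delta contributes the factor (6 + 2 eps0) Z. The 34 absorbs rounding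
    up. *)
Definition growth : R := 32 * 64 * (64 * 64) * (6 + 2 * eps0) + 34.

Variable P : params R.
Hypothesis adm : admissible eps0 P.
Hypothesis large : 1 <= (nusers P)%:R * eps P.
Local Notation n := (nusers P).
Local Notation d := (dim P).
Local Notation T := (nbuckets P).
Local Notation K := (scale P).

Definition size_param : R :=
  1 + (n * d * T)%N%:R / beta P
    + Num.max 0 (ln ((universe P)%:R / (eps P * delta P))).
Local Notation Z := size_param.

Let lnmax_ge0 : 0 <= Num.max 0 (ln ((universe P)%:R / (eps P * delta P))).
Proof. by rewrite le_max lexx. Qed.

Let Q := (n * d * T)%N%:R / beta P.

Let Q_ge : (n * d * T)%N%:R <= Q.
Proof.
rewrite /Q ler_peMr // invf_ge1 ?(beta_gt0 adm) //; exact: ltW (beta_lt1 adm).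
Qed.

Lemma size_param_ge1 : 1 <= Z.
Proof.
rewrite /size_param -/Q; have h := Q_ge; have h2 := lnmax_ge0.
have h3 : 0 <= (n * d * T)%N%:R :> R by []; lra.
Qed.

Let Q_le : Q <= Z.
Proof. by rewrite /size_param -/Q; have := lnmax_ge0; lra. Qed.

Lemma nat_params_le : [/\ n%:R <= Z, d%:R <= Z & T%:R <= Z].
Proof.
have [n0 d0 T0] : [/\ (0 < n)%N, (0 < d)%N & (0 < T)%N] by case: adm => -[].
have h k : (k <= n * d * T)%N -> k%:R <= Z.
  by rewrite -(ler_nat R) => hk; have := Q_ge; have := Q_le; lra.
split; apply: h.
- by rewrite -mulnA leq_pmulr // muln_gt0 d0.
- by rewrite mulnAC leq_pmull // muln_gt0 n0.
- by rewrite leq_pmull // muln_gt0 n0.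
Qed.

Let nT_le_Z : n%:R * T%:R / beta P <= Z /\ d%:R * (n%:R * T%:R / beta P) <= Z.
Proof.
have b0 := beta_gt0 adm; have d1 := d_ge1 adm.
have e : d%:R * (n%:R * T%:R / beta P) = Q by rewrite /Q !natrM; ring.
have q0 : 0 <= n%:R * T%:R / beta P by rewrite divr_ge0 ?mulr_ge0 // ltW.
have h := Q_le; split; last by rewrite e.
apply: le_trans h; rewrite -e; have := ler_wpM2r q0 d1; lra.
Qed.

Lemma scale_le : K <= 32 * Z ^+ 2.
Proof.
have [_ dZ _] := nat_params_le; have [_ h] := nT_le_Z; have Z1 := size_param_ge1.
rewrite scaleE.
have -> : 32 * d%:R ^+ 2 * (n%:R * T%:R / beta P) =
  32 * (d%:R * (d%:R * (n%:R * T%:R / beta P))) by ring.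
rewrite ler_pM2l // expr2; apply: ler_pM => //.
by rewrite mulr_ge0 // divr_ge0 ?mulr_ge0 // ltW // (beta_gt0 adm).
Qed.

Lemma ncodes_le_Z : (ncodes P)%:R <= 8 * Z.
Proof.
have := ncodes_le adm; have [_ h] := nT_le_Z; rewrite -mulrA; lra.
Qed.

Lemma cell_bits_le : (cell_bits P)%:R <= 8 * Z.
Proof.
apply: le_trans ncodes_le_Z; rewrite ler_nat /ncodes.
have d0 : (0 < d)%N by case: adm => -[].
apply: leq_trans (ltnW (ltn_expl _ (isT : 1 < 2)%N)) _.
by apply: leq_pmulr; rewrite double_gt0.
Qed.

(** The time bound sees |Y|, eps and delta only through one quotient. Splitting its logarithm costs
    ln eps, which is at most eps0 even when eps exceeds 1. *)
Lemma log_params_le : 0 <= ln ((universe P)%:R : R) /\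
  ln ((universe P)%:R : R) + ln (1 / delta P) <= Z + eps0.
Proof.
have U1 : 1 <= (universe P)%:R :> R by case: adm => -[_ _ _ h *]; rewrite ler1n.
have e0 := eps_gt0 adm; have d0 := delta_gt0 adm.
have e1 : eps P <= eps0 by case: adm => _ /andP[].
split; first exact: ln_ge0.
have h1 : ln (eps P) <= eps0.
  apply: le_trans e1; rewrite ltW // ln_sublinear //.
have U0 : 0 < (universe P)%:R :> R by lra.
have h2 : ln ((universe P)%:R / (eps P * delta P)) =
   ln ((universe P)%:R : R) + ln (1 / delta P) - ln (eps P).
  rewrite ln_div ?posrE ?mulr_gt0 // lnM ?posrE // div1r lnV ?posrE //; ring.
have h3 : ln ((universe P)%:R / (eps P * delta P)) <= Z.
  rewrite /size_param -/Q.
  have : ln ((universe P)%:R / (eps P * delta P)) <=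
    Num.max 0 (ln ((universe P)%:R / (eps P * delta P))) by rewrite le_max lexx orbT.
  by have := Q_ge; have : 0 <= (n * d * T)%N%:R :> R by []; lra.
by lra.
Qed.

Let ln_delta_ge0 : 0 <= ln (1 / delta P).
Proof.
apply: ln_ge0; rewrite ler_pdivlMr ?(delta_gt0 adm) // mul1r.
by rewrite ltW // (delta_lt1 adm).
Qed.

Lemma key_bits_le : (key_bits P)%:R <= (6 + 2 * eps0) * Z.
Proof.
have U1 : 1 <= (universe P)%:R :> R by case: adm => -[_ _ _ h *]; rewrite ler1n.
have [h1 h2] := log_params_le; have h3 := ln_delta_ge0; have Z1 := size_param_ge1.
have := log2up_le_ln U1; rewrite -/(key_bits P).
by have := eps0_gt0 => *; nra.
Qed.

Lemma delta_bits_le_Z : (delta_bits P)%:R <= (6 + 2 * eps0) * Z.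
Proof.
have [h1 h2] := log_params_le; have h3 := ln_delta_ge0; have Z1 := size_param_ge1.
have d0 := delta_gt0 adm; have d1 := delta_lt1 adm.
have h4 : 1 <= 2%:R / delta P by rewrite ler_pdivlMr // mul1r; lra.
have := log2up_le_ln h4; rewrite -/(delta_bits P).
have -> : 2%:R / delta P = 2 * (1 / delta P) by ring.
rewrite lnM ?posrE ?divr_gt0 //.
by have := ln2_le1 R; have := eps0_gt0 => *; nra.
Qed.

(** Here [large] is essential: it bounds 1/eps by n, hence the inflation by 2Z, and keeps the number
    of coins polynomial. *)
Lemma coins_le : (coins P)%:R <= growth * Z ^+ 9.
Proof.
have [nZ dZ TZ] := nat_params_le; have Z1 := size_param_ge1.
have n1 := n_ge1 adm; have eps1 := eps_gt0 adm.
have e1 : inflation P <= 2 * Z.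
  have : 1 / eps P <= n%:R by rewrite ler_pdivrMr.
  by rewrite /inflation; lra.
have i1 := inflation_ge1 adm; have T1 := T_ge1 adm; have K0 := scale_gt0 adm.
have h1 : T%:R * K * inflation P <= Z * (32 * Z ^+ 2) * (2 * Z).
  apply: ler_pM => //; [by rewrite mulr_ge0 // ltW|by lra|].
  by apply: ler_pM => //; [exact: ltW|exact: scale_le].
have f1 := flips_ge1 adm.
have h2 : flips P <= 32 * 64 * (Z * (32 * Z ^+ 2) * (2 * Z)) ^+ 2 * ((6 + 2 * eps0) * Z).
  have u0 : 0 <= T%:R * K * inflation P.
    by apply: mulr_ge0; [exact: mulr_ge0 (ler0n _ _) (ltW K0)|lra].
  rewrite /flips; apply: ler_pM => //; last exact: delta_bits_le_Z.
    by apply: mulr_ge0; [lra|exact: sqr_ge0].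
  rewrite ler_pM2l; last by lra.
  by rewrite ler_sqr ?nnegrE //; apply: le_trans h1.
have q0 : 0 <= flips P / n%:R by rewrite divr_ge0 //; lra.
have := natceil_lt q0; rewrite -coinsE.
have h3 : flips P / n%:R <= flips P.
  by rewrite ler_pdivrMr; [rewrite ler_peMr //; lra|lra].
have h4 : 1 <= Z ^+ 9 by rewrite exprn_ege1.
have -> : growth * Z ^+ 9 = 32 * 64 * (Z * (32 * Z ^+ 2) * (2 * Z)) ^+ 2 *
   ((6 + 2 * eps0) * Z) + 34 * Z ^+ 9 by rewrite /growth; ring.
by lra.
Qed.

Lemma time_polynomial (b kh g ell t dd kk nc co : nat) : (1 <= b)%N ->
  [/\ kh <= b, g <= b & ell <= b]%N -> [/\ t <= b, dd <= b & kk <= b]%N ->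
  [/\ nc <= b & co <= b]%N ->
  (kh * 4 + g * 4 + ell * 4 + t * (hash_time kh ell + vector_time dd kk + 6)
     + nc * (co * 9 + 9) + 40 <= 160 * b ^ 3)%N.
Proof.
move=> b1 [h1 h2 h3] [h4 h5 h6] [h7 h8]; rewrite /hash_time /vector_time.
apply: (@leq_trans (b * 4 + b * 4 + b * 4 + b * (b * (b * 16 + 21) + 10 +
   (b * (b * 8 + 20) + 3) + 6) + b * (b * 9 + 9) + 40)).
  by rewrite !(leq_add, leq_mul).
have b2 : (b <= b * b)%N by rewrite leq_pmulr.
have b3 : (b * b <= b * b * b)%N by rewrite leq_pmulr.
by rewrite !expnS expn0 muln1; nia.
Qed.

Lemma bounded_by_size (k : nat) : k%:R <= growth * Z ^+ 9 ->
  (k <= natceil (growth * Z ^+ 9))%N.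
Proof. by move=> h; rewrite -(ler_nat R); apply: le_trans (natceil_ge _). Qed.

(** The decoder scans all messages, at most n times the encoder's time, once per coordinate; these
    two factors raise the degree from 3 to 5. *)
Lemma enc_time_le : (enc_time P <= 160 * natceil (growth * Z ^+ 9) ^ 3)%N /\
  (dec_time P (n * enc_time P) <= 1700 * natceil (growth * Z ^+ 9) ^ 5)%N.
Proof.
have Z1 := size_param_ge1; have e0 := eps0_gt0.
have [nZ dZ TZ] := nat_params_le.
set b := natceil _.
have ZZ k : (k <= 9)%N -> Z ^+ k <= Z ^+ 9 by move=> h; rewrite ler_weXn2l.
have Z9 := ZZ 1%N isT; rewrite expr1 in Z9.
have Z2 := ZZ 2%N isT.
have lin (k : nat) c : 0 <= c -> c <= growth -> k%:R <= c * Z -> (k <= b)%N.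
  move=> c0 cg h; apply: bounded_by_size; apply: le_trans h _.
  apply: ler_pM => //; lra.
have G : 8 <= growth /\ 6 + 2 * eps0 <= growth by rewrite /growth; split; lra.
have b1 : (1 <= b)%N by apply: (lin 1%N 1); rewrite ?mul1r; lra.
have hkh : (cell_bits P <= b)%N by apply: (lin _ 8) cell_bits_le; lra.
have hg : (delta_bits P <= b)%N by apply: (lin _ _ _ _ delta_bits_le_Z); lra.
have hell : (key_bits P <= b)%N by apply: (lin _ _ _ _ key_bits_le); lra.
have hn : (n <= b)%N by apply: (lin _ 1); rewrite ?mul1r //; lra.
have hd : (d <= b)%N by apply: (lin _ 1); rewrite ?mul1r //; lra.
have hT : (T <= b)%N by apply: (lin _ 1); rewrite ?mul1r //; lra.
have hnc : (ncodes P <= b)%N by apply: (lin _ 8) ncodes_le_Z; lra.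
have hco : (coins P <= b)%N := bounded_by_size coins_le.
have hK : (natceil K <= b)%N.
  apply: bounded_by_size; apply: (@le_trans _ _ (32 * Z ^+ 9 + 1)).
    have := natceil_lt (ltW (scale_gt0 adm)); have := scale_le; lra.
  have : (33 : R) * Z ^+ 9 <= growth * Z ^+ 9.
    by rewrite ler_wpM2r ?exprn_ge0 //; rewrite /growth; lra.
  have z1 : 1 <= Z ^+ 9 by rewrite exprn_ege1.
  by lra.
have enc : (enc_time P <= 160 * b ^ 3)%N.
  by apply: time_polynomial.
split=> //.
have M : (n * enc_time P <= b * (160 * b ^ 3))%N by apply: leq_mul.
have poly : (dec_time P (n * enc_time P) <= b * 4 + b * 4 + (b * (b * 16 + 21) + 10) +
   b * (b * (160 * b ^ 3) * 9 + 20) + 40)%N.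
  rewrite /dec_time /hash_time; move: M.
  move: (n * enc_time P)%N (b * (160 * b ^ 3))%N => M1 M2 M12.
  by rewrite !(leq_add, leq_mul).
apply: leq_trans poly _.
have b2 : (b <= b * b)%N by rewrite leq_pmulr.
have b3 : (b * b <= b ^ 5)%N.
  by rewrite -[(b * b)%N]/(b ^ 2)%N; apply: leq_pexp2l.
have b4 : (b * (b * (160 * b ^ 3) * 9) = 1440 * b ^ 5)%N.
  by rewrite !expnS expn0; ring.
by rewrite [(b * (_ * 9 + 20))%N]mulnDr b4; move: b2 b3; move: (b ^ 5)%N => B; clear -b1; nia.
Qed.

(** The exponent 45 is 9 * 5: degree 5 in a quantity of degree 9 in Z. *)
Lemma time_bound_ge c : (45 <= c)%N -> 1700 * (2 * growth) ^+ 5 <= c%:R ->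
  (enc_time P <= time_bound c P)%N /\
  (dec_time P (n * enc_time P) <= time_bound c P)%N.
Proof.
move=> c45 hc; have [h1 h2] := enc_time_le; set b := natceil _ in h1 h2.
have Z1 := size_param_ge1.
have g1 : 1 <= growth by rewrite /growth; have := eps0_gt0; lra.
have gz : 1 <= growth * Z ^+ 9 by rewrite mulr_ege1 // exprn_ege1.
have bb : b%:R <= 2 * growth * Z ^+ 9.
  have g0 : 0 <= growth * Z ^+ 9 by lra.
  by have := natceil_lt g0; rewrite -/b; lra.
have main : (1700 * b ^ 5 <= time_bound c P)%N.
  rewrite /time_bound -/(size_param) truncn_ge_nat; last first.
    by rewrite mulr_ge0 // exprn_ge0 //; lra.
  rewrite natrM natrX.
  apply: (@le_trans _ _ (1700 * (2 * growth * Z ^+ 9) ^+ 5)).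
    by rewrite ler_pM2l // lerXn2r ?nnegrE //; lra.
  rewrite [X in 1700 * X]exprMn mulrA -exprM; apply: ler_pM => //.
  - by rewrite mulr_ge0 // exprn_ge0 //; lra.
  - by rewrite exprn_ge0 //; lra.
  - by rewrite ler_weXn2l.
split; apply: leq_trans main => //; apply: leq_trans h1 _.
have b1 : (0 < b)%N by rewrite ltn_natceil; lra.
by apply: leq_mul => //; apply: leq_pexp2l.
Qed.

End RunningTime.

Theorem theorem9 (R : realType) (eps0 : R) (heps0 : 0 < eps0) :
  exists (enc dec : cmd) (a k c : nat),
  forall P : params R, admissible eps0 P ->
  let L := time_bound c P in
  [/\ shuffle_dp P L enc,
      accurate P L enc dec (error_bound a k P),
      enc_in_time P L enc
    & dec_in_time P L enc dec].
Proof.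
pose a := natceil (514 * (1 + eps0)).
pose c := (natceil (1700 * (2 * growth eps0) ^+ 5) + 45)%N.
have a_ge : 514 * (1 + eps0) <= a%:R := natceil_ge _.
have a_gt0 : (0 < a)%N by rewrite ltn_natceil; lra.
have c_ge : 1700 * (2 * growth eps0) ^+ 5 <= c%:R.
  by apply: le_trans (natceil_ge _) _; rewrite ler_nat leq_addr.
exists encoder, decoder, a, 1%N, c => P adm L.
have c45 : (45 <= c)%N by rewrite leq_addl.
have [small|large] := ltP ((nusers P)%:R * eps P) 1.
  have L2 : (2 <= L)%N.
    rewrite /L /time_bound truncn_ge_nat -/(size_param P); last first.
      by rewrite mulr_ge0 // exprn_ge0 //; have := size_param_ge1 adm; lra.
    apply: (@le_trans _ _ (c%:R * 1)).
      by rewrite mulr1 ler_nat (leq_trans _ c45).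
    by rewrite ler_wpM2l // exprn_ege1 // (size_param_ge1 adm).
  split.
  - exact: (silent_dp small L2 (eps_gt0 adm) (delta_gt0 adm)).
  - exact: (silent_accurate small L2 (error_large adm a_gt0 small) (beta_gt0 adm)).
  - by move=> u pub priv _; have [] := silent_run small L2 pub priv u.
  - by move=> x y pub dpriv priv s _; have [] := silent_decoder small L2 pub dpriv (shuffle s) y.
have [encL decL] := time_bound_ge heps0 adm large c45 c_ge.
split.
- exact: (encoder_dp adm large encL).
- move=> x y vx; apply: (accuracy_of_bound adm large encL decL y vx).
  exact: (error_small adm a_ge).
- by move=> u pub priv hu; have [] := messages_spec adm large encL pub priv hu.
- move=> x y pub dpriv priv s vx.
  have sz : (size (shuffle s) <= nusers P * enc_time P)%N.
    by rewrite (perm_size (perm_shuffle s)) (size_all_messages adm large encL vx).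
  by have [] := decoder_run adm large decL pub dpriv y sz.
Qed.
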